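(* Let $B$ be a paracompact topological space, $\mathcal{U}=\{U_i\}_{i\in I}$ a countable open cover of $B$, and $d\ge1$. Let $0\leq\epsilon\leq\sqrt2/4$ and let $\Omega\in\mathsf Z^1_\epsilon(\mathcal{U};O(d))$ be an $\epsilon$-approximate cocycle. Then there exists an exact cocycle $\Lambda\in\mathsf Z^1_0(\mathcal{U};O(d))$ such that $\mathsf{cl}(\Lambda)=\pi_*(\mathsf{cl}(\Omega))$ in $[B,\mathsf{Gr}(d)]$ and such that $\mathsf d_{\mathsf Z}(\Omega,\Lambda)\leq9\epsilon$.
   Context: Paracompact means Hausdorff and every open cover has a locally finite open refinement. $\|A\|=\sqrt{\mathrm{tr}(A^tA)}$ is the Frobenius norm; $O(d)$ carries the Frobenius distance. $[X,Y]$ is the set of homotopy classes of continuous maps. $\mathsf{Gr}(d,n)=\{A\in\mathbb{R}^{n\times n}: A=A^t=A^2,\ \mathrm{rank}\,A=d\}$, and $\mathsf V(d,n)$ is the set of real $n\times d$ matrices with orthonormal columns. $\mathsf{Gr}(d)$, $\mathsf V(d)$, $\mathbb{R}^{\infty\times\infty}$ are the unions over $n$ of $\mathsf{Gr}(d,n)$, $\mathsf V(d,n)$, $\mathbb{R}^{n\times n}$ (padding by zeros), with the direct limit topology. For $\epsilon>0$, $\mathsf{Gr}(d)^\epsilon\subseteq\mathbb{R}^{\infty\times\infty}$ is the set of matrices at Frobenius distance $<\epsilon$ from some element of $\mathsf{Gr}(d)$; $\mathsf{Gr}(d)^0=\mathsf{Gr}(d)$. If $\epsilon\leq\sqrt2/2$,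 every $A\in\mathsf{Gr}(d)^\epsilon$ has a unique Frobenius-closest point $\pi(A)\in\mathsf{Gr}(d)$, $\pi$ is a homotopy inverse of the inclusion $\mathsf{Gr}(d)\subseteq\mathsf{Gr}(d)^\epsilon$, and $\pi_*:[B,\mathsf{Gr}(d)^\epsilon]\to[B,\mathsf{Gr}(d)]$ is the induced bijection. $N(\mathcal{U})$ is the nerve of $\mathcal{U}$; write $(i_0\dots i_n)\in N(\mathcal{U})$ for an ordered list with $U_{i_n}\cap\dots\cap U_{i_0}\neq\emptyset$. $\mathsf Z^1_\epsilon(\mathcal{U};O(d))$ is the set of families of continuous maps $\Omega=\{\Omega_{ij}:U_j\cap U_i\to O(d)\}_{(ij)\in N(\mathcal{U})}$ with $\Omega_{ij}(y)=\Omega_{ji}(y)^{-1}$ and $\|\Omega_{ij}(y)\Omega_{jk}(y)-\Omega_{ik}(y)\|<\epsilon$ for all $(ijk)\in N(\mathcal{U})$ and $y\in U_k\cap U_j\cap U_i$; for $\epsilon=0$ one requires $\Omega_{ij}(y)\Omega_{jk}(y)=\Omega_{ik}(y)$ (exact cocycles). $\mathsf d_{\mathsf Z}(\Omega,\Lambda)=\sup_{(ij)\in N(\mathcal{U})}\sup_{y\in U_j\cap U_i}\|\Omega_{ij}(y)-\Lambda_{ij}(y)\|$. Construction of $\mathsf{cl}$. Choose a partition of unity $\phi=\{\phi_i\}_{i\in I}$ subordinate to $\mathcal{U}$ and an injection $\iota:I\to\{1,2,3,\dots\}$. For $\Omega\in\mathsf Z^1_\epsilon(\mathcal{U};O(d))$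 define $\Phi_i:U_i\to\mathsf V(d)$ by declaring, for each $j\in I$, the rows of $\Phi_i(y)$ from $d\,\iota(j)$ to $d(\iota(j)+1)-1$ to be $\sqrt{\phi_j(y)}\,\Omega_{ij}(y)^t$ (zero if $y\notin U_j$), all other rows zero. Then $\mathsf{cl}(\Omega)\in[B,\mathsf{Gr}(d)^{\sqrt2\epsilon}]$ is the homotopy class of $y\mapsto\sum_{i\in I}\phi_i(y)\,\Phi_i(y)\Phi_i(y)^t$; it does not depend on the choice of $\phi$ and $\iota$. *)

(* Defs.v *)
From HB Require Import structures.
From mathcomp Require Import all_boot all_order all_algebra.
From mathcomp Require Import all_classical all_reals all_analysis.

Set Implicit Arguments.
Unset Strict Implicit.
Unset Printing Implicit Defensive.

Import Order.TTheory GRing.Theory Num.Theory.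
Import numFieldNormedType.Exports.

Local Open Scope classical_set_scope.
Local Open Scope ring_scope.

Section Paracompact.
Context {T : topologicalType}.

Definition is_open_cover (C : set (set T)) :=
  (forall V, C V -> open V) /\ \bigcup_(V in C) V = setT.

Definition refines (D C : set (set T)) :=
  forall V, D V -> exists2 W, C W & V `<=` W.

Definition locally_finite (K : Type) (F : K -> set T) (A : set K) :=
  forall x : T, exists2 N, nbhs x N & finite_set [set k | A k /\ F k `&` N !=set0].

End Paracompact.

Definition paracompact (T : topologicalType) :=
  hausdorff_space T /\
  forall C : set (set T), is_open_cover C ->
    exists D : set (set T),
      [/\ is_open_cover D, refines D C & locally_finite id D].

(* Finitely supported infinite matrices: the union over n of the spaces of n x n
   matrices. Rows and columns are numbered from 0. *)
Record infmx (R : realType) := Infmx {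
  infmx_fun :> nat -> nat -> R;
  infmx_finsupp : exists n : nat, forall i j : nat,
    (n <= i)%N || (n <= j)%N -> infmx_fun i j = 0
}.

Section InfiniteMatrices.
Context {R : realType}.

Lemma infmxP (A B : infmx R) : (forall i j, A i j = B i j) -> A = B.
Proof.
case: A B => [A hA] [B hB] /= AB.
have E : A = B by apply/funext => i; apply/funext => j.
by subst B; congr Infmx; exact: Prop_irrelevance.
Qed.

HB.instance Definition _ := gen_eqMixin (infmx R).
HB.instance Definition _ := gen_choiceMixin (infmx R).

Lemma infmx0_finsupp : exists n : nat, forall i j : nat,
  (n <= i)%N || (n <= j)%N -> (fun _ _ : nat => 0 : R) i j = 0.
Proof. by exists 0%N. Qed.

HB.instance Definition _ := isPointed.Build (infmx R) (Infmx infmx0_finsupp).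

Definition pad_fun n (a : 'M[R]_n) (i j : nat) : R :=
  if (insub i, insub j) is (Some i', Some j') then a i' j' else 0.

Lemma pad_finsupp n (a : 'M[R]_n) : exists m : nat, forall i j : nat,
  (m <= i)%N || (m <= j)%N -> pad_fun a i j = 0.
Proof.
exists n => i j /orP[h|h]; rewrite /pad_fun.
  by rewrite insubF // ltnNge h.
by case: (insub i) => [i'|] //; rewrite insubF // ltnNge h.
Qed.

Definition pad n (a : 'M[R]_n) : infmx R := Infmx (pad_finsupp a).

(* The direct limit topology. *)
Definition dlim_open : set_system (infmx R) :=
  [set W | forall n, open ((@pad n) @^-1` W)].

Lemma dlim_openT : dlim_open setT.
Proof. by move=> n; rewrite preimage_setT; exact: openT. Qed.

Lemma dlim_openI : setI_closed dlim_open.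
Proof. by move=> A B hA hB n; rewrite preimage_setI; exact: openI. Qed.

Lemma dlim_open_bigU (K : Type) (f : K -> set (infmx R)) :
  (forall i, dlim_open (f i)) -> dlim_open (\bigcup_i f i).
Proof.
by move=> h n; rewrite preimage_bigcup; apply: bigcup_open => i _; exact: h.
Qed.

HB.instance Definition _ :=
  isOpenTopological.Build (infmx R) dlim_openT dlim_openI dlim_open_bigU.

Definition frob m n (a : 'M[R]_(m, n)) : R := Num.sqrt (\tr (a^T *m a)).

(* Frobenius distance: the square root of tr (C^t C), with C = A - B; both sums
   have finite support. *)
Definition frob_dist (A B : infmx R) : R :=
  Num.sqrt (\sum_(j \in [set: nat]) \sum_(i \in [set: nat]) (A i j - B i j) ^+ 2).

Definition grassmannian_fin (d n : nat) : set 'M[R]_n :=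
  [set a | [/\ a = a^T, a = a *m a & \rank a = d]].

Definition grassmannian (d : nat) : set (infmx R) :=
  \bigcup_n (@pad n @` @grassmannian_fin d n).

Definition thick_grassmannian (d : nat) (e : R) : set (infmx R) :=
  if e == 0 then grassmannian d
  else [set A | exists2 P, grassmannian d P & frob_dist A P < e].

(* The closest point of Gr(d) is unique when A is in Gr(d)^(sqrt 2 / 2). *)
Definition closest_point (d : nat) (A : infmx R) : infmx R :=
  get [set P | grassmannian d P /\
         forall Q, grassmannian d Q -> frob_dist A P <= frob_dist A Q].

End InfiniteMatrices.
Arguments grassmannian_fin {R} d n.

Section HomotopyClasses.
Context {R : realType} {X Y : topologicalType}.
Implicit Types (S : set Y) (f g : X -> Y) (C : set (X -> Y)).

(* Maps X -> S, for S a subspace of Y, are represented by maps X -> Y with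
   values in S. *)
Definition map_into S f := continuous f /\ forall x, S (f x).

Definition homotopic_in S f g :=
  exists H : X * R -> Y,
    [/\ {within [set: X] `*` `[0, 1], continuous H},
        forall x t, 0 <= t <= 1 -> S (H (x, t)),
        forall x, H (x, 0) = f x &
        forall x, H (x, 1) = g x].

(* The class of f in [X, S]; it is empty if f is not a continuous map into S. *)
Definition homotopy_class S f : set (X -> Y) :=
  [set g | homotopic_in S f g].

(* [X, S] *)
Definition homotopy_classes S : set (set (X -> Y)) :=
  homotopy_class S @` map_into S.

End HomotopyClasses.
Arguments homotopic_in R {X Y} S f g.
Arguments homotopy_class R {X Y} S f.
Arguments homotopy_classes R X {Y} S.

(* The map p_* of homotopy classes: p_* [f] = [p \o f]. *)
Definition push_class (R : realType) (X Y Z : topologicalType) (S : set Z)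
    (p : Y -> Z) (C : set (X -> Y)) : set (X -> Z) :=
  [set h | exists2 f, C f & homotopic_in R S (p \o f) h].

Definition pi_star (R : realType) (B : topologicalType) (d : nat) :
    set (B -> infmx R) -> set (B -> infmx R) :=
  push_class R (grassmannian d) (closest_point d).

Definition is_indexed_open_cover (T : topologicalType) (I : Type)
    (U : I -> set T) :=
  (forall i, open (U i)) /\ \bigcup_i U i = setT.

Record partition_of_unity (R : realType) (T : topologicalType)
    (I : choiceType) (U : I -> set T) := PartitionOfUnity {
  pou_fun :> I -> T -> R;
  pou_continuous : forall i, continuous (pou_fun i);
  pou_ge0 : forall i x, 0 <= pou_fun i x;
  pou_subordinate : forall i, closure [set x | pou_fun i x != 0] `<=` U i;
  pou_locally_finite :
    locally_finite (fun i => closure [set x | pou_fun i x != 0]) setT;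
  pou_sum1 : forall x, \sum_(i \in [set: I]) pou_fun i x = 1
}.

Section Cocycles.
Context {R : realType} {B : topologicalType} {I : choiceType}.
Variables (d : nat) (U : I -> set B).

Definition orthogonal_group : set 'M[R]_d := [set a | a^T *m a = 1%:M].

(* A family (Omega_ij : U_j `&` U_i -> O(d)) is given by total functions whose
   values outside U_j `&` U_i are irrelevant; in particular the indices (i, j)
   that are not in the nerve are not constrained. *)
Definition cochain := I -> I -> B -> 'M[R]_d.

Definition is_cochain (Omega : cochain) := forall i j,
  {within U j `&` U i, continuous (Omega i j)} /\
  forall y, (U j `&` U i) y -> orthogonal_group (Omega i j y).

Definition approx_cocycle (e : R) : set cochain :=
  [set Omega | [/\ is_cochain Omega,
     forall i j y, (U j `&` U i) y -> Omega i j y = invmx (Omega j i y) &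
     forall i j k y, (U k `&` U j `&` U i) y ->
       if e == 0 then Omega i j y *m Omega j k y = Omega i k y
       else frob (Omega i j y *m Omega j k y - Omega i k y) < e]].

(* A supremum in \bar R, equal to -oo (rather than 0) if B is empty. *)
Definition cocycle_dist (Omega Lambda : cochain) : \bar R :=
  ereal_sup [set r | exists i j y,
    (U j `&` U i) y /\ r = (frob (Omega i j y - Lambda i j y))%:E].

Variables (phi : partition_of_unity R U) (iota : I -> nat).

(* Phi_i : U_i -> V(d). When rows are numbered from 1, row d * iota j + k (k < d)
   of Phi_i y is row k of sqrt (phi_j y) * (Omega_ij y)^t; here rows are numbered
   from 0, so that row r is the one numbered r.+1. *)
Definition local_frame (Omega : cochain) (i : I) (y : B) (r : nat) (c : 'I_d)
    : R :=
  \sum_(j \in [set j | U j y]) \sum_(k < d | r.+1 == (d * iota j + k)%N)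
    Num.sqrt (phi j y) * (Omega i j y)^T k c.

Definition cl_fun (Omega : cochain) (y : B) (r s : nat) : R :=
  \sum_(i \in [set: I]) phi i y *
    \sum_(c < d) local_frame Omega i y r c * local_frame Omega i y s c.

Lemma pou_finite y : finite_set [set j | phi j y != 0].
Proof.
have [N Ny fN] := pou_locally_finite phi y.
apply: sub_finite_set fN => j /= hj; split=> //.
exists y; split; last exact: nbhs_singleton.
exact: subset_closure.
Qed.

Lemma local_frame_finsupp Omega y : exists n : nat, forall i r c,
  (n <= r)%N -> local_frame Omega i y r c = 0.
Proof.
have [N hN] : exists N : nat, forall j, phi j y != 0 -> (iota j <= N)%N.
  have /finite_seqP[s sE] := pou_finite y.
  exists (\max_(j <- s) iota j)%N => j hj.
  have js : j \in s by rewrite -/([set` s] j) -sE.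
  by rewrite (big_rem j) //= leq_maxl.
exists (d * N + d)%N => i r c hr; rewrite /local_frame fsbig1// => j _.
have [->|hj] := eqVneq (phi j y) 0.
  by rewrite big1 // => k _; rewrite sqrtr0 mul0r.
rewrite big_pred0// => k; apply/negbTE/eqP => rE.
have := leq_mul2l d (iota j) N; rewrite (hN _ hj) orbT => le1.
have : (r.+1 <= d * N + d)%N by rewrite rE leq_add // ltnW.
by rewrite leqNgt ltnS hr.
Qed.

Lemma cl_fun_finsupp Omega y : exists n : nat, forall r s : nat,
  (n <= r)%N || (n <= s)%N -> cl_fun Omega y r s = 0.
Proof.
have [n hn] := local_frame_finsupp Omega y.
exists n => r s rs; rewrite /cl_fun fsbig1// => i _.
rewrite big1 ?mulr0// => c _.
by case/orP: rs => h; rewrite (hn _ _ _ h) ?mul0r ?mulr0.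
Qed.

Definition cl_map (Omega : cochain) (y : B) : infmx R :=
  Infmx (cl_fun_finsupp Omega y).

Definition cl (e : R) (Omega : cochain) : set (B -> infmx R) :=
  homotopy_class R (thick_grassmannian d (Num.sqrt 2 * e)) (cl_map Omega).

End Cocycles.

Section GrassmannianTopology.
Context {R : realType}.

Lemma mxtrace_idempotent n (a : 'M[R]_n) : a = a *m a -> \tr a = (\rank a)%:R.
Proof.
move=> aa; have ab := mulmx_base a.
have bc1 : row_base a *m col_base a = 1%:M.
  have cf : row_free (col_base a)^T.
    by rewrite /row_free mxrank_tr; exact: col_base_full.
  apply: (row_free_inj (row_base_free a)); apply: trmx_inj.
  apply: (row_free_inj cf); rewrite /= -!trmx_mul; congr trmx.
  rewrite mul1mx -(mulmxA (row_base a)) ab.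
  by rewrite (mulmxA (col_base a)) ab -aa.
by rewrite -{1}ab mxtrace_mulC bc1 mxtrace1.
Qed.

Lemma pad_ord n (a : 'M[R]_n) (i j : 'I_n) : pad a i j = a i j.
Proof. by rewrite /= /pad_fun !valK. Qed.

Lemma pad_out n (a : 'M[R]_n) (i j : nat) :
  (n <= i)%N || (n <= j)%N -> pad a i j = 0.
Proof.
case/orP=> h; rewrite /= /pad_fun; first by rewrite insubF // ltnNge h.
by case: (insub i) => [i'|] //; rewrite insubF // ltnNge h.
Qed.

Lemma sum_widen_ord (F : nat -> R) n m : (n <= m)%N ->
  (forall k, (n <= k)%N -> F k = 0) -> \sum_(k < m) F k = \sum_(k < n) F k.
Proof.
move=> nm F0; rewrite (big_ord_widen m F nm) [RHS]big_mkcond /=.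
by apply: eq_bigr => k _; case: ltnP => // /F0.
Qed.

Lemma sum_same (F : nat -> R) n m :
  (forall k, (n <= k)%N -> F k = 0) -> (forall k, (m <= k)%N -> F k = 0) ->
  \sum_(k < m) F k = \sum_(k < n) F k.
Proof.
by move=> Fn Fm; case: (leqP n m) => [|/ltnW] h; [|symmetry];
  exact: sum_widen_ord.
Qed.

Lemma pad_mulE n (a : 'M[R]_n) (i j : 'I_n) :
  (a *m a) i j = \sum_(k < n) pad a i k * pad a k j.
Proof. by rewrite mxE; apply: eq_bigr => k _; rewrite !pad_ord. Qed.

Lemma pad_trE n (a : 'M[R]_n) : \tr a = \sum_(k < n) pad a k k.
Proof. by rewrite /mxtrace; apply: eq_bigr => k _; rewrite pad_ord. Qed.

Lemma grassmannian_finE (d n : nat) (a : 'M[R]_n) : grassmannian_fin d n a <->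
  [/\ a = a^T, a = a *m a & \tr a = d%:R].
Proof.
split=> -[aT aa h]; split=> //; first by rewrite mxtrace_idempotent// h.
by apply/eqP; rewrite -(eqr_nat R) -mxtrace_idempotent// h.
Qed.

Lemma grassmannian_pad (d n : nat) (a : 'M[R]_n) :
  grassmannian d (pad a) <-> grassmannian_fin d n a.
Proof.
split=> [|ha]; last by exists n => //; exists a.
case=> m _ [b /grassmannian_finE[bT bb trb] ba]; apply/grassmannian_finE.
have bE i j : pad b i j = pad a i j by rewrite ba.
have Z i j : (m <= i)%N || (m <= j)%N -> pad a i j = 0.
  by rewrite -bE; exact: pad_out.
split.
- apply/matrixP => i j; rewrite [RHS]mxE -!pad_ord.
  have [h|h] := boolP ((m <= i)%N || (m <= j)%N).
    by rewrite !Z// orbC.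
  move: h; rewrite negb_or -!ltnNge => /andP[im jm]; rewrite -!bE.
  by rewrite -[i : nat]/(Ordinal im : nat) -[j : nat]/(Ordinal jm : nat) !pad_ord {1}bT mxE.
- apply/matrixP => i j; rewrite pad_mulE -pad_ord.
  have [h|h] := boolP ((m <= i)%N || (m <= j)%N).
    rewrite Z// big1 // => k _; case/orP: h => h.
      by rewrite Z ?h// mul0r.
    by rewrite [X in _ * X]Z ?h ?orbT// mulr0.
  move: h; rewrite negb_or -!ltnNge => /andP[im jm].
  rewrite -(@sum_same (fun k => pad a i k * pad a k j) n m); first last.
  + by move=> k h; rewrite Z ?h ?orbT// mul0r.
  + by move=> k h; rewrite pad_out ?h ?orbT// mul0r.
  rewrite -bE -[i : nat]/(Ordinal im : nat) -[j : nat]/(Ordinal jm : nat).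
  rewrite pad_ord {1}bb pad_mulE; apply: eq_bigr => k _.
  by rewrite !bE.
- rewrite pad_trE -trb pad_trE (eq_bigr (fun k : 'I_m => pad a k k)).
    apply: (@sum_same (fun k => pad a k k)) => k h; first by rewrite Z ?h.
    by rewrite pad_out ?h.
  by move=> k _; rewrite bE.
Qed.

Lemma closed_eq_fun (T : topologicalType) (f g : T -> R) :
  continuous f -> continuous g -> closed [set x | f x = g x].
Proof.
move=> cf cg; have -> : [set x | f x = g x] = (f \- g) @^-1` [set 0].
  by apply/seteqP; split=> x /= /eqP h; apply/eqP; move: h;
    rewrite subr_eq0.
apply: preimage_closed; last exact: closed_eq.
by move=> x _; apply: cvgB; [exact: cf|exact: cg].
Qed.

Lemma continuous_sum_ord (T : topologicalType) n (f : 'I_n -> T -> R) :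
  (forall i, continuous (f i)) -> continuous (fun x => \sum_(i < n) f i x).
Proof.
by move=> cf x; apply: cvg_big => [|i _]; [exact: add_continuous|exact: cf].
Qed.

Lemma closed_grassmannian_fin (d n : nat) :
  closed (grassmannian_fin d n : set 'M[R]_n).
Proof.
have cc i j : continuous (fun a : 'M[R]_n => a i j) by exact: coord_continuous.
have -> : (grassmannian_fin d n : set 'M[R]_n) =
    (\bigcap_ij [set a : 'M[R]_n | a ij.1 ij.2 = a ij.2 ij.1]) `&`
    (\bigcap_ij [set a : 'M[R]_n | a ij.1 ij.2 =
                     \sum_(k < n) a ij.1 k * a k ij.2]) `&`
    [set a : 'M[R]_n | \sum_(k < n) a k k = d%:R].
  apply/seteqP; split=> a.
    move=> /grassmannian_finE[aT aa tra]; split; last exact: tra.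
    split=> -[i j] _ /=; first by rewrite {1}aT mxE.
    by rewrite {1}aa mxE.
  move=> [[aT aa] tra]; apply/grassmannian_finE; split; last exact: tra.
    by apply/matrixP => i j; rewrite mxE; exact: (aT (i, j)).
  by apply/matrixP => i j; rewrite mxE; exact: (aa (i, j)).
apply: closedI; first apply: closedI.
- by apply: closed_bigI => ij _; apply: closed_eq_fun.
- apply: closed_bigI => ij _; apply: closed_eq_fun => //.
  by apply: continuous_sum_ord => k x; exact: (cvgM (cc _ _ x) (cc _ _ x)).
- apply: closed_eq_fun; first exact: continuous_sum_ord.
  exact: cst_continuous.
Qed.

(* The topology of Gr(d) as a subspace of the space of infinite matrices is the
   direct limit of the topologies of the Gr(d, n). *)
Lemma grassmannian_dlim (d : nat) (W : set (infmx R)) :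
  W `<=` grassmannian d ->
  (exists2 Z, open Z & W = Z `&` grassmannian d) <->
  (forall n, exists2 V : set 'M[R]_n, open V &
     @pad R n @^-1` W = V `&` grassmannian_fin d n).
Proof.
move=> WG; split=> [[Z oZ ->] n|h].
  exists (@pad R n @^-1` Z); first exact: oZ.
  by apply/seteqP; split=> a /= [Za /grassmannian_pad].
exists (W `|` ~` grassmannian d); last first.
  apply/seteqP; split=> A; first by move=> WA; split; [left|exact: WG].
  by case=> -[].
have E n : @pad R n @^-1` (~` grassmannian d) = ~` grassmannian_fin d n.
  by apply/seteqP; split=> a /= + /grassmannian_pad; apply.
suff : dlim_open (W `|` ~` grassmannian d) by [].
move=> n; have [V oV VE] := h n.
have -> : @pad R n @^-1` (W `|` ~` grassmannian d) =
    V `|` ~` grassmannian_fin d n.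
  by rewrite preimage_setU E VE setUIl setUv setIT.
by apply: openU => //; rewrite openC; exact: closed_grassmannian_fin.
Qed.

End GrassmannianTopology.

(* Main.v *)
(** Let A(y) be the value of the classifying map of Omega.  It lies within
    sqrt 2 * e <= 1/2 of each projection V_i V_i^T onto the image of the frame
    V_i = Phi_i(y), so its spectrum has a gap and its closest point P(y) is the
    projection onto the top d-dimensional invariant subspace.  Orthonormalizing P V_i
    by K_i = (V_i^T P V_i)^(-1/2) gives frames of the image of P, and
    Lambda_ij = K_i (V_i^T P V_j) K_j is an exact cocycle at distance at most
    (4 sqrt 2 + 1) e <= 9 e.  It does not depend on iota, because V_i^T P V_j is
    invariant under isometric changes of coordinates.

    The weights (1 - t) + t K_i deform V_i^T P V_j into Lambda_ij.  Along this path
    the classifying map has the form (M M^T)^2 with M = M P injective on the image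
    of P, so it keeps a spectral gap and its closest point stays continuous.  At
    t = 0 that closest point is P: there M = G P with G^2 = A, and G commutes with P.
    Finally phi is changed by linear interpolation. *)

(* Spectral statements are phrased by quadratic forms, without eigenvalues. For [Q] in Gr(d),
   [|A - Q|^2] equals [|A|^2 + d - 2 <A, Q>], so closest points are maximizers of a linear
   functional on a compact set; a gap [b < a] turns maximality into quadratic growth, which yields
   uniqueness and Lipschitz dependence at once. The bound on [e] is used twice: distance less than
   1/2 from a projection leaves a gap, and distance at most 1 from [P] to [V_i V_i^T] bounds
   [1 - V_i^T P V_i] by 1/2, where the square root iteration contracts. The obstacle is the
   deformation from [V_i^T P V_j] to [Lambda_ij]: its matrices are not orthogonal in general, so its
   classifying map has no reason to stay in the tubular neighbourhood. The closest point is
   therefore studied on [spectral_domain], where only a gap is asked. [Lambda] comes from one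
   partition of unity but must serve all of them, hence the change of [phi]. Pointwise computations
   use coordinates indexed by the support of [phi] at [y], whose number varies with [y]; continuity
   is proved through the infinite matrices. *)
Require Import Defs.
From mathcomp Require Import all_boot all_order all_algebra finmap.
From mathcomp Require Import all_classical all_reals all_analysis.
From mathcomp Require Import zify ring lra.

Set Implicit Arguments.
Unset Strict Implicit.
Unset Printing Implicit Defensive.

Import Order.TTheory GRing.Theory Num.Theory.
Import numFieldNormedType.Exports.

Local Open Scope classical_set_scope.
Local Open Scope ring_scope.

(** * The Frobenius inner product *)

Section FrobeniusInnerProduct.
Context {R : realType}.

Definition mdot m n (A B : 'M[R]_(m, n)) : R := \tr (A^T *m B).

Lemma mdotE m n (A B : 'M[R]_(m, n)) :
  mdot A B = \sum_j \sum_i A i j * B i j.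
Proof.
by rewrite /mdot /mxtrace; apply: eq_bigr => j _; rewrite mxE;
  apply: eq_bigr => i _; rewrite mxE.
Qed.

Lemma mdotC m n (A B : 'M[R]_(m, n)) : mdot A B = mdot B A.
Proof. by rewrite /mdot -mxtrace_tr trmx_mul trmxK. Qed.

Lemma mdotDl m n (A B C : 'M[R]_(m, n)) : mdot (A + B) C = mdot A C + mdot B C.
Proof. by rewrite /mdot linearD mulmxDl linearD. Qed.

Lemma mdotDr m n (A B C : 'M[R]_(m, n)) : mdot C (A + B) = mdot C A + mdot C B.
Proof. by rewrite ![mdot C _]mdotC mdotDl. Qed.

Lemma mdotNl m n (A C : 'M[R]_(m, n)) : mdot (- A) C = - mdot A C.
Proof. by rewrite /mdot linearN mulNmx linearN. Qed.

Lemma mdotNr m n (A C : 'M[R]_(m, n)) : mdot C (- A) = - mdot C A.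
Proof. by rewrite ![mdot C _]mdotC mdotNl. Qed.

Lemma mdotBl m n (A B C : 'M[R]_(m, n)) : mdot (A - B) C = mdot A C - mdot B C.
Proof. by rewrite mdotDl mdotNl. Qed.

Lemma mdotBr m n (A B C : 'M[R]_(m, n)) : mdot C (A - B) = mdot C A - mdot C B.
Proof. by rewrite mdotDr mdotNr. Qed.

Lemma mdotZl m n a (A C : 'M[R]_(m, n)) : mdot (a *: A) C = a * mdot A C.
Proof. by rewrite /mdot linearZ -scalemxAl linearZ. Qed.

Lemma mdotZr m n a (A C : 'M[R]_(m, n)) : mdot C (a *: A) = a * mdot C A.
Proof. by rewrite ![mdot C _]mdotC mdotZl. Qed.

Lemma mdot0l m n (A : 'M[R]_(m, n)) : mdot 0 A = 0.
Proof. by rewrite /mdot trmx0 mul0mx mxtrace0. Qed.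

Lemma mdot0r m n (A : 'M[R]_(m, n)) : mdot A 0 = 0.
Proof. by rewrite mdotC mdot0l. Qed.

Lemma mdotT m n (A B : 'M[R]_(m, n)) : mdot A^T B^T = mdot A B.
Proof. by rewrite /mdot trmxK mxtrace_mulC -mxtrace_tr trmx_mul trmxK. Qed.

Lemma mdot_mull m n p (A : 'M[R]_(m, n)) (X : 'M[R]_(n, p)) Y :
  mdot (A *m X) Y = mdot X (A^T *m Y).
Proof. by rewrite /mdot trmx_mul mulmxA. Qed.

Lemma mdot_mulr m n p (A : 'M[R]_(n, p)) (X : 'M[R]_(m, n)) Y :
  mdot (X *m A) Y = mdot X (Y *m A^T).
Proof. by rewrite -mdotT trmx_mul mdot_mull trmxK -mdotT trmxK trmx_mul trmxK. Qed.

Lemma mdot_ge0 m n (A : 'M[R]_(m, n)) : 0 <= mdot A A.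
Proof.
by rewrite mdotE; do 2 apply: sumr_ge0 => ? _; rewrite -expr2 sqr_ge0.
Qed.

Lemma mdot_eq0 m n (A : 'M[R]_(m, n)) : (mdot A A == 0) = (A == 0).
Proof.
apply/eqP/eqP => [|->]; last by rewrite mdot0l.
rewrite mdotE => /eqP; rewrite psumr_eq0; last first.
  by move=> j _; apply: sumr_ge0 => i _; rewrite -expr2 sqr_ge0.
move=> /allP h; apply/matrixP => i j; rewrite mxE.
have := h j (mem_index_enum _); rewrite psumr_eq0; last first.
  by move=> k _; rewrite -expr2 sqr_ge0.
move=> /allP /(_ i (mem_index_enum _)) /=.
by rewrite mulf_eq0 orbb => /eqP.
Qed.

Lemma mdot_gt0 m n (A : 'M[R]_(m, n)) : A != 0 -> 0 < mdot A A.
Proof. by move=> A0; rewrite lt_def mdot_eq0 A0 mdot_ge0. Qed.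

Lemma frob_ge0 m n (A : 'M[R]_(m, n)) : 0 <= frob A.
Proof. exact: sqrtr_ge0. Qed.

Lemma frob_sqr m n (A : 'M[R]_(m, n)) : frob A ^+ 2 = mdot A A.
Proof. by rewrite sqr_sqrtr //; exact: mdot_ge0. Qed.

Lemma frob0 m n : frob (0 : 'M[R]_(m, n)) = 0.
Proof. by rewrite /frob -/(mdot _ _) mdot0l sqrtr0. Qed.

Lemma frob_eq0 m n (A : 'M[R]_(m, n)) : (frob A == 0) = (A == 0).
Proof. by rewrite -mdot_eq0 -frob_sqr expf_eq0. Qed.

Lemma frobT m n (A : 'M[R]_(m, n)) : frob A^T = frob A.
Proof. by rewrite /frob -![\tr _]/(mdot _ _) mdotT. Qed.

Lemma frobN m n (A : 'M[R]_(m, n)) : frob (- A) = frob A.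
Proof. by rewrite /frob -![\tr _]/(mdot _ _) mdotNl mdotNr opprK. Qed.

Lemma frobC m n (A B : 'M[R]_(m, n)) : frob (A - B) = frob (B - A).
Proof. by rewrite -frobN opprB. Qed.

Lemma frobZ m n a (A : 'M[R]_(m, n)) : frob (a *: A) = `|a| * frob A.
Proof.
rewrite /frob -![\tr _]/(mdot _ _) mdotZl mdotZr mulrA -expr2.
by rewrite sqrtrM ?sqr_ge0// sqrtr_sqr.
Qed.

Lemma le_frob m n p q (A : 'M[R]_(m, n)) (B : 'M[R]_(p, q)) :
  (frob A <= frob B) = (mdot A A <= mdot B B).
Proof. by rewrite -!frob_sqr ler_sqr ?nnegrE ?frob_ge0. Qed.

Lemma mdot_CS m n (A B : 'M[R]_(m, n)) : mdot A B <= frob A * frob B.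
Proof.
have [->|A0] := eqVneq A 0; first by rewrite mdot0l frob0 mul0r.
have a0 : 0 < frob A by rewrite lt_def frob_eq0 A0 frob_ge0.
(* This square equals [|A|^2 (|A|^2 |B|^2 - <A, B>^2)], and [|A|^2 > 0] can be cancelled. *)
have : 0 <= mdot (mdot A B *: A - frob A ^+ 2 *: B)
                 (mdot A B *: A - frob A ^+ 2 *: B) by exact: mdot_ge0.
rewrite mdotBl !mdotBr !mdotZl !mdotZr [mdot B A]mdotC -!frob_sqr => h.
apply: le_trans (ler_norm _) _.
rewrite -ler_sqr ?nnegrE ?mulr_ge0 ?frob_ge0// real_normK ?num_real//.
have a2 : 0 < frob A ^+ 2 by rewrite exprn_gt0.
rewrite exprMn -subr_ge0 -(pmulr_rge0 _ a2).
by apply: le_trans h _; rewrite le_eqVlt; apply/orP; left; apply/eqP; ring.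
Qed.

Lemma mdot_CS_norm m n (A B : 'M[R]_(m, n)) : `|mdot A B| <= frob A * frob B.
Proof.
by rewrite ler_norml mdot_CS andbT lerNl -mdotNl -[frob A]frobN mdot_CS.
Qed.

Lemma frobD m n (A B : 'M[R]_(m, n)) : frob (A + B) <= frob A + frob B.
Proof.
rewrite -ler_sqr ?nnegrE ?addr_ge0 ?frob_ge0// frob_sqr mdotDl !mdotDr.
rewrite [mdot B A]mdotC -!frob_sqr; have := mdot_CS A B.
by nra.
Qed.

Lemma frob_tri m n (A B C : 'M[R]_(m, n)) :
  frob (A - C) <= frob (A - B) + frob (B - C).
Proof. by have := frobD (A - B) (B - C); rewrite addrA subrK. Qed.

Lemma frob_sum m n (J : Type) (r : seq J) (Q : pred J) (F : J -> 'M[R]_(m, n)) :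
  frob (\sum_(j <- r | Q j) F j) <= \sum_(j <- r | Q j) frob (F j).
Proof.
elim/big_rec2: _ => [|j y1 y2 _ h]; first by rewrite frob0.
by apply: le_trans (frobD _ _) _; rewrite lerD2l.
Qed.

Lemma entry_le_frob m n (A : 'M[R]_(m, n)) i j : `|A i j| <= frob A.
Proof.
rewrite -ler_sqr ?nnegrE ?frob_ge0// real_normK ?num_real// frob_sqr mdotE.
rewrite (bigD1 j)//= (bigD1 i)//= -expr2 -addrA lerDl addr_ge0//.
  by apply: sumr_ge0 => k _; rewrite -expr2 sqr_ge0.
by do 2 apply: sumr_ge0 => ? _; rewrite -expr2 sqr_ge0.
Qed.

Lemma mdot_col m n (A B : 'M[R]_(m, n)) :
  mdot A B = \sum_j mdot (col j A) (col j B).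
Proof.
rewrite mdotE; apply: eq_bigr => j _; rewrite mdotE big_ord1.
by apply: eq_bigr => i _; rewrite !mxE.
Qed.

Lemma frobM m n p (A : 'M[R]_(m, n)) (B : 'M[R]_(n, p)) :
  frob (A *m B) <= frob A * frob B.
Proof.
rewrite -ler_sqr ?nnegrE ?mulr_ge0 ?frob_ge0// exprMn !frob_sqr.
rewrite [mdot B B]mdot_col mulr_sumr mdotE; apply: ler_sum => j _.
rewrite -[mdot A A]mdotT mdot_col mulr_suml; apply: ler_sum => i _.
have -> : (A *m B) i j = mdot (col i A^T) (col j B).
  by rewrite mxE mdotE big_ord1; apply: eq_bigr => k _; rewrite !mxE.
rewrite -!frob_sqr -expr2 -exprMn -real_normK ?num_real//.
by rewrite ler_sqr ?nnegrE ?mulr_ge0 ?frob_ge0// mdot_CS_norm.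
Qed.

Lemma frob_isometry m n p (V : 'M[R]_(m, n)) (A : 'M[R]_(n, p)) :
  V^T *m V = 1%:M -> frob (V *m A) = frob A.
Proof.
by move=> VV; rewrite /frob -![\tr _]/(mdot _ _) mdot_mull mulmxA VV mul1mx.
Qed.

(** [W = V V^T A] is the orthogonal projection of [A] to the image of [V], so
    [|A - W|^2 = |A|^2 - |V^T A|^2]. *)
Lemma frob_coisometry m n p (V : 'M[R]_(m, n)) (A : 'M[R]_(m, p)) :
  V^T *m V = 1%:M -> frob (V^T *m A) <= frob A.
Proof.
move=> VV; rewrite le_frob; set W := V *m (V^T *m A).
have WW : mdot W W = mdot (V^T *m A) (V^T *m A).
  by rewrite /W mdot_mull mulmxA VV mul1mx.
have AW : mdot A W = mdot (V^T *m A) (V^T *m A).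
  by rewrite mdotC /W mdot_mull.
have := mdot_ge0 (A - W); rewrite mdotBl !mdotBr [mdot W A]mdotC WW AW.
by rewrite subrr subr0 subr_ge0.
Qed.

Lemma frob_mul_isometry m n p (V : 'M[R]_(m, n)) (A : 'M[R]_(p, m)) :
  V^T *m V = 1%:M -> frob (A *m V) <= frob A.
Proof.
by move=> VV; rewrite -frobT trmx_mul -[frob A]frobT; exact: frob_coisometry.
Qed.

End FrobeniusInnerProduct.

(** * Spectral gaps and maximizers on the Grassmannian *)

Section SpectralGap.
Context {R : realType}.

Definition is_proj n (P : 'M[R]_n) := P = P^T /\ P = P *m P.

Lemma grass_proj d n (P : 'M[R]_n) : grassmannian_fin d n P -> is_proj P.
Proof. by case. Qed.

Lemma grass_tr d n (P : 'M[R]_n) : grassmannian_fin d n P -> \tr P = d%:R.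
Proof. by move/grassmannian_finE => []. Qed.

Lemma proj_grass d n (P : 'M[R]_n) :
  is_proj P -> \tr P = d%:R -> grassmannian_fin d n P.
Proof. by move=> [? ?] ?; apply/grassmannian_finE. Qed.

Lemma projC n (P : 'M[R]_n) : is_proj P -> is_proj (1%:M - P).
Proof.
move=> [PT PP]; split; first by rewrite linearB /= trmx1 -PT.
by rewrite mulmxBl mul1mx mulmxBr mulmx1 -PP subrr subr0.
Qed.

Lemma mdot_proj m n (P : 'M[R]_n) (X Y : 'M[R]_(n, m)) : is_proj P ->
  mdot (P *m X) (P *m Y) = mdot X (P *m Y).
Proof. by move=> [PT PP]; rewrite mdot_mull mulmxA -PT -PP. Qed.

Lemma mdot_projr m n (P : 'M[R]_n) (X Y : 'M[R]_(m, n)) : is_proj P ->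
  mdot (X *m P) (Y *m P) = mdot X (Y *m P).
Proof. by move=> [PT PP]; rewrite mdot_mulr -mulmxA -PT -PP. Qed.

Lemma mdot1l n (A : 'M[R]_n) : mdot 1%:M A = \tr A.
Proof. by rewrite /mdot trmx1 mul1mx. Qed.

Lemma mdot_proj_tr n (P : 'M[R]_n) : is_proj P -> mdot P P = \tr P.
Proof. by move=> [PT PP]; rewrite /mdot -PT -PP. Qed.

Lemma mdot_grass_dist d n (P Q : 'M[R]_n) :
  grassmannian_fin d n P -> grassmannian_fin d n Q ->
  mdot (P - Q) (P - Q) = 2 * (d%:R - mdot P Q).
Proof.
move=> hP hQ; rewrite mdotBl !mdotBr [mdot Q P]mdotC.
rewrite !mdot_proj_tr ?(grass_tr hP) ?(grass_tr hQ); first by ring.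
  exact: grass_proj hQ.
exact: grass_proj hP.
Qed.

Lemma mulmx_colvecE n (x z : 'cV[R]_n) : x^T *m z = (mdot x z)%:M.
Proof. by rewrite [LHS]mx11_scalar /mdot /mxtrace big_ord1. Qed.

Lemma mul_outer n (x y z : 'cV[R]_n) : x *m y^T *m z = mdot y z *: x.
Proof. by rewrite -mulmxA mulmx_colvecE mul_mx_scalar. Qed.

Lemma mdot_outer n (x y : 'cV[R]_n) A : mdot (x *m y^T) A = mdot x (A *m y).
Proof. by rewrite mdot_mulr trmxK. Qed.

Lemma tr_outer n (x : 'cV[R]_n) : \tr (x *m x^T) = mdot x x.
Proof. by rewrite /mdot mxtrace_mulC. Qed.

Lemma eq0_mulmx_cV m n (A : 'M[R]_(m, n)) :
  (forall v : 'cV_n, A *m v = 0) -> A = 0.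
Proof.
move=> h; apply/matrixP => i j; have := h (delta_mx j 0).
by rewrite -colE => /matrixP /(_ i 0); rewrite !mxE.
Qed.

Lemma eq0_mdot_cV n (A : 'M[R]_n) :
  (forall u v : 'cV_n, mdot u (A *m v) = 0) -> A = 0.
Proof.
by move=> h; apply: eq0_mulmx_cV => v; apply/eqP; rewrite -mdot_eq0 h.
Qed.

Lemma proj_outerD n (P : 'M[R]_n) (u : 'cV_n) : is_proj P -> P *m u = 0 ->
  mdot u u = 1 -> is_proj (P + u *m u^T).
Proof.
move=> [PT PP] Pu uu; have uP : u^T *m P = 0.
  by rewrite PT -trmx_mul Pu trmx0.
split; first by rewrite linearD /= trmx_mul trmxK -PT.
rewrite mulmxDr !mulmxDl -PP !mulmxA Pu mul0mx add0r.
by rewrite -!mulmxA uP mulmx0 addr0 (mulmxA u^T) mulmx_colvecE uu mul1mx.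
Qed.

Lemma proj_outerB n (P : 'M[R]_n) (u : 'cV_n) : is_proj P -> P *m u = u ->
  mdot u u = 1 -> is_proj (P - u *m u^T).
Proof.
move=> hP Pu uu.
(* The complementary projection gains [u], which reduces the claim to [proj_outerD]. *)
have -> : P - u *m u^T = 1%:M - ((1%:M - P) + u *m u^T).
  by rewrite opprD opprB addrA [1%:M + _]addrC subrK.
apply: projC; apply: proj_outerD => //; first exact: projC.
by rewrite mulmxBl mul1mx Pu subrr.
Qed.

Lemma normalize n (x : 'cV[R]_n) : x != 0 ->
  exists2 k : R, 0 < k & mdot (k *: x) (k *: x) = 1.
Proof.
move=> x0; have f0 : 0 < frob x by rewrite lt_def frob_eq0 x0 frob_ge0.
exists (frob x)^-1; first by rewrite invr_gt0.
rewrite mdotZl mdotZr -frob_sqr; field; lra.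
Qed.

(** A dimension count: the kernel of [A] is too large to miss the image of [B]. It supplies the test
    vectors of the min-max principle. *)
Lemma proj_meet n (A B : 'M[R]_n) : is_proj A -> is_proj B -> \tr A < \tr B ->
  exists v : 'cV_n, [/\ v != 0, B *m v = v & A *m v = 0].
Proof.
move=> [AT AA] [BT BB]; rewrite !mxtrace_idempotent // ltr_nat => rAB.
(* If the left kernel of [B A] were inside that of [B], then [rank B <= rank (B A) <= rank A]. *)
have : ~~ (kermx (B *m A) <= kermx B)%MS.
  apply: contraL rAB => /mxrankS; rewrite !mxrank_ker -leqNgt => h.
  have := mxrankM_maxr B A; have := rank_leq_row B.
  have := rank_leq_row (B *m A); move: h.
  move: (\rank _) (\rank _) (\rank _) => p q r; clear; lia.
move=> /row_subPn[i hi]; set u := row i (kermx (B *m A)) in hi.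
have uBA : u *m (B *m A) = 0 by apply/sub_kermxP; exact: row_sub.
exists (u *m B)^T; split.
- by rewrite trmx_eq0; apply: contra hi => /eqP h; apply/sub_kermxP.
- by rewrite {1}BT -trmx_mul -mulmxA -BB.
- by rewrite {1}AT -trmx_mul -mulmxA uBA trmx0.
Qed.

(** Commutation of [S] and [P] is kept out: the two bounds survive a perturbation of [S] with
    slightly worse constants, commutation does not. *)
Definition form_gap n (a b : R) (S P : 'M[R]_n) :=
  (forall x : 'cV_n,
     a * mdot (P *m x) (P *m x) <= mdot (P *m x) (S *m (P *m x))) /\
  (forall x : 'cV_n, P *m x = 0 -> mdot x (S *m x) <= b * mdot x x).

(** For symmetric [S] and [b < a], [P] is the spectral projection of [S] for its [d] largest
    eigenvalues. *)
Definition gap_proj d n (a b : R) (S P : 'M[R]_n) :=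
  [/\ grassmannian_fin d n P, S *m P = P *m S & form_gap a b S P].

Lemma col_mulmx m n p j (A : 'M[R]_(m, n)) (B : 'M[R]_(n, p)) :
  col j (A *m B) = A *m col j B.
Proof. by rewrite !colE mulmxA. Qed.

Lemma form_gap_mx n m a b (S P : 'M[R]_n) (X : 'M[R]_(n, m)) :
  form_gap a b S P ->
  a * mdot (P *m X) (P *m X) <= mdot (P *m X) (S *m (P *m X)) /\
  (P *m X = 0 -> mdot X (S *m X) <= b * mdot X X).
Proof.
move=> [ga gb]; split=> [|PX].
  rewrite !(mdot_col (P *m X)) mulr_sumr; apply: ler_sum => j _.
  by rewrite !col_mulmx.
rewrite !(mdot_col X) mulr_sumr; apply: ler_sum => j _.
by rewrite !col_mulmx; apply: gb; rewrite -col_mulmx PX linear0.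
Qed.

(** Quadratic growth at a spectral projection: [<P, S> - <Q, S>] is the form of [S] on [P (1 - Q)],
    where it is at least [a], minus the form on [(1 - P) Q], where it is at most [b]. Both matrices
    have squared norm [d - <P, Q> = |P - Q|^2 / 2]. *)
Lemma gap_proj_ineq d n a b (S P Q : 'M[R]_n) : S^T = S ->
  gap_proj d a b S P -> grassmannian_fin d n Q ->
  (a - b) / 2 * mdot (P - Q) (P - Q) <= mdot P S - mdot Q S.
Proof.
move=> ST [hP PS gab] hQ; rewrite (mdot_grass_dist hP hQ).
have pP := grass_proj hP; have pQ := grass_proj hQ.
have pP1 := projC pP; have pQ1 := projC pQ; have [PT PP] := pP.
have [ga _] := form_gap_mx (1%:M - Q) gab.
have [_] := form_gap_mx ((1%:M - P) *m Q) gab.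
rewrite mulmxA mulmxBr mulmx1 -PP subrr mul0mx => /(_ erefl) gb.
have e1 : mdot (P *m (1%:M - Q)) (P *m (1%:M - Q)) = d%:R - mdot P Q.
  rewrite mdot_projr // mulmxBr mulmx1 mdotBr mdot_proj_tr // (grass_tr hP).
  by rewrite [mdot P _]mdotC mdot_mull -PT -PP mdotC.
have e2 : mdot (((1%:M - P) *m Q)) ((1%:M - P) *m Q) = d%:R - mdot P Q.
  rewrite mdot_proj // mulmxBl mul1mx mdotBr mdot_proj_tr // (grass_tr hQ).
  by rewrite [mdot Q _]mdotC mdot_mulr -pQ.1 -pQ.2.
have e3 : mdot (P *m (1%:M - Q)) (S *m (P *m (1%:M - Q))) =
    mdot P S - mdot P (S *m Q).
  rewrite mdot_mulr -pQ1.1 -!mulmxA -pQ1.2 mulmxA PS -mulmxA.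
  by rewrite mdotC mdot_mull -PT -PP mdotC mulmxBr mulmx1 mdotBr.
have e4 : mdot ((1%:M - P) *m Q) (S *m ((1%:M - P) *m Q)) =
    mdot Q S - mdot P (S *m Q).
  rewrite mdot_mulr -pQ.1 -!mulmxA -pQ.2 mulmxA mulmxBr mulmx1 PS.
  rewrite mulmxBl -mulmxA.
  have -> : S *m Q - P *m (S *m Q) = (1%:M - P) *m (S *m Q).
    by rewrite mulmxBl mul1mx.
  rewrite mdotC mdot_mull -pP1.1 -pP1.2 mdotC mdotBl mdot1l mxtrace_mulC.
  by rewrite {1}pQ.1.
move: ga gb; rewrite e1 e2 e3 e4; lra.
Qed.

Lemma gap_proj_eq d n a b (S P Q : 'M[R]_n) : S^T = S -> b < a ->
  gap_proj d a b S P -> grassmannian_fin d n Q -> mdot P S <= mdot Q S -> P = Q.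
Proof.
move=> ST ab hP hQ h; have := gap_proj_ineq ST hP hQ => h1.
apply/eqP; rewrite -subr_eq0 -mdot_eq0 eq_le mdot_ge0 andbT.
rewrite -(pmulr_rle0 _ (_ : 0 < (a - b) / 2)); last by lra.
by apply: le_trans h1 _; rewrite subr_le0.
Qed.

Lemma linear_le_square_eq0 (q K : R) :
  (forall s, 2 * (s * q) <= s ^+ 2 * K) -> q = 0.
Proof.
move=> key; have [//|q0] := eqVneq q 0; exfalso.
have q2 : 0 < q ^+ 2 by rewrite lt_def sqrf_eq0 q0 sqr_ge0.
pose M : R := 1 + `|K|; have M0 : 0 < M by rewrite /M; have := normr_ge0 K; lra.
have KM : K < M by rewrite /M; have := ler_norm K; lra.
(* As [K < M], the choice [s = q / M] makes the quadratic side drop below the linear one. *)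
have := key (q / M); rewrite [q / M * q](_ : _ = q ^+ 2 / M); last by field; lra.
rewrite [(q / M) ^+ 2 * K](_ : _ = q ^+ 2 / M * (K / M)); last by field; lra.
have qM : 0 < q ^+ 2 / M by rewrite divr_gt0.
have uM : K / M < 1 by rewrite ltr_pdivrMr// mul1r.
by move: qM uM; move: (q ^+ 2 / M) (K / M) => t u; clear; nra.
Qed.

Section Maximizer.
Variables (d n : nat) (S P : 'M[R]_n).
Hypothesis ST : S^T = S.
Hypothesis hP : grassmannian_fin d n P.
Hypothesis maxP : forall Q, grassmannian_fin d n Q -> mdot Q S <= mdot P S.

(* Replacing x by w in the image of P keeps a projection of rank d. *)
Let swap_unit (x z : 'cV[R]_n) c : mdot x x = 1 -> P *m x = x -> P *m z = 0 ->
  mdot (c *: x + z) (c *: x + z) = 1 ->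
  mdot (c *: x + z) (S *m (c *: x + z)) <= mdot x (S *m x).
Proof.
move=> xx Px Pz; set w := _ + z => ww.
have pP := grass_proj hP.
have xz : mdot x z = 0 by rewrite -Px mdot_mull -(pP.1) Pz mdot0r.
have pX := proj_outerB pP Px xx.
have Xw : (P - x *m x^T) *m w = 0.
  rewrite mulmxBl mul_outer /w mulmxDr -scalemxAr Px Pz mdotDr mdotZr xx xz.
  by rewrite !addr0 mulr1 subrr.
have h := maxP (proj_grass (proj_outerD pX Xw ww) _).
rewrite !mdotDl mdotNl !mdot_outer in h.
suff hh : mdot P S - mdot x (S *m x) + mdot w (S *m w) <= mdot P S by lra.
apply: h; rewrite mxtraceD [\tr (P - _)]linearB /= !tr_outer ww xx (grass_tr hP).
by rewrite subrK.
Qed.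

(** [swap_unit] made homogeneous, so that the new vector need not have norm 1. *)
Let swap (x z : 'cV[R]_n) c : mdot x x = 1 -> P *m x = x -> P *m z = 0 ->
  mdot (c *: x + z) (S *m (c *: x + z)) <=
  mdot x (S *m x) * mdot (c *: x + z) (c *: x + z).
Proof.
move=> xx Px Pz; have [->|w0] := eqVneq (c *: x + z) 0.
  by rewrite !mdot0l mulr0.
have [k k0] := normalize w0; rewrite scalerDr scalerA => kw.
have := swap_unit xx Px _ kw; rewrite -scalemxAr Pz scaler0 => /(_ erefl).
move: kw; rewrite -scalerA -scalerDr -scalemxAr !mdotZl !mdotZr => kw h.
rewrite -(ler_pM2l k0) -(ler_pM2l k0) (le_trans h)//.
rewrite [X in _ <= X](_ : _ = mdot x (S *m x) *
  (k * (k * mdot (c *: x + z) (c *: x + z)))); last by ring.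
by rewrite kw mulr1.
Qed.

(** The first-order condition at a maximum: moving [x] to [x + s z] bounds a term linear in [s] by
    one quadratic in [s], so the cross term vanishes. *)
Let crossless (x z : 'cV[R]_n) : P *m x = x -> P *m z = 0 ->
  mdot x (S *m z) = 0.
Proof.
move=> Px Pz; have [->|x0] := eqVneq x 0; first by rewrite mdot0l.
have [k k0 kx] := normalize x0.
suff : mdot (k *: x) (S *m z) = 0.
  by rewrite mdotZl => /eqP; rewrite mulf_eq0 gt_eqF// => /eqP.
have Pkx : P *m (k *: x) = k *: x by rewrite -scalemxAr Px.
move: (k *: x) kx Pkx => {k k0 x0 Px}x xx Px.
have xz : mdot x z = 0 by rewrite -Px mdot_mull -((grass_proj hP).1) Pz mdot0r.
set q := mdot x (S *m z); pose K := mdot x (S *m x) * mdot z z - mdot z (S *m z).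
have key s : 2 * (s * q) <= s ^+ 2 * K.
  have := @swap x (s *: z) 1 xx Px; rewrite scale1r -scalemxAr Pz scaler0.
  move=> /(_ erefl); rewrite mulmxDr -scalemxAr !(mdotDl, mdotDr, mdotZl, mdotZr).
  have -> : mdot z (S *m x) = q by rewrite mdotC mdot_mull ST.
  rewrite [mdot z x]mdotC xz xx -/q /K; lra.
exact: linear_le_square_eq0 key.
Qed.

(** By [crossless] the off-diagonal block [P S (1 - P)] is zero; symmetry of [S] kills the other
    one. *)
Lemma maximizer_commutes : S *m P = P *m S.
Proof.
have pP := grass_proj hP; have [PT PP] := pP.
have h : P *m S *m (1%:M - P) = 0.
  apply: eq0_mdot_cV => u v; rewrite -!mulmxA mdotC mdot_mull -PT mdotC.
  apply: crossless; first by rewrite mulmxA -PP.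
  by rewrite mulmxA mulmxBr mulmx1 -PP subrr mul0mx.
have e : P *m S = P *m S *m P.
  by apply/eqP; rewrite -subr_eq0 -[X in X - _]mulmx1 -mulmxBr h.
have e' : (P *m S)^T = S *m P by rewrite trmx_mul ST -PT.
by rewrite -e' [in LHS]e trmx_mul e' -PT mulmxA -e.
Qed.

(** The min-max argument: the bounds of a competitor [P0] pass to the maximizer, by a dimension
    count after one line is removed from [P] or added to it. *)
Lemma maximizer_form_gap a b P0 : grassmannian_fin d n P0 ->
  form_gap a b S P0 -> form_gap a b S P.
Proof.
move=> hP0 [ga gb]; have pP := grass_proj hP; have [PT PP] := pP.
have pP0 := grass_proj hP0; split.
- move=> y; have : P *m (P *m y) = P *m y by rewrite mulmxA -PP.
  move: (P *m y) => {}y Py; have [->|y0] := eqVneq y 0.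
    by rewrite !mdot0l mulr0.
  have [k k0 ky] := normalize y0.
  have Pky : P *m (k *: y) = k *: y by rewrite -scalemxAr Py.
  (* Without the line of [y] the trace of [P] drops to [d - 1], so some [v] in the image of [P0] has
     [P v] on that line; [swap] then compares [v] with [y]. *)
  have [|v [v0 P0v Xv]] := @proj_meet n _ _ (proj_outerB pP Pky ky) pP0.
    by rewrite linearB /= tr_outer ky (grass_tr hP) (grass_tr hP0); lra.
  move: Xv; rewrite mulmxBl mul_outer => /eqP; rewrite subr_eq0 => /eqP Pv.
  have Pz : P *m (v - P *m v) = 0 by rewrite mulmxBr mulmxA -PP subrr.
  have := swap (mdot (k *: y) v) ky Pky Pz; rewrite -Pv addrC subrK => h.
  have := ga v; rewrite P0v => /le_trans /(_ h).
  rewrite ler_pM2r ?mdot_gt0// => {}h.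
  have -> : y = k^-1 *: (k *: y) by rewrite scalerA mulVf ?scale1r// gt_eqF.
  rewrite -(scalemxAr k^-1) !(mdotZl k^-1) !(mdotZr k^-1) ky.
  rewrite mulrCA ler_pM2l ?invr_gt0// mulrCA ler_pM2l ?invr_gt0// mulr1//.
- move=> y Py; have [->|y0] := eqVneq y 0; first by rewrite !mdot0l mulr0.
  have [k k0 ky] := normalize y0.
  have Pky : P *m (k *: y) = 0 by rewrite -scalemxAr Py scaler0.
  (* With the line of [y] added the trace is [d + 1], so the larger image contains some [v] killed
     by [P0]; it is the sum of [P v] and a multiple of [y]. *)
  have [|v [v0 Xv P0v]] := @proj_meet n _ _ pP0 (proj_outerD pP Pky ky).
    by rewrite linearD /= tr_outer ky (grass_tr hP) (grass_tr hP0); lra.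
  have h := gb v P0v; move: Xv; rewrite mulmxDl mul_outer => vE.
  have : P *m (P *m v) = P *m v by rewrite mulmxA -PP.
  have yE : y = k^-1 *: (k *: y) by rewrite scalerA mulVf ?scale1r// gt_eqF.
  move: (k *: y : 'cV_n) ky Pky yE vE => z ky Pky -> {y Py y0}.
  move: (P *m v) (mdot z v) => x c vE Px.
  have xz : mdot x z = 0 by rewrite -Px mdot_mull -PT Pky mdot0r.
  have xSz : mdot x (S *m z) = 0 by exact: crossless.
  have zSx : mdot z (S *m x) = 0 by rewrite mdotC mdot_mull ST xSz.
  have hx : mdot z (S *m z) * mdot x x <= mdot x (S *m x).
    have [->|x0] := eqVneq x 0; first by rewrite !mdot0l mulr0.
    have [l l0 lx] := normalize x0.
    have Plx : P *m (l *: x) = l *: x by rewrite -scalemxAr Px.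
    (* With coefficient 0, [swap] replaces [x] entirely by the unit vector [z]. *)
    have := swap 0 lx Plx Pky; rewrite scale0r add0r ky mulr1.
    rewrite -scalemxAr !mdotZl !mdotZr => hh.
    move: lx; rewrite mdotZl mdotZr => lx.
    apply: le_trans (ler_wpM2r (mdot_ge0 x) hh) _.
    rewrite [X in X <= _](_ : _ = l * (l * mdot x x) * mdot x (S *m x)).
      by rewrite lx mul1r.
    by ring.
  have zx : mdot z x = 0 by rewrite mdotC.
  have v1 : mdot v v = mdot x x + c ^+ 2.
    rewrite -vE !(mdotDl, mdotDr, mdotZl, mdotZr) zx xz ky; ring.
  have v2 : mdot v (S *m v) = mdot x (S *m x) + c ^+ 2 * mdot z (S *m z).
    rewrite -vE mulmxDr -scalemxAr !(mdotDl, mdotDr, mdotZl, mdotZr) xSz zSx.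
    by ring.
  have vv := mdot_gt0 v0; rewrite v1 in vv; rewrite v1 v2 in h.
  have : mdot z (S *m z) <= b.
    by rewrite -(ler_pM2r vv); apply: le_trans h; rewrite mulrDr; lra.
  move=> {}h; rewrite -(scalemxAr k^-1) !(mdotZl k^-1) !(mdotZr k^-1) ky.
  rewrite [X in _ <= X]mulrCA ler_pM2l ?invr_gt0//.
  by rewrite mulrCA ler_pM2l ?invr_gt0// mulr1.
Qed.

End Maximizer.

End SpectralGap.

(** * Topology of matrix spaces: entries, Frobenius balls, extreme values *)

Section MatrixTopology.
Context {R : realType}.

Lemma cvg_mx (T : Type) (F : set_system T) (FF : Filter F) m n
    (f : T -> 'M[R]_(m, n)) (M : 'M[R]_(m, n)) :
  (forall i j, f x i j @[x --> F] --> M i j) -> f x @[x --> F] --> M.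
Proof.
move=> h A [P hP sPA].
apply: filterS (_ : \forall x \near F, forall ij, P ij.1 ij.2 (f x ij.1 ij.2)).
  by move=> x hx; apply: sPA => i j; exact: (hx (i, j)).
by apply: filter_forall => -[i j]; exact: (h i j _ (hP i j)).
Qed.

Lemma continuous_at_mx (T : topologicalType) m n (f : T -> 'M[R]_(m, n)) x :
  (forall i j, {for x, continuous (fun y => f y i j)}) -> {for x, continuous f}.
Proof. by move=> h; apply: (@cvg_mx _ (nbhs x) _ _ _ f) => i j; exact: h. Qed.

Lemma continuous_mdot (T : topologicalType) m n (f g : T -> 'M[R]_(m, n)) :
  continuous f -> continuous g -> continuous (fun x => mdot (f x) (g x)).
Proof.
move=> cf cg; rewrite (_ : (fun x => _) =
    (fun x => \sum_(j < n) \sum_(i < m) f x i j * g x i j)); last first.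
  by apply/funext => x; rewrite mdotE.
apply: continuous_sum_ord => j; apply: continuous_sum_ord => i x.
apply: cvgM; first exact: (cvg_comp _ _ (cf x) (@coord_continuous _ _ _ _ _ _)).
exact: (cvg_comp _ _ (cg x) (@coord_continuous _ _ _ _ _ _)).
Qed.

Lemma continuous_frob (T : topologicalType) m n (f : T -> 'M[R]_(m, n)) :
  continuous f -> continuous (fun x => frob (f x)).
Proof.
move=> cf x; apply: (@continuous_comp _ _ _ (fun x => mdot (f x) (f x)) Num.sqrt).
  exact: continuous_mdot.
exact: sqrt_continuous.
Qed.

Lemma near_frob_lt m n (A : 'M[R]_(m, n)) e : 0 < e ->
  \forall B \near A, frob (B - A) < e.
Proof.
move=> e0; have c : continuous (fun B : 'M[R]_(m, n) => frob (B - A)).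
  apply: continuous_frob => B; apply: continuous_at_mx => i j.
  rewrite (_ : (fun _ => _) = (fun C : 'M[R]_(m, n) => C i j - A i j)).
    by apply: continuousB; [exact: coord_continuous|exact: cst_continuous].
  by apply/funext => C; rewrite !mxE.
have := c A; rewrite /continuous_at subrr frob0.
by move/cvgr_lt; apply.
Qed.

Lemma nbhs_frobP m n (A : 'M[R]_(m, n)) (V : set 'M[R]_(m, n)) : nbhs A V ->
  exists2 e, 0 < e & forall B, frob (B - A) <= e -> V B.
Proof.
move=> /nbhs_ballP[e /= e0 AV]; exists (e / 2); first by rewrite divr_gt0.
move=> B BA; apply: AV; split=> // i j; rewrite /ball /= distrC.
have := entry_le_frob (B - A) i j; rewrite !mxE => h.
by apply: le_lt_trans h _; apply: le_lt_trans BA _; rewrite ltr_pdivrMr// ltr_pMr// ltr1n.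
Qed.

(** [vec_mx] transports the extreme value theorem from row vectors; a Frobenius bound controls every
    entry, hence the maximum norm in which boundedness is measured. *)
Lemma EVT_max_mx m n (K : set 'M[R]_(m, n)) (f : 'M[R]_(m, n) -> R) b :
  K !=set0 -> closed K -> (forall A, K A -> frob A <= b) -> continuous f ->
  exists2 A, K A & forall B, K B -> f B <= f A.
Proof.
move=> [A0 KA0] cK bK cf.
have cv : continuous (@vec_mx R m n).
  move=> v; apply: continuous_at_mx => i j.
  rewrite (_ : (fun _ => _) = (fun w : 'rV[R]_(m * n) => w 0 (mxvec_index i j))).
    exact: coord_continuous.
  by apply/funext => w; rewrite mxE.
have [|||v vK maxv] := @EVT_max_rV R (m * n) (f \o vec_mx) (vec_mx @^-1` K).
- by exists (mxvec A0); rewrite /= mxvecK.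
- apply: bounded_closed_compact; last first.
    by apply: preimage_closed cK => v _; exact: cv.
  exists b; split; first exact: num_real.
  move=> M bM v Kv; rewrite /Num.norm /= mx_normrE; apply/bigmax_leP; split=> /=.
    apply: (le_trans _ (ltW bM)); apply: le_trans (bK _ Kv); exact: frob_ge0.
  move=> [i k] _ /=; rewrite ord1; case/mxvec_indexP: k => k l.
  have := entry_le_frob (vec_mx v) k l; rewrite mxE => h.
  by apply: le_trans h _; apply: le_trans (bK _ Kv) (ltW bM).
- apply: continuous_subspaceT => v.
  by apply: (cvg_comp _ _ (cv v)); exact: cf.
exists (vec_mx v); first by move: vK; rewrite inE.
by move=> B KB; have := maxv (mxvec B); rewrite /= mxvecK; apply; rewrite inE /= mxvecK.
Qed.

End MatrixTopology.

(** * Existence and stability of spectral projections *)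

Section GapExistence.
Context {R : realType}.

(** Elements of Gr(d, n) have norm [sqrt d], so [<P, S>] attains a maximum. The maximizer commutes
    with [S] and inherits the constants of [P0]: a mere form gap is upgraded to an invariant
    projection. *)
Lemma gap_proj_exists d n a b (S P0 : 'M[R]_n) : S^T = S ->
  grassmannian_fin d n P0 -> form_gap a b S P0 -> exists P, gap_proj d a b S P.
Proof.
move=> ST hP0 g0.
have [||A hA||P hP maxP] := @EVT_max_mx R n n (grassmannian_fin d n)
  (fun P => mdot P S) (Num.sqrt d%:R).
- by exists P0.
- exact: closed_grassmannian_fin.
- by rewrite /frob -/(mdot A A) mdot_proj_tr ?(grass_tr hA)//; exact: grass_proj hA.
- apply: (@continuous_mdot _ _ _ _ id (fun=> S)); last exact: cst_continuous.
  by move=> B; exact: cvg_id.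
exists P; split => //; first exact: maximizer_commutes ST hP maxP.
exact: maximizer_form_gap ST hP maxP _ _ _ hP0 g0.
Qed.

(** The Frobenius norm dominates the operator norm, so the form moves by at most [e |x|^2]. *)
Lemma form_gap_perturb n a b (S S' P : 'M[R]_n) e : frob (S' - S) <= e ->
  form_gap a b S P -> form_gap (a - e) (b + e) S' P.
Proof.
move=> he [ga gb].
have h (x : 'cV[R]_n) : `|mdot x (S' *m x) - mdot x (S *m x)| <= e * mdot x x.
  rewrite -mdotBr -mulmxBl (le_trans (mdot_CS_norm _ _))// -frob_sqr expr2.
  rewrite mulrA [X in _ <= X]mulrC ler_wpM2l ?frob_ge0//.
  by rewrite (le_trans (frobM _ _))// ler_wpM2r ?frob_ge0.
split=> [x|x Px].
  have := h (P *m x); have := ga x; rewrite mulrBl ler_norml; lra.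
by have := h x; have := gb x Px; rewrite mulrDl ler_norml; lra.
Qed.

Lemma form_gap_proj n (P : 'M[R]_n) : is_proj P -> form_gap 1 0 P P.
Proof.
move=> [PT PP]; split=> [x|x Px]; first by rewrite mul1r mulmxA -PP.
by rewrite Px mdot0r mul0r.
Qed.

(** Quadratic growth for [S] at [P] meets maximality of [P'] for [S']: together [(a - b) / 2 * |P' -
    P|^2 <= <P' - P, S' - S>], and after Cauchy-Schwarz one factor cancels. *)
Lemma gap_proj_lipschitz d n a b (S S' P P' : 'M[R]_n) : S^T = S ->
  S'^T = S' -> gap_proj d a b S P -> grassmannian_fin d n P' -> b < a ->
  (forall Q, grassmannian_fin d n Q -> mdot Q S' <= mdot P' S') ->
  frob (P' - P) <= 2 / (a - b) * frob (S' - S).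
Proof.
move=> ST ST' hP hP' ab maxP'; have ab0 : 0 < a - b by rewrite subr_gt0.
have h1 := gap_proj_ineq ST hP hP'; have h2 := maxP' P (let: And3 x _ _ := hP in x).
have h3 := mdot_CS (P' - P) (S' - S).
have h4 : (a - b) / 2 * frob (P' - P) ^+ 2 <= frob (P' - P) * frob (S' - S).
  apply: le_trans _ h3; rewrite frob_sqr.
  rewrite -[P' - P in X in X <= _]opprB mdotNl mdotNr opprK.
  by apply: le_trans h1 _; rewrite mdotBl !mdotBr; lra.
have [->|p0] := eqVneq (frob (P' - P)) 0.
  by rewrite mulr_ge0 ?frob_ge0// divr_ge0// ltW.
have pp : 0 < frob (P' - P) by rewrite lt_def p0 frob_ge0.
rewrite mulrAC ler_pdivlMr// -(ler_pM2l pp).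
by rewrite expr2 in h4; nra.
Qed.

Lemma gap_proj_max d n a b (S P : 'M[R]_n) : S^T = S -> b <= a ->
  gap_proj d a b S P ->
  forall Q, grassmannian_fin d n Q -> mdot Q S <= mdot P S.
Proof.
move=> ST ab hP Q hQ; rewrite -subr_ge0.
apply: le_trans (gap_proj_ineq ST hP hQ).
by rewrite mulr_ge0 ?mdot_ge0// divr_ge0// subr_ge0.
Qed.

(** The condition [0 <= b] enters because [E S E^T] vanishes on the complement of the image of [E],
    which lies in the kernel of the new projection. *)
Lemma gap_proj_isometry d m n a b (S P : 'M[R]_n) (E : 'M[R]_(m, n)) :
  E^T *m E = 1%:M -> 0 <= b -> gap_proj d a b S P ->
  gap_proj d a b (E *m S *m E^T) (E *m P *m E^T).
Proof.
move=> EE b0 [hP PS [ga gb]]; have [PT PP] := grass_proj hP.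
have EK p (X : 'M[R]_(n, p)) : E^T *m (E *m X) = X.
  by rewrite mulmxA EE mul1mx.
have hP' : is_proj (E *m P *m E^T).
  split; first by rewrite !trmx_mul trmxK -PT mulmxA.
  by rewrite -!mulmxA EK (mulmxA P P) -PP.
split.
- apply: proj_grass => //.
  by rewrite mxtrace_mulC mulmxA EE mul1mx (grass_tr hP).
- by rewrite -!mulmxA !EK (mulmxA S) PS -mulmxA.
split=> x.
  by have := ga (E^T *m x); rewrite -!mulmxA !mdot_mull !EK.
move=> EPx; have := gb (E^T *m x).
have Px : P *m (E^T *m x) = 0 by rewrite -[LHS]EK (mulmxA E) (mulmxA (E *m P)) EPx mulmx0.
move=> /(_ Px); rewrite mdot_mull trmxK -!mulmxA => h; apply: le_trans h _.
by rewrite ler_wpM2l// -le_frob frob_coisometry.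
Qed.

End GapExistence.

(** * Infinite matrices *)

Section InfiniteMatrixTopology.
Context {R : realType}.
Implicit Types A B : infmx R.

Definition supported n A := forall i j, (n <= i)%N || (n <= j)%N -> A i j = 0.

Definition trunc n A : 'M[R]_n := \matrix_(i, j) A i j.

Definition incl_mx n m : 'M[R]_(m, n) := \matrix_(i, j) (i == j :> nat)%:R.

Lemma supported_pad n (a : 'M[R]_n) : supported n (pad a).
Proof. by move=> i j; exact: pad_out. Qed.

Lemma supportedW n m A : (n <= m)%N -> supported n A -> supported m A.
Proof.
by move=> nm h i j /orP[ij|ij]; apply: h; rewrite (leq_trans nm ij) ?orbT.
Qed.

Lemma pad_trunc n A : supported n A -> pad (trunc n A) = A.
Proof.
move=> h; apply: infmxP => i j.
have [ij|] := boolP ((n <= i)%N || (n <= j)%N); first by rewrite pad_out// h.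
rewrite negb_or -!ltnNge => /andP[ilt jlt].
by rewrite -[i]/(Ordinal ilt : nat) -[j]/(Ordinal jlt : nat) pad_ord mxE.
Qed.

Lemma pad_truncW n m (a : 'M[R]_n) : (n <= m)%N -> pad (trunc m (pad a)) = pad a.
Proof. by move=> nm; apply/pad_trunc/(supportedW nm)/supported_pad. Qed.

Lemma sum_delta n (F : nat -> R) i : (forall k, (n <= k)%N -> F k = 0) ->
  \sum_(k < n) (i == k :> nat)%:R * F k = F i.
Proof.
move=> F0; have [ni|ni] := leqP n i.
  by rewrite F0// big1// => k _; rewrite gtn_eqF ?mul0r// (leq_trans _ ni).
rewrite (bigD1 (Ordinal ni))//= eqxx mul1r big1 ?addr0// => k ki.
by rewrite (_ : (i == k) = false) ?mul0r//; apply: contraNF ki => /eqP ik; apply/eqP/val_inj.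
Qed.

(** For [n <= m] padding is conjugation by an isometry, so [gap_proj_isometry] moves spectral gaps
    between matrix sizes. *)
Lemma incl_mxE n m (a : 'M[R]_n) :
  incl_mx n m *m a *m (incl_mx n m)^T = trunc m (pad a).
Proof.
apply/matrixP => i j; rewrite mxE [RHS]mxE.
have e1 (k : 'I_n) : (incl_mx n m *m a) i k = pad a i k.
  rewrite mxE -(@sum_delta n (fun l => pad a l k)) => [|l nl].
    by apply: eq_bigr => l _; rewrite mxE pad_ord.
  by rewrite pad_out// nl.
rewrite -(@sum_delta n (fun l => pad a i l)) => [|l nl].
  by apply: eq_bigr => l _; rewrite e1 !mxE mulrC.
by rewrite pad_out// nl orbT.
Qed.

Lemma incl_mx_isometry n m : (n <= m)%N ->
  (incl_mx n m)^T *m incl_mx n m = 1%:M.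
Proof.
move=> nm; apply/matrixP => i j; rewrite !mxE.
rewrite -[RHS](@sum_delta m (fun k => (k == j :> nat)%:R)) => [|k mk].
  by apply: eq_bigr => k _; rewrite !mxE eq_sym.
by rewrite gtn_eqF// (leq_trans (ltn_ord j))// (leq_trans nm).
Qed.

Lemma continuous_pad n : continuous (@pad R n).
Proof. by apply/continuousP => W oW; exact: oW. Qed.

Lemma open_infmxP (W : set (infmx R)) :
  open W <-> forall n, open (@pad R n @^-1` W).
Proof. by []. Qed.

Lemma continuous_infmx_entry i j : continuous (fun A => A i j).
Proof.
apply/continuousP => W oW; apply/open_infmxP => n.
suff c : continuous (fun a : 'M[R]_n => pad a i j) by move/continuousP: c; exact.
rewrite /pad /= /pad_fun; case: (insub i) => [i'|]; last exact: cst_continuous.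
case: (insub j) => [j'|]; last exact: cst_continuous.
exact: coord_continuous.
Qed.

(** In the direct limit topology continuity of the entries alone does not suffice; a common support
    bound near [x] makes the map factor through one matrix space. *)
Lemma continuous_at_infmx (X : topologicalType) (f : X -> infmx R) x n :
  (\forall y \near x, supported n (f y)) ->
  (forall i j, {for x, continuous (fun y => f y i j)}) ->
  {for x, continuous f}.
Proof.
move=> nf cf.
have c : {for x, continuous (fun y => pad (trunc n (f y)))}.
  apply: (@continuous_comp _ _ _ (fun y => trunc n (f y)) (@pad R n)).
    apply: continuous_at_mx => i j; rewrite (_ : (fun _ => _) = fun y => f y i j)//.
    by apply/funext => y; rewrite mxE.
  exact: continuous_pad.
have fx : pad (trunc n (f x)) = f x.
  by apply: pad_trunc; exact: (nbhs_singleton nf).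
rewrite /prop_for /continuous_at -fx; apply: cvg_trans c; apply: near_eq_cvg.
by near=> y; apply: pad_trunc; near: y.
Unshelve. all: by end_near. Qed.

Lemma frob_dist_pad n (a b : 'M[R]_n) : frob_dist (pad a) (pad b) = frob (a - b).
Proof.
rewrite /frob_dist /frob -[\tr _]/(mdot _ _) mdotE; congr Num.sqrt.
have fin (F : nat -> R) : (forall k, (n <= k)%N -> F k = 0) ->
    \sum_(k \in [set: nat]) F k = \sum_(k < n) F k.
  move=> F0; rewrite fsbig_ord; apply/esym.
  by apply: fsbig_widen => // k [_ /= /negP]; rewrite -leqNgt => /F0.
rewrite fin => [|j nj].
  apply: eq_bigr => j _; rewrite fin => [|i ni].
    by apply: eq_bigr => i _; rewrite !pad_ord !mxE expr2.
  by rewrite !pad_out ?ni// subr0 expr0n.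
by apply: fsbig1 => i _; rewrite !pad_out ?nj ?orbT// subr0 expr0n.
Qed.

End InfiniteMatrixTopology.

(** * The closest point projection *)

Section ClosestPoint.
Context {R : realType}.
Implicit Types (A : infmx R) (d n : nat).

(** Matrices of the thickened Grassmannian need not be symmetric, but only their symmetric part
    decides which [Q] in Gr(d) is closest. *)
Definition symm n (a : 'M[R]_n) := 2^-1 *: (a + a^T).

Lemma symmT n (a : 'M[R]_n) : (symm a)^T = symm a.
Proof. by rewrite /symm linearZ linearD /= trmxK addrC. Qed.

Lemma symm_id n (a : 'M[R]_n) : a^T = a -> symm a = a.
Proof.
move=> aT; rewrite /symm aT (_ : a + a = 2 *: a); last by rewrite scaler_nat mulr2n.
by rewrite scalerA mulVf ?scale1r// pnatr_eq0.
Qed.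

Lemma mdot_symm n (a Q : 'M[R]_n) : Q = Q^T -> mdot Q (symm a) = mdot Q a.
Proof.
by move=> QT; rewrite /symm mdotZr mdotDr {2}QT mdotT; lra.
Qed.

Lemma frob_symmB n (a b : 'M[R]_n) : frob (symm a - symm b) <= frob (a - b).
Proof.
rewrite /symm -scalerBr opprD addrACA -linearB /= frobZ ger0_norm ?invr_ge0//.
have := frobD (a - b) (a - b)^T; rewrite frobT; lra.
Qed.

Lemma symm_conj n m (a : 'M[R]_n) (E : 'M[R]_(m, n)) :
  symm (E *m a *m E^T) = E *m symm a *m E^T.
Proof.
rewrite /symm !trmx_mul trmxK mulmxA -mulmxDl -mulmxDr.
by rewrite -scalemxAr -scalemxAl.
Qed.

(** Since [mdot a a + d] does not depend on [Q], the closest points to [a] are the maximizers of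
    [mdot Q (symm a)]. *)
Lemma sqr_frob_grass d n (a Q : 'M[R]_n) : grassmannian_fin d n Q ->
  frob (a - Q) ^+ 2 = mdot a a + d%:R - 2 * mdot Q (symm a).
Proof.
move=> hQ; have pQ := grass_proj hQ; rewrite frob_sqr mdotBl !mdotBr.
rewrite (mdot_proj_tr pQ) (grass_tr hQ) (mdot_symm a pQ.1).
by rewrite [mdot a Q]mdotC; ring.
Qed.

Lemma gap_proj_closest d n a b (x P Q : 'M[R]_n) : b < a ->
  gap_proj d a b (symm x) P -> grassmannian_fin d n Q ->
  frob (x - P) <= frob (x - Q) /\ (frob (x - Q) <= frob (x - P) -> P = Q).
Proof.
move=> ab hP hQ; have [gP _ _] := hP.
rewrite -!(@ler_sqr _ (frob _)) ?nnegrE ?frob_ge0// !(sqr_frob_grass _ gP).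
rewrite !(sqr_frob_grass _ hQ); split=> [|h].
  have := gap_proj_max (symmT x) (ltW ab) hP hQ; lra.
apply: (gap_proj_eq (symmT x) ab hP hQ); lra.
Qed.

(** Asking [0 <= b] makes the notion stable under a change of size: padding adds only zero
    eigenvalues, which stay below the gap. *)
Definition spectral_proj d A (P : infmx R) := exists n (x Q : 'M[R]_n) a b,
  [/\ A = pad x, P = pad Q, 0 <= b < a & gap_proj d a b (symm x) Q].

(** A domain for the closest point that contains the tubular neighbourhoods of radius at most 1/2
    and also matrices possibly far from Gr(d), as met along the deformation of cocycles. *)
Definition spectral_domain d := [set A | exists P, spectral_proj d A P].

Lemma gap_proj_incl d n m a b (x P : 'M[R]_n) : (n <= m)%N -> 0 <= b ->
  gap_proj d a b (symm x) P ->
  gap_proj d a b (symm (trunc m (pad x))) (trunc m (pad P)).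
Proof.
move=> nm b0 hP; rewrite -!incl_mxE symm_conj.
apply: gap_proj_isometry b0 hP; exact: incl_mx_isometry.
Qed.

Lemma grass_pad_trunc d n m (q : 'M[R]_n) : (n <= m)%N ->
  grassmannian_fin d n q -> grassmannian_fin d m (trunc m (pad q)).
Proof. by move=> nm hq; apply/grassmannian_pad; rewrite pad_truncW//; apply/grassmannian_pad. Qed.

Lemma spectral_proj_closest d A P Q : spectral_proj d A P -> grassmannian d Q ->
  frob_dist A P <= frob_dist A Q /\ (frob_dist A Q <= frob_dist A P -> P = Q).
Proof.
move=> [n [x [p [a [b [-> -> /andP[b0 ab] hp]]]]]] [m _ [q hq <-]].
have nk := leq_maxl n m; have mk := leq_maxr n m.
rewrite -(pad_truncW x nk) -(pad_truncW p nk) -(pad_truncW q mk) !frob_dist_pad.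
have hp' := gap_proj_incl nk b0 hp; have hq' := grass_pad_trunc mk hq.
have [h1 h2] := gap_proj_closest ab hp' hq'.
by split=> // h; rewrite (h2 h).
Qed.

Lemma spectral_proj_grass d A P : spectral_proj d A P -> grassmannian d P.
Proof.
by move=> [n [x [p [a [b [_ -> _ [hp _ _]]]]]]]; apply/grassmannian_pad.
Qed.

Lemma closest_pointE d A P : spectral_proj d A P -> closest_point d A = P.
Proof.
move=> h; have [g c] : grassmannian d (closest_point d A) /\
    forall Q, grassmannian d Q ->
      frob_dist A (closest_point d A) <= frob_dist A Q.
  apply: (@getPex _ [set P | grassmannian d P /\
    forall Q, grassmannian d Q -> frob_dist A P <= frob_dist A Q]).
  exists P; split; first exact: spectral_proj_grass h.
  by move=> Q hQ; exact: (spectral_proj_closest h hQ).1.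
apply/esym/(spectral_proj_closest h g).2; apply: c.
exact: spectral_proj_grass h.
Qed.

Lemma spectral_domainP d A :
  spectral_domain d A -> spectral_proj d A (closest_point d A).
Proof. by move=> [P h]; rewrite (closest_pointE h). Qed.

Lemma grass_spectral_proj d A : grassmannian d A -> spectral_proj d A A.
Proof.
move=> [n _ [p hp <-]]; exists n, p, p, 1, 0; split=> //; first by rewrite lexx ltr01.
have pp := grass_proj hp; rewrite symm_id -?(pp.1)//; split=> //.
exact: form_gap_proj.
Qed.

Lemma closest_point_grass d A : grassmannian d A -> closest_point d A = A.
Proof. by move=> /grass_spectral_proj /closest_pointE. Qed.

(** [p] itself has the gap from 0 to 1; a perturbation of size [delta < 1/2] leaves the gap from
    [delta] to [1 - delta]. *)
Lemma near_gap_proj d n (x p : 'M[R]_n) e : grassmannian_fin d n p ->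
  frob (x - p) < e -> e <= 1 / 2 ->
  exists P a b, [/\ 0 <= b < a, gap_proj d a b (symm x) P & frob (x - P) < e].
Proof.
move=> hp xp e2; have pp := grass_proj hp.
have : frob (symm x - p) <= frob (x - p).
  by rewrite -{1}(symm_id (esym pp.1)) frob_symmB.
move/form_gap_perturb => /(_ _ _ _ (form_gap_proj pp)) hg.
have [P hP] := gap_proj_exists (symmT x) hp hg.
exists P, (1 - frob (x - p)), (0 + frob (x - p)); split=> //.
  by apply/andP; split; have := frob_ge0 (x - p); lra.
have ab : 0 + frob (x - p) < 1 - frob (x - p) by lra.
by apply: le_lt_trans xp; have [] := gap_proj_closest ab hP hp.
Qed.

Lemma near_spectral_domain d A e : 0 < e <= 1 / 2 -> thick_grassmannian d e A ->
  spectral_domain d A.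
Proof.
move=> /andP[e0 e2]; rewrite /thick_grassmannian gt_eqF//= => -[_ [m _ [p hp <-]] h].
have [n An] := infmx_finsupp A; have {}An : supported n A by [].
have nk := leq_maxl n m; have mk := leq_maxr n m.
rewrite -(pad_trunc (supportedW nk An)) -(pad_truncW p mk) frob_dist_pad in h.
have [P [a [b [ab hP _]]]] := near_gap_proj (grass_pad_trunc mk hp) h e2.
exists (pad P), (maxn n m), (trunc (maxn n m) A), P, a, b; split=> //.
by rewrite pad_trunc//; exact: supportedW An.
Qed.

Lemma gap_proj_continuous d n a b (x P : 'M[R]_n) e : 0 <= b < a -> 0 < e ->
  gap_proj d a b (symm x) P ->
  \forall y \near x, exists Q a' b',
    [/\ 0 <= b' < a', gap_proj d a' b' (symm y) Q & frob (Q - P) <= e].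
Proof.
move=> /andP[b0 ab] e0 hP; have [gP _ fP] := hP.
have ab0 : 0 < a - b by rewrite subr_gt0.
(* The first bound keeps [b + t < a - t]; the second makes the Lipschitz constant [2 / (a - b)]
   times [t] at most [e]. *)
pose t := Num.min ((a - b) / 3) ((a - b) / 2 * e).
have t0 : 0 < t by rewrite lt_min divr_gt0//= mulr_gt0// divr_gt0.
have t3 : t <= (a - b) / 3 by rewrite ge_min lexx.
have te : t <= (a - b) / 2 * e by rewrite ge_min lexx orbT.
apply: filterS (near_frob_lt x t0) => y yx.
have yx' : frob (symm y - symm x) <= t := le_trans (frob_symmB _ _) (ltW yx).
have [Q hQ] := gap_proj_exists (symmT y) gP (form_gap_perturb yx' fP).
have ab' : b + t < a - t by lra.
exists Q, (a - t), (b + t); split=> //; first by apply/andP; split; lra.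
have [gQ _ _] := hQ.
have := gap_proj_lipschitz (symmT x) (symmT y) hP gQ ab
  (gap_proj_max (symmT y) (ltW ab') hQ).
move=> h; apply: le_trans h _.
have -> : e = 2 / (a - b) * ((a - b) / 2 * e) by field; lra.
by rewrite ler_wpM2l ?(le_trans yx')// divr_ge0// ltW.
Qed.

Lemma continuous_incl n m : continuous (fun x : 'M[R]_n => trunc m (pad x)).
Proof.
move=> x; apply: continuous_at_mx => i j.
rewrite (_ : (fun _ => _) = (fun A : infmx R => A i j) \o @pad R n).
  by apply: continuous_comp; [exact: continuous_pad|exact: continuous_infmx_entry].
by apply/funext => y /=; rewrite mxE.
Qed.

Lemma continuous_closest_point d A : spectral_domain d A ->
  {for A, continuous (@closest_point R d)}.
Proof.
move=> hA V; rewrite nbhsE => -[W [oW AW] WV].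
(* Openness of the domain and continuity on it are proved together, as the gap at nearby matrices
   provides both. *)
suff oG : open (spectral_domain d `&` closest_point d @^-1` W).
  apply: (@filterS _ (nbhs A) _ (spectral_domain d `&` closest_point d @^-1` W)).
    by move=> B [_ /WV].
  by apply: open_nbhs_nbhs; split.
apply/open_infmxP => n; rewrite openE => x /= [/spectral_domainP].
set P := closest_point d (pad x) => -[m [y [p [a [b [xy PE ab hp]]]]]].
rewrite PE => WP; have /andP[b0 _] := ab.
(* Openness is tested in size [n], while the gap is witnessed in size [m]; both are padded to a
   common size. *)
have nk := leq_maxl n m; have mk := leq_maxr n m.
set k := maxn n m in nk mk.
have := gap_proj_incl mk b0 hp; rewrite -xy.
set p' := trunc k (pad p) => hp'.
have Wp' : nbhs p' (@pad R k @^-1` W).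
  apply: open_nbhs_nbhs; split; first exact: oW.
  by rewrite /= /p' pad_truncW.
have [e e0 he] := nbhs_frobP Wp'.
have N : \forall z \near x, exists Q a' b', [/\ 0 <= b' < a',
    gap_proj d a' b' (symm (trunc k (pad z))) Q & frob (Q - p') <= e].
  exact: (@continuous_incl n k x _ (gap_proj_continuous ab e0 hp')).
apply: filterS N => z [Q [a' [b' [ab' hQ Qp]]]].
have sp : spectral_proj d (pad z) (pad Q).
  by exists k, (trunc k (pad z)), Q, a', b'; split=> //; rewrite pad_truncW.
split; first by exists (pad Q).
by rewrite /= (closest_pointE sp); exact: he.
Qed.

End ClosestPoint.

(** * Inverse square roots *)

Section InverseSquareRoot.
Context {R : realType}.

Lemma unitmx_inj n (A : 'M[R]_n) : (forall x : 'cV_n, A *m x = 0 -> x = 0) ->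
  A \in unitmx.
Proof.
move=> h; rewrite -unitmx_tr -row_free_unit -kermx_eq0.
apply/eqP/row_matrixP => i; rewrite row0.
have : row i (kermx A^T) *m A^T = 0 by apply/sub_kermxP; exact: row_sub.
move=> /(congr1 trmx); rewrite trmx_mul trmxK trmx0 => /h /(congr1 trmx).
by rewrite trmxK trmx0.
Qed.

Lemma unitmx_1B n (Y : 'M[R]_n) : frob Y < 1 -> 1%:M - Y \in unitmx.
Proof.
move=> Y1; apply: unitmx_inj => x; rewrite mulmxBl mul1mx => /eqP.
rewrite subr_eq0 => /eqP xY; apply/eqP; rewrite -frob_eq0.
have h := frobM Y x; rewrite -xY in h; have := frob_ge0 x; nra.
Qed.

Definition sqrt_step n (X Y : 'M[R]_n) := 2^-1 *: (X + Y *m Y).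

(** On the ball of radius 1/2 squaring is 1-Lipschitz, so [sqrt_step] contracts by 1/2 in [Y]. *)
Lemma frob_sqrt_stepB n (X X' Y Y' : 'M[R]_n) :
  frob Y <= 2^-1 -> frob Y' <= 2^-1 ->
  frob (sqrt_step X Y - sqrt_step X' Y') <=
  2^-1 * frob (X - X') + 2^-1 * frob (Y - Y').
Proof.
move=> hY hY'; rewrite /sqrt_step -scalerBr frobZ ger0_norm ?invr_ge0//.
rewrite -mulrDr ler_wpM2l ?invr_ge0// opprD addrACA.
apply: le_trans (frobD _ _) _; rewrite lerD2l.
have -> : Y *m Y - Y' *m Y' = Y *m (Y - Y') + (Y - Y') *m Y'.
  by rewrite mulmxBr mulmxBl addrA subrK.
apply: le_trans (frobD _ _) _.
have h1 := frobM Y (Y - Y'); have h2 := frobM (Y - Y') Y'.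
have := frob_ge0 (Y - Y'); nra.
Qed.

Lemma frob_sqrt_step n (X Y : 'M[R]_n) : frob X <= 2^-1 -> frob Y <= 2^-1 ->
  frob (sqrt_step X Y) <= 2^-1.
Proof.
move=> hX hY; rewrite /sqrt_step frobZ ger0_norm ?invr_ge0//.
have h1 := frobD X (Y *m Y); have h2 := frobM Y Y; have := frob_ge0 Y; nra.
Qed.

(* The fixed point of sqrt_step X solves (1 - Y)^2 = 1 - X; by compactness the
   displacement has a minimum, which the contraction forces to be 0. *)
Lemma sqrt_fixpoint_exists n (X : 'M[R]_n) : frob X <= 2^-1 ->
  exists Y, frob Y <= 2^-1 /\ sqrt_step X Y = Y.
Proof.
move=> hX.
have cid : continuous (id : 'M[R]_n -> 'M[R]_n) by move=> Y; exact: cvg_id.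
have [||//||Y hY maxY] := @EVT_max_mx R n n [set Y | frob Y <= 2^-1]
    (fun Y => - frob (sqrt_step X Y - Y)) 2^-1.
- by exists 0; rewrite /= frob0 invr_ge0.
- rewrite (_ : [set Y | _] = @frob R n n @^-1` [set x : R | x <= 2^-1])//.
  apply: preimage_closed; last exact: closed_le.
  by move=> Y _; apply: (@continuous_frob _ _ _ _ id).
- suff c : continuous (fun Y : 'M[R]_n => frob (sqrt_step X Y - Y)).
    by move=> Z; apply: (@cvgN _ _ _ (nbhs Z) _ _ _ (c Z)).
  apply: continuous_frob => Y.
  apply: continuous_at_mx => i j.
  rewrite (_ : (fun _ => _) = (fun Y : 'M[R]_n =>
     2^-1 * (X i j + \sum_k Y i k * Y k j) - Y i j)); last first.
    by apply/funext => Z; rewrite !mxE.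
  apply: continuousB; last exact: coord_continuous.
  apply: continuousM; first exact: cst_continuous.
  apply: continuousD; first exact: cst_continuous.
  apply: continuous_sum_ord => k Z.
  by apply: continuousM; exact: coord_continuous.
exists Y; split=> //; have := maxY _ (frob_sqrt_step hX hY); rewrite lerN2.
have := frob_sqrt_stepB X X (frob_sqrt_step hX hY) hY; rewrite subrr frob0 mulr0 add0r.
move=> h1 h2; apply/eqP; rewrite -subr_eq0 -frob_eq0.
have := frob_ge0 (sqrt_step X Y - Y); lra.
Qed.

(** [1 - sqrt_defect X] is the square root of [1 - X] near 1. For [frob X <= 2^-1] the fixed point
    exists and contraction makes it unique; outside that range nothing is claimed. *)
Definition sqrt_defect n (X : 'M[R]_n) : 'M[R]_n :=
  xget 0 [set Y | frob Y <= 2^-1 /\ sqrt_step X Y = Y].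

Definition inv_sqrt n (C : 'M[R]_n) := invmx (1%:M - sqrt_defect (1%:M - C)).

Lemma sqrt_defectP n (X : 'M[R]_n) : frob X <= 2^-1 ->
  frob (sqrt_defect X) <= 2^-1 /\ sqrt_step X (sqrt_defect X) = sqrt_defect X.
Proof. by move=> /sqrt_fixpoint_exists h; have := xgetPex 0 h. Qed.

Lemma sqrt_defect_lipschitz n (X X' : 'M[R]_n) :
  frob X <= 2^-1 -> frob X' <= 2^-1 ->
  frob (sqrt_defect X - sqrt_defect X') <= frob (X - X').
Proof.
move=> /sqrt_defectP[h1 e1] /sqrt_defectP[h2 e2].
have := frob_sqrt_stepB X X' h1 h2; rewrite e1 e2; lra.
Qed.

(** The transpose is again a fixed point in the ball, and contraction leaves only one. *)
Lemma sqrt_defectT n (X : 'M[R]_n) : X^T = X -> frob X <= 2^-1 ->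
  (sqrt_defect X)^T = sqrt_defect X.
Proof.
move=> XT /sqrt_defectP[h e]; have h' : frob (sqrt_defect X)^T <= 2^-1.
  by rewrite frobT.
have e' : sqrt_step X (sqrt_defect X)^T = (sqrt_defect X)^T.
  rewrite -[in RHS]e /sqrt_step [RHS]linearZ /= [(_ + _)^T]linearD /=.
  by rewrite trmx_mul XT.
have := frob_sqrt_stepB X X h' h; rewrite e e' subrr frob0 mulr0 add0r => hh.
apply/eqP; rewrite -subr_eq0 -frob_eq0.
have := frob_ge0 ((sqrt_defect X)^T - sqrt_defect X); lra.
Qed.

Section Fixed.
Variables (n : nat) (C : 'M[R]_n).
Hypothesis hC : frob (1%:M - C) <= 2^-1.

Let Y := sqrt_defect (1%:M - C).
Let hY : frob Y <= 2^-1. Proof. by have [] := sqrt_defectP hC. Qed.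
Let eY : sqrt_step (1%:M - C) Y = Y. Proof. by have [] := sqrt_defectP hC. Qed.
Let uY : 1%:M - Y \in unitmx. Proof. by apply: unitmx_1B; apply: le_lt_trans hY _; lra. Qed.

Lemma sqr_1B_defect : (1%:M - Y) *m (1%:M - Y) = C.
Proof.
have : 2 *: Y = 1%:M - C + Y *m Y.
  by rewrite -{1}eY /sqrt_step scalerA divff ?scale1r// pnatr_eq0.
rewrite mulmxBl mul1mx mulmxBr mulmx1; move: (Y *m Y) => Z h.
by apply/matrixP => i j; move/matrixP/(_ i j): h; rewrite !mxE; lra.
Qed.

Lemma inv_sqrtK : inv_sqrt C *m (1%:M - Y) = 1%:M.
Proof. by rewrite mulVmx. Qed.

Lemma inv_sqrtVK : (1%:M - Y) *m inv_sqrt C = 1%:M.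
Proof. by rewrite mulmxV. Qed.

Lemma inv_sqrt_conj : inv_sqrt C *m C *m inv_sqrt C = 1%:M.
Proof.
by rewrite -{2}sqr_1B_defect mulmxA inv_sqrtK mul1mx inv_sqrtVK.
Qed.

Lemma mul_inv_sqrt : C *m inv_sqrt C = 1%:M - Y.
Proof. by rewrite -{1}sqr_1B_defect -mulmxA inv_sqrtVK mulmx1. Qed.

Lemma inv_sqrtT : C^T = C -> (inv_sqrt C)^T = inv_sqrt C.
Proof.
move=> CT; rewrite /inv_sqrt trmx_inv linearB /= trmx1 sqrt_defectT//.
by rewrite linearB /= trmx1 CT.
Qed.

(** For [K = inv_sqrt C], [K (1 - Y) = 1] gives [K - 1 = Y + (K - 1) Y] with [|Y| <= 1/2], so half
    of [|K - 1|] is at most 1/2. *)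
Lemma frob_inv_sqrtB1 : frob (inv_sqrt C - 1%:M) <= 1.
Proof.
have e : inv_sqrt C - 1%:M = Y + (inv_sqrt C - 1%:M) *m Y.
  have := inv_sqrtK; rewrite mulmxBr mulmx1 mulmxBl mul1mx.
  move: (inv_sqrt C *m Y) => Z h; apply/matrixP => i j.
  by move/matrixP/(_ i j): h; rewrite !mxE; lra.
have h1 := frobD Y ((inv_sqrt C - 1%:M) *m Y); rewrite -e in h1.
have := frobM (inv_sqrt C - 1%:M) Y.
have := ler_wpM2l (frob_ge0 (inv_sqrt C - 1%:M)) hY; have := hY; lra.
Qed.

(** With [K = inv_sqrt C] the path is [(1 - (1 - s) Y) K], a product of invertible factors as
    [|Y| <= 1/2]. It keeps the weights of the deformation invertible. *)
Lemma unitmx_inv_sqrt_path s : 0 <= s <= 1 ->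
  (1 - s) *: 1%:M + s *: inv_sqrt C \in unitmx.
Proof.
move=> /andP[s0 s1].
have -> : (1 - s) *: 1%:M + s *: inv_sqrt C =
    (1%:M - (1 - s) *: Y) *m inv_sqrt C.
  have YK : Y *m inv_sqrt C = inv_sqrt C - 1%:M.
    by have := inv_sqrtVK; rewrite mulmxBl mul1mx => <-; rewrite opprB addrC subrK.
  rewrite mulmxBl mul1mx -scalemxAl YK; move: (inv_sqrt C) => K.
  by apply/matrixP => i j; rewrite !mxE; ring.
rewrite unitmx_mul unitmx_inv uY andbT; apply: unitmx_1B.
rewrite frobZ ger0_norm; last lra.
have := ler_piMl (frob_ge0 Y) (_ : 1 - s <= 1); have := hY; lra.
Qed.

(* The hypotheses hold when 1 - C is the Gram matrix of a small frame. *)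
Lemma tr_sqrt_defect : C^T = C -> frob (1%:M - C) <= \tr (1%:M - C) ->
  \tr (1%:M - C) <= 2^-1 -> \tr Y <= \tr (1%:M - C).
Proof.
move=> CT X1 X2; have YT : Y^T = Y.
  by apply: sqrt_defectT => //; rewrite linearB /= trmx1 CT.
have e1 : 2 * \tr Y = \tr (1%:M - C) + frob Y ^+ 2.
  rewrite -{1}eY /sqrt_step linearZ /= linearD /= frob_sqr /mdot YT.
  by rewrite mulrA divff ?mul1r ?pnatr_eq0.
have e2 : 2 * frob Y <= frob (1%:M - C) + frob Y * frob Y.
  rewrite -{1}eY /sqrt_step frobZ ger0_norm ?invr_ge0// mulrA divff ?pnatr_eq0//.
  rewrite mul1r; apply: le_trans (frobD _ _) _; rewrite lerD2l; exact: frobM.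
have := ler_wpM2l (frob_ge0 Y) hY.
have := frob_ge0 Y; have := frob_ge0 (1%:M - C); nra.
Qed.

End Fixed.

(** For [K = (1 - Y)^-1] and [K' = (1 - Y')^-1] one has [K - K' = K (Y - Y') K']; each outer factor
    is within 1 of the identity and costs a factor 2. *)
Lemma inv_sqrt_lipschitz n (C C' : 'M[R]_n) :
  frob (1%:M - C) <= 2^-1 -> frob (1%:M - C') <= 2^-1 ->
  frob (inv_sqrt C - inv_sqrt C') <= 4 * frob (C - C').
Proof.
move=> hC hC'; set Y := sqrt_defect (1%:M - C).
set Y' := sqrt_defect (1%:M - C').
have -> : inv_sqrt C - inv_sqrt C' = inv_sqrt C *m (Y - Y') *m inv_sqrt C'.
  have -> : Y - Y' = (1%:M - Y') - (1%:M - Y) by apply/matrixP => i j; rewrite !mxE; ring.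
  rewrite mulmxBr (inv_sqrtK hC) mulmxBl mul1mx.
  by rewrite -mulmxA (inv_sqrtVK hC') mulmx1.
have eY : frob (Y - Y') <= frob (C - C').
  have := sqrt_defect_lipschitz hC hC'.
  rewrite (_ : 1%:M - C - (1%:M - C') = C' - C) 1?[frob (C' - C)]frobC//.
  by apply/matrixP => i j; rewrite !mxE; ring.
have twoL (D K : 'M[R]_n) : frob (K - 1%:M) <= 1 -> frob (K *m D) <= 2 * frob D.
  move=> hK; have -> : K *m D = D + (K - 1%:M) *m D.
    by rewrite mulmxBl mul1mx addrC subrK.
  have := frobD D ((K - 1%:M) *m D); have := frobM (K - 1%:M) D.
  have := frob_ge0 D; nra.
have twoR (D K : 'M[R]_n) : frob (K - 1%:M) <= 1 -> frob (D *m K) <= 2 * frob D.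
  move=> hK; rewrite -frobT trmx_mul -[frob D]frobT; apply: twoL.
  by rewrite -[1%:M]trmx1 -linearB /= frobT.
have h1 := twoR (inv_sqrt C *m (Y - Y')) _ (frob_inv_sqrtB1 hC').
have h2 := twoL (Y - Y') _ (frob_inv_sqrtB1 hC).
by apply: le_trans h1 _; lra.
Qed.

End InverseSquareRoot.

(** * Orthonormal frames *)

Section FrameAlgebra.
Context {R : realType}.

Lemma frame_grass d n (V : 'M[R]_(n, d)) :
  V^T *m V = 1%:M -> grassmannian_fin d n (V *m V^T).
Proof.
move=> VV; apply: proj_grass; last by rewrite mxtrace_mulC VV mxtrace1.
split; first by rewrite trmx_mul trmxK.
by rewrite mulmxA -(mulmxA V V^T V) VV mulmx1.
Qed.

(** With [G = V^T W] the squared norms are [2 (d - |G|^2)] and [2 (d - tr G)]; the claim amounts to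
    [0 <= |1 - G|^2]. *)
Lemma frob_frame_projB d n (V W : 'M[R]_(n, d)) :
  V^T *m V = 1%:M -> W^T *m W = 1%:M ->
  frob (V *m V^T - W *m W^T) <= Num.sqrt 2 * frob (V - W).
Proof.
move=> VV WW; rewrite -ler_sqr ?nnegrE ?mulr_ge0 ?frob_ge0// exprMn [Num.sqrt 2 ^+ 2]sqr_sqrtr//.
rewrite !frob_sqr (mdot_grass_dist (frame_grass VV) (frame_grass WW)).
have e1 : mdot (V *m V^T) (W *m W^T) = mdot (V^T *m W) (V^T *m W).
  by rewrite mdot_mull mdotC mulmxA mdot_mulr trmxK.
have e2 : mdot (V - W) (V - W) = 2 * (d%:R - \tr (V^T *m W)).
  rewrite mdotBl !mdotBr [mdot W V]mdotC /mdot VV WW mxtrace1; ring.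
have h := mdot_ge0 (1%:M - V^T *m W).
rewrite mdotBl !mdotBr !mdot1l (mdotC (V^T *m W) 1%:M) mdot1l mxtrace1 in h.
rewrite e1 e2; lra.
Qed.

Section OrthonormalizedFrame.
Variables (d n : nat) (P : 'M[R]_n) (V : 'M[R]_(n, d)).
Hypothesis hP : grassmannian_fin d n P.
Hypothesis VV : V^T *m V = 1%:M.
Hypothesis PV : frob (P - V *m V^T) <= 1.

Let C := V^T *m P *m V.
Let pP : is_proj P. Proof. exact: grass_proj hP. Qed.

Let CT : C^T = C.
Proof. by rewrite /C !trmx_mul trmxK -(pP.1) mulmxA. Qed.

Let trC : \tr (1%:M - C) = frob (P - V *m V^T) ^+ 2 / 2.
Proof.
rewrite frob_sqr (mdot_grass_dist hP (frame_grass VV)) linearB /= mxtrace1.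
by rewrite mdotC mdot_mulr trmxK /mdot /C mulmxA; lra.
Qed.

Let frobC_le : frob (1%:M - C) <= \tr (1%:M - C).
Proof.
have -> : 1%:M - C = ((1%:M - P) *m V)^T *m ((1%:M - P) *m V).
  rewrite trmx_mul -(projC pP).1 mulmxA -(mulmxA V^T) -(projC pP).2.
  by rewrite mulmxBr mulmx1 mulmxBl VV.
rewrite -/(mdot _ _) -frob_sqr expr2.
by apply: le_trans (frobM _ _) _; rewrite frobT.
Qed.

Let trC_half : \tr (1%:M - C) <= 2^-1.
Proof.
rewrite trC; have := frob_ge0 (P - V *m V^T); move: PV; nra.
Qed.

(** [1 - C] is the Gram matrix of [(1 - P) V], so its norm is at most its trace, which is
    [|P - V V^T|^2 / 2]. *)
Lemma frob_compression : frob (1%:M - C) <= 2^-1.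
Proof. exact: le_trans frobC_le trC_half. Qed.

(** The isometric factor in the polar decomposition of [P V]. *)
Definition orth_frame := P *m V *m inv_sqrt C.

Let KT := inv_sqrtT frob_compression CT.

Lemma orth_frame_isometry : orth_frame^T *m orth_frame = 1%:M.
Proof.
rewrite /orth_frame !trmx_mul KT -(inv_sqrt_conj frob_compression).
rewrite -(pP.1); move: (inv_sqrt C) => K.
by rewrite /C !mulmxA -(mulmxA (K *m V^T) P P) -(pP.2).
Qed.

(** The isometry [F] satisfies [P F = F], hence [<P, F F^T> = d]; two elements of Gr(d) with that
    inner product have distance 0. *)
Lemma orth_frame_proj : orth_frame *m orth_frame^T = P.
Proof.
have hQ := frame_grass orth_frame_isometry.
apply/esym/eqP; rewrite -subr_eq0 -mdot_eq0 (mdot_grass_dist hP hQ).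
have -> : mdot P (orth_frame *m orth_frame^T) = d%:R.
  rewrite mdotC mdot_mulr trmxK.
  have -> : P *m orth_frame = orth_frame by rewrite /orth_frame !mulmxA -(pP.2).
  by rewrite /mdot orth_frame_isometry mxtrace1.
by rewrite subrr mulr0.
Qed.

(** [|F - V|^2 = 2 tr Y] for the square root defect [Y] of [1 - C], while
    [|P - V V^T|^2 = 2 tr (1 - C)]; [tr_sqrt_defect] compares the two traces. *)
Lemma frob_orth_frameB : frob (orth_frame - V) <= frob (P - V *m V^T).
Proof.
rewrite -ler_sqr ?nnegrE ?frob_ge0// [X in X <= _]frob_sqr.
have e : mdot V orth_frame = d%:R - \tr (sqrt_defect (1%:M - C)).
  rewrite /mdot /orth_frame !mulmxA (mul_inv_sqrt frob_compression).
  by rewrite linearB /= mxtrace1.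
rewrite mdotBl !mdotBr [mdot _ V]mdotC e.
have -> : mdot orth_frame orth_frame = d%:R.
  by rewrite /mdot orth_frame_isometry mxtrace1.
rewrite {1}/mdot VV mxtrace1.
have := tr_sqrt_defect frob_compression CT frobC_le trC_half.
move: trC; lra.
Qed.

End OrthonormalizedFrame.

Lemma orth_frame_dist d n (P : 'M[R]_n) (V W : 'M[R]_(n, d)) :
  grassmannian_fin d n P -> V^T *m V = 1%:M -> W^T *m W = 1%:M ->
  frob (P - V *m V^T) <= 1 -> frob (P - W *m W^T) <= 1 ->
  frob ((orth_frame P V)^T *m orth_frame P W - V^T *m W) <=
  frob (P - V *m V^T) + frob (P - W *m W^T).
Proof.
move=> hP VV WW PV PW.
rewrite (_ : _ - _ = (orth_frame P V - V)^T *m orth_frame P W +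
                     V^T *m (orth_frame P W - W)); last first.
  by rewrite linearB /= mulmxBl mulmxBr addrA subrK.
apply: le_trans (frobD _ _) _; apply: lerD.
  apply: le_trans (frob_mul_isometry _ (orth_frame_isometry hP WW PW)) _.
  by rewrite frobT; exact: frob_orth_frameB.
apply: le_trans (frob_coisometry _ VV) _; exact: frob_orth_frameB.
Qed.

(** [M M^T] and [M^T M] share their nonzero spectrum, and [M^T M] is definite on the image of [P];
    so [M M^T] has exactly [d] positive eigenvalues. [Q] projects onto the image of [M]. *)
Lemma gap_proj_square d m n (P : 'M[R]_n) (M : 'M[R]_(m, n)) :
  grassmannian_fin d n P -> M *m P = M ->
  (forall x : 'cV_n, M *m x = 0 -> P *m x = 0) ->
  exists (Q : 'M[R]_m) a, 0 < a /\
    gap_proj d a 0 (M *m M^T *m (M *m M^T)) Q.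
Proof.
move=> hP MP Minj; have pP := grass_proj hP; have [PT PP] := pP.
(* [N] agrees with [M^T M] on the image of [P] and is the identity on its kernel, so it is
   invertible. *)
pose N := M^T *m M + (1%:M - P).
have NT : N^T = N.
  by rewrite /N linearD /= trmx_mul trmxK -(projC pP).1.
have uN : N \in unitmx.
  apply: unitmx_inj => x Nx.
  have : mdot (M *m x) (M *m x) + mdot ((1%:M - P) *m x) ((1%:M - P) *m x) = 0.
    rewrite (mdot_proj _ _ (projC pP)) mdot_mull -mdotDr mulmxA -mulmxDl.
    by rewrite -/N Nx mdot0r.
  move=> /eqP; rewrite paddr_eq0 ?mdot_ge0// !mdot_eq0 => /andP[/eqP/Minj Px].
  by rewrite mulmxBl mul1mx Px subr0 => /eqP.
have PMT : P *m M^T = M^T by rewrite -[RHS]/(M^T) -{2}MP trmx_mul -PT.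
have NP : invmx N *m (M^T *m M) = P.
  have : N *m (1%:M - P) = 1%:M - P.
    by rewrite /N mulmxDl -(projC pP).2 -mulmxA mulmxBr mulmx1 MP subrr mulmx0 add0r.
  move=> /(congr1 (mulmx (invmx N))); rewrite mulKmx// => e.
  have -> : M^T *m M = N - (1%:M - P) by rewrite addrK.
  by rewrite mulmxBr mulVmx// -e opprB addrC subrK.
have NVT : (invmx N)^T = invmx N by rewrite trmx_inv NT.
have PN : M^T *m M *m invmx N = P.
  by rewrite PT -NP !trmx_mul trmxK NVT.
set S := M *m M^T; pose Q := M *m invmx N *m M^T.
have ST : S^T = S by rewrite trmx_mul trmxK.
have QS : Q *m S = S.
  by rewrite /Q /S -!mulmxA (mulmxA M^T) (mulmxA (invmx N)) NP PMT.
have SQ : S *m Q = S.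
  by rewrite /Q /S -!mulmxA (mulmxA M^T) (mulmxA (M^T *m M)) PN PMT.
have QQ : Q = Q *m Q.
  rewrite {2 3}/Q -!mulmxA (mulmxA M^T M) (mulmxA (invmx N) (M^T *m M)) NP.
  by rewrite (mulmxA M P) MP mulmxA.
have QT : Q = Q^T by rewrite /Q !trmx_mul trmxK NVT mulmxA.
(* [Y] inverts [M M^T] on the image of [Q], so its norm bounds the form of the square from below.
   The constant [(|Y|^2 + 1)^-1] has the [+ 1] to stay positive when [Y = 0]. *)
pose Y := M *m invmx N *m invmx N *m M^T.
have YS : Y *m S = Q.
  rewrite /Y /S -!mulmxA (mulmxA M^T M) (mulmxA (invmx N) (M^T *m M)) NP.
  by rewrite PMT /Q mulmxA.
have Y1 : 0 < frob Y ^+ 2 + 1 by rewrite ltr_wpDl// sqr_ge0.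
exists Q, (frob Y ^+ 2 + 1)^-1; split; first by rewrite invr_gt0.
split; first apply: proj_grass => //.
- rewrite /Q mxtrace_mulC mulmxA mxtrace_mulC NP; exact: grass_tr hP.
- by rewrite -mulmxA SQ mulmxA QS.
split=> x.
  rewrite mulrC ler_pdivrMr// mulrC -mulmxA -{1}ST -mdot_mull.
  have h : frob (Q *m x) <= frob Y * frob (S *m (Q *m x)).
    have QE : Q *m x = Y *m (S *m (Q *m x)) by rewrite (mulmxA Y) YS mulmxA -QQ.
    by rewrite {1}QE; exact: frobM.
  rewrite -!frob_sqr; apply: (@le_trans _ _ ((frob Y * frob (S *m (Q *m x))) ^+ 2)).
    by rewrite ler_sqr ?nnegrE ?mulr_ge0 ?frob_ge0.
  rewrite exprMn; have := sqr_ge0 (frob (S *m (Q *m x))); lra.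
move=> Qx; have Sx : S *m x = 0 by rewrite -SQ -(mulmxA S Q) Qx mulmx0.
by rewrite mul0r -mulmxA Sx mulmx0 mdot0r.
Qed.

(** The off-diagonal block [Z = (1 - P) G P] commutes with [A = G G] and links the image of [P],
    where the form of [A] is at least [a], to the kernel, where it is at most [b]. Hence
    [a |Z|^2 <= b |Z|^2] and [Z = 0], although [G] may be indefinite. *)
Lemma gap_proj_root_comm d n a b (G P : 'M[R]_n) : G^T = G -> b < a ->
  gap_proj d a b (G *m G) P -> G *m P = P *m G.
Proof.
move=> GT ab [hP AP gab]; have pP := grass_proj hP; have [PT PP] := pP.
have [P1T P1P] := projC pP; set P1 := 1%:M - P in P1T P1P.
have AT : (G *m G)^T = G *m G by rewrite trmx_mul GT.
have AG : G *m G *m G = G *m (G *m G) by rewrite mulmxA.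
move: (G *m G) AP gab AT AG => A AP gab AT AG.
have [Z ZE] : exists Z, Z = P1 *m G *m P by exists (P1 *m G *m P).
have PZ : P *m Z = 0 by rewrite ZE !mulmxA mulmxBr mulmx1 -PP subrr !mul0mx.
have ZP : Z *m P = Z by rewrite ZE -mulmxA -PP.
have PZT : P *m Z^T = Z^T by rewrite PT -trmx_mul ZP.
have AZ : A *m Z = Z *m A.
  have AP1 : A *m P1 = P1 *m A by rewrite mulmxBr mulmxBl mul1mx mulmx1 AP.
  by rewrite ZE !mulmxA AP1 -(mulmxA P1 A) AG -!mulmxA AP.
have [_ h1] := form_gap_mx Z gab.
have [h2 _] := form_gap_mx Z^T gab.
move: h2; rewrite PZT mdotT => h2.
have e : mdot Z^T (A *m Z^T) = mdot Z (A *m Z).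
  by rewrite AZ -[in RHS]mdotT trmx_mul AT.
have Z0 : Z = 0.
  apply/eqP; rewrite -mdot_eq0 eq_le mdot_ge0 andbT.
  rewrite -(pmulr_rle0 _ (_ : 0 < a - b)) ?subr_gt0// mulrBl subr_le0.
  by apply: le_trans (h1 PZ); rewrite -e.
have e1 : G *m P = P *m G *m P.
  apply/eqP; rewrite -subr_eq0; apply/eqP; rewrite -Z0 ZE.
  by rewrite /P1 !mulmxBl mul1mx.
have e2 : (G *m P)^T = P *m G by rewrite trmx_mul GT -PT.
by rewrite -e2 [in RHS]e1 !trmx_mul GT -PT mulmxA -e1.
Qed.

(** As [G] and [P] commute, [M M^T = A P] with [A = G G], whose square has the same spectral
    projection; Cauchy-Schwarz gives the lower bound [a ^+ 2]. This identifies the start of the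
    deformation. *)
Lemma gap_proj_root_square d n a b (G P : 'M[R]_n) : G^T = G -> 0 <= b < a ->
  gap_proj d a b (G *m G) P -> let M := G *m P in
  gap_proj d (a ^+ 2) 0 (M *m M^T *m (M *m M^T)) P.
Proof.
move=> GT /andP[b0 ab] hgap M; have GP := gap_proj_root_comm GT ab hgap.
move: hgap => [hP AP [ga _]]; have pP := grass_proj hP; have [PT PP] := pP.
have AT : (G *m G)^T = G *m G by rewrite trmx_mul GT.
have MM : M *m M^T = G *m G *m P.
  by rewrite /M trmx_mul GT -PT mulmxA -(mulmxA G P) -PP -mulmxA -GP mulmxA.
rewrite {}MM; move: (G *m G) AP ga AT => A AP ga AT.
have SE : A *m P *m (A *m P) = A *m A *m P.
  by rewrite -!mulmxA (mulmxA P A) -AP -mulmxA -PP.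
rewrite SE; split=> //.
  rewrite -(mulmxA (A *m A)) -PP !mulmxA -AP -(mulmxA A P A) -AP mulmxA.
  by rewrite -(mulmxA (A *m A)) -PP.
split=> x.
  have := ga x; set u := P *m x => hu.
  have Pu : P *m u = u by rewrite /u mulmxA -PP.
  rewrite -mulmxA Pu -mulmxA -{1}AT -mdot_mull -!frob_sqr -exprMn.
  rewrite ler_sqr ?nnegrE ?mulr_ge0 ?frob_ge0//; last by rewrite (le_trans b0)// ltW.
  have := mdot_CS u (A *m u); have := frob_ge0 u.
  have := frob_ge0 (A *m u).
  move: hu; rewrite -frob_sqr.
  move: (frob u) (frob (A *m u)) (mdot _ _) => r t c h1 t0 r0 h2.
  have [->|rn] := eqVneq r 0; first by rewrite mulr0.
  have rp : 0 < r by rewrite lt_def rn.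
  by rewrite -(ler_pM2l rp); nra.
by move=> Px; rewrite -mulmxA Px mulmx0 mdot0r mul0r.
Qed.

End FrameAlgebra.

(** * Matrices stacked from blocks of rows *)

Section Stack.
Context {R : realType}.
Variables N d : nat.
Local Notation n := #|{: 'I_N * 'I_d}|.

(** Rows are numbered by pairs of a block and a row in it, so that sums over rows split into double
    sums. *)
Definition stack q (F : 'I_N -> 'M[R]_(d, q)) : 'M[R]_(n, q) :=
  \matrix_(t, c) F (enum_val t).1 (enum_val t).2 c.

Lemma sum_enum_pair (V : nmodType) (F : 'I_N * 'I_d -> V) :
  \sum_(t < n) F (enum_val t) = \sum_k \sum_b F (k, b).
Proof.
rewrite pair_bigA /= [RHS](reindex (@enum_val _ {: 'I_N * 'I_d})) /=.
  by apply: eq_bigr => t _; case: (enum_val t).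
by apply: onW_bij; exact: enum_val_bij.
Qed.

Lemma stack_mul q1 q2 (F : 'I_N -> 'M[R]_(d, q1)) (G : 'I_N -> 'M[R]_(d, q2)) :
  (stack F)^T *m stack G = \sum_k (F k)^T *m G k.
Proof.
apply/matrixP => i j; rewrite mxE summxE.
under eq_bigr do rewrite !mxE.
rewrite (sum_enum_pair (fun x => F x.1 x.2 i * G x.1 x.2 j)).
by apply: eq_bigr => k _; rewrite mxE; apply: eq_bigr => b _; rewrite mxE.
Qed.

Lemma mdot_stack q (F G : 'I_N -> 'M[R]_(d, q)) :
  mdot (stack F) (stack G) = \sum_k mdot (F k) (G k).
Proof. by rewrite /mdot stack_mul raddf_sum. Qed.

Lemma stackM q1 q2 (F : 'I_N -> 'M[R]_(d, q1)) (A : 'M[R]_(q1, q2)) :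
  stack F *m A = stack (fun k => F k *m A).
Proof.
by apply/matrixP => i j; rewrite !mxE; apply: eq_bigr => b _; rewrite mxE.
Qed.

Lemma stackB q (F G : 'I_N -> 'M[R]_(d, q)) :
  stack F - stack G = stack (fun k => F k - G k).
Proof. by apply/matrixP => i j; rewrite !mxE. Qed.

Lemma eq_stack q (F G : 'I_N -> 'M[R]_(d, q)) : F =1 G -> stack F = stack G.
Proof. by move=> FG; apply/matrixP => i j; rewrite !mxE FG. Qed.

Lemma stack_eq0 q (F : 'I_N -> 'M[R]_(d, q)) : stack F = 0 -> forall k, F k = 0.
Proof.
move=> F0 k; apply/matrixP => b c; rewrite [RHS]mxE.
by have /matrixP /(_ (enum_rank (k, b)) c) := F0; rewrite !mxE enum_rankK.
Qed.

(** It moves the blocks to the rows prescribed by [iota]; [r.+1] because those rows are numbered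
    from 1 and ordinals from 0. *)
Definition embed_mx (iota : 'I_N -> nat) m : 'M[R]_(m, n) :=
  \matrix_(r < m, t < n) (r.+1 == d * iota (enum_val t).1 + (enum_val t).2)%N%:R.

(** Division by [d] recovers block and row from the row number, so distinct rows stay distinct;
    [1 <= iota k] makes every row number positive, and [m] leaves room for it. *)
Lemma embed_mx_isometry (iota : 'I_N -> nat) m : injective iota ->
  (forall k, (1 <= iota k)%N) -> (forall k, (d * iota k + d <= m)%N) ->
  (embed_mx iota m)^T *m embed_mx iota m = 1%:M.
Proof.
move=> iota_inj iota1 iota_m; apply/matrixP => t u; rewrite !mxE.
set f := fun x : 'I_N * 'I_d => (d * iota x.1 + x.2)%N.
have f_inj : injective f.
  move=> [k b] [l c] e; have d0 : (0 < d)%N by exact: leq_ltn_trans (ltn_ord b).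
  have := congr1 (modn^~ d) e; have := congr1 (divn^~ d) e; rewrite /f /=.
  rewrite ![(d * _)%N]mulnC !divnMDl// !modnMDl !modn_small// !divn_small// !addn0.
  by move=> /iota_inj -> /val_inj ->.
have [r rE] : exists r : 'I_m, r.+1 = f (enum_val t).
  case: (enum_val t) => k b; rewrite /f /=.
  have d0 : (0 < d)%N by exact: leq_ltn_trans (ltn_ord b).
  have f0 : (0 < d * iota k + b)%N by rewrite addn_gt0 muln_gt0 d0 iota1.
  have fm : ((d * iota k + b).-1 < m)%N.
    by rewrite prednK// (leq_trans _ (iota_m k))// leq_add2l ltnW.
  by exists (Ordinal fm); rewrite /= prednK.
rewrite (bigD1 r)//= big1 => [|r' r'r].
  rewrite !mxE rE eqxx mul1r addr0 (inj_eq f_inj) (inj_eq enum_val_inj)//.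
rewrite !mxE -/(f _) -rE eqSS (_ : (r' == r :> nat) = false) ?mul0r//.
by apply: contraNF r'r => /eqP /val_inj ->.
Qed.

End Stack.

(** * Frames, their projections and the average at one point *)

Section PointwiseFrames.
Context {R : realType}.
Variables (J : Type) (N d : nat) (s : 'I_N -> J) (p : 'I_N -> R).
Hypothesis p_gt0 : forall k, 0 < p k.
Hypothesis p_sum1 : \sum_k p k = 1.
Local Notation n := #|{: 'I_N * 'I_d}|.
Implicit Types W : J -> J -> 'M[R]_d.

(** This is [Phi_i(y)] without its zero rows; [s] lists the indices of positive weight. *)
Definition frame W i : 'M[R]_(n, d) :=
  stack (fun k => Num.sqrt (p k) *: (W i (s k))^T).

Definition frame_avg W : 'M[R]_n :=
  \sum_k p k *: (frame W (s k) *m (frame W (s k))^T).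

Let sqrtp k : Num.sqrt (p k) * Num.sqrt (p k) = p k.
Proof. by rewrite -expr2 sqr_sqrtr// ltW. Qed.

Let sum_constE m q (A : 'M[R]_(m, q)) : A = \sum_k p k *: A.
Proof. by rewrite -scaler_suml p_sum1 scale1r. Qed.

Lemma frame_gram W i j :
  (frame W i)^T *m frame W j = \sum_k p k *: (W i (s k) *m (W j (s k))^T).
Proof.
rewrite stack_mul; apply: eq_bigr => k _.
by rewrite [(_ *: _)^T]linearZ /= trmxK -scalemxAl -scalemxAr scalerA sqrtp.
Qed.

Lemma frame_avgT W : (frame_avg W)^T = frame_avg W.
Proof.
rewrite /frame_avg linear_sum /=; apply: eq_bigr => k _.
by rewrite linearZ /= trmx_mul trmxK.
Qed.

Lemma convex_sumr_lt (F : 'I_N -> R) e : (forall k, F k < e) ->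
  \sum_k p k * F k < e.
Proof.
move=> Fe; rewrite -subr_gt0 -[e in X in _ < X]mul1r -p_sum1 mulr_suml -sumrB.
rewrite lt_def sumr_ge0 ?andbT => [|k _]; last first.
  by rewrite -mulrBr mulr_ge0 ?ltW// subr_gt0.
rewrite psumr_neq0 => [|k _]; last by rewrite -mulrBr mulr_ge0 ?ltW// subr_gt0.
(* Strictness needs one index; an empty set of indices would make the weights sum to 0 instead of
   1. *)
apply/hasP; have [k _|N0] := pickP (fun _ : 'I_N => true).
  by exists k; rewrite ?mem_index_enum//= -mulrBr mulr_gt0// subr_gt0.
by move: p_sum1; rewrite big_pred0 => [/esym/eqP|k]; [rewrite oner_eq0|have := N0 k].
Qed.

Lemma frob_convex_lt m q (F : 'I_N -> 'M[R]_(m, q)) A e :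
  (forall k, frob (F k - A) < e) -> frob (\sum_k p k *: F k - A) < e.
Proof.
move=> Fe; rewrite [A in X in frob X]sum_constE -sumrB.
apply: le_lt_trans (frob_sum _ _ _) _; apply: le_lt_trans (convex_sumr_lt Fe).
by apply: ler_sum => k _; rewrite -scalerBr frobZ ger0_norm// ltW.
Qed.

Section Cocycle.
Variables (V : J -> Prop) (W : J -> J -> 'M[R]_d).
Hypothesis Vs : forall k, V (s k).
Hypothesis W_orth : forall i j, V i -> V j -> (W i j)^T *m W i j = 1%:M.
Hypothesis W_sym : forall i j, V i -> V j -> W i j = (W j i)^T.

Lemma frame_isometry i : V i -> (frame W i)^T *m frame W i = 1%:M.
Proof.
move=> Vi; rewrite frame_gram [RHS]sum_constE.
apply: eq_bigr => k _; rewrite {1}(W_sym Vi (Vs k)) (W_sym Vi (Vs k)) trmxK.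
by rewrite (W_orth (Vs k) Vi).
Qed.

(** All summands agree: frame [s k] is frame [j] times the orthogonal matrix [W j (s k)], which
    cancels in the projection. *)
Lemma frame_avg_exact j : (forall i j k, V i -> V j -> V k ->
  W i j *m W j k = W i k) -> V j -> frame_avg W = frame W j *m (frame W j)^T.
Proof.
move=> W_mul Vj; rewrite /frame_avg [RHS]sum_constE.
apply: eq_bigr => k _; congr (_ *: _).
have -> : frame W (s k) = frame W j *m W j (s k).
  rewrite /frame stackM; apply: eq_stack => l; rewrite -scalemxAl; congr (_ *: _).
  by rewrite -!W_sym// W_mul.
rewrite trmx_mul mulmxA -(mulmxA _ (W j (s k))) -W_sym// W_mul//.
have -> : W j j = 1%:M by have := W_orth Vj Vj; rewrite -W_sym// W_mul//.
by rewrite mulmx1.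
Qed.

Section Approximate.
Variable e : R.
Hypothesis W_mul : forall i j k, V i -> V j -> V k ->
  frob (W i j *m W j k - W i k) < e.

(** The Gram matrix is a convex combination of the products [W i (s k) *m W (s k) j], each within
    [e] of [W i j]. *)
Lemma frame_gram_approx i j : V i -> V j ->
  frob ((frame W i)^T *m frame W j - W i j) < e.
Proof.
move=> Vi Vj; rewrite frame_gram; apply: frob_convex_lt => k.
by rewrite -W_sym// W_mul.
Qed.

(** Turning frame [j] by the orthogonal matrix [W j i] keeps its projection and brings it within [e]
    of frame [i], blockwise in mean square; [frob_frame_projB] contributes the factor [sqrt 2]. *)
Lemma frame_proj_approx i j : V i -> V j ->
  frob (frame W i *m (frame W i)^T - frame W j *m (frame W j)^T) <
  Num.sqrt 2 * e.
Proof.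
move=> Vi Vj; have e0 : 0 < e := le_lt_trans (frob_ge0 _) (W_mul Vi Vi Vi).
pose F := frame W j *m W j i.
have -> : frame W j *m (frame W j)^T = F *m F^T.
  rewrite /F trmx_mul mulmxA -(mulmxA (frame W j)) -(W_sym Vi Vj).
  by rewrite {1}(W_sym Vj Vi) W_orth// mulmx1.
have FF : F^T *m F = 1%:M.
  by rewrite /F trmx_mul mulmxA -(mulmxA _ _ (frame W j)) frame_isometry// mulmx1 W_orth.
apply: le_lt_trans (frob_frame_projB (frame_isometry Vi) FF) _.
rewrite ltr_pM2l ?sqrtr_gt0// -ltr_sqr ?nnegrE ?frob_ge0 ?(ltW e0)//.
rewrite frob_sqr /F /frame stackM stackB mdot_stack.
apply: le_lt_trans (convex_sumr_lt (F := fun k =>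
  frob (W (s k) j *m W j i - W (s k) i) ^+ 2) _) => [|k].
  apply: ler_sum => k _; rewrite -scalemxAl -scalerBr mdotZl mdotZr mulrA sqrtp.
  by rewrite -frob_sqr -!W_sym// frobC.
by rewrite ltr_sqr ?nnegrE ?frob_ge0 ?(ltW e0)// W_mul.
Qed.

Lemma frame_avg_approx j : V j ->
  frob (frame_avg W - frame W j *m (frame W j)^T) < Num.sqrt 2 * e.
Proof. by move=> Vj; apply: frob_convex_lt => k; exact: frame_proj_approx. Qed.

End Approximate.

Section Compressed.
Variables (P : 'M[R]_n) (a b : R).
Hypothesis ab : 0 <= b < a.
Hypothesis hP : gap_proj d a b (frame_avg W) P.

Definition compressed (K : J -> 'M[R]_d) i j : 'M[R]_d :=
  K i *m ((frame W i)^T *m P *m frame W j) *m K j.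

Let pP : is_proj P. Proof. by have [/grass_proj] := hP. Qed.

Let M (K : J -> 'M[R]_d) : 'M[R]_n :=
  stack (fun k => Num.sqrt (p k) *: (K (s k) *m (frame W (s k))^T *m P)).

Let MP K : M K *m P = M K.
Proof.
rewrite /M stackM; apply: eq_stack => k.
by rewrite -scalemxAl -mulmxA -(pP.2).
Qed.

(** Frame [s l] of the compressed family is [M] times [X_l = P F_l K_l], with [F_l = frame W (s l)],
    and [M^T M] is the weighted sum of the [X_l X_l^T]; so the average is [M (M^T M) M^T]. *)
Let avg_compressed K : (forall k, (K (s k))^T = K (s k)) ->
  frame_avg (compressed K) = M K *m (M K)^T *m (M K *m (M K)^T).
Proof.
move=> KT; have fE l : frame (compressed K) (s l) =
    M K *m (P *m frame W (s l) *m K (s l)).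
  rewrite /frame /M stackM; apply: eq_stack => k; rewrite -scalemxAl; congr (_ *: _).
  by rewrite /compressed !trmx_mul !KT trmxK -(pP.1) !mulmxA -(mulmxA _ P P) -(pP.2).
have MM : (M K)^T *m M K = \sum_k p k *: (P *m frame W (s k) *m K (s k) *m
    (P *m frame W (s k) *m K (s k))^T).
  rewrite stack_mul; apply: eq_bigr => k _.
  rewrite [(_ *: _)^T]linearZ /= -scalemxAl -scalemxAr scalerA sqrtp; congr (_ *: _).
  by rewrite !trmx_mul trmxK KT -(pP.1) !mulmxA.
rewrite mulmxA -(mulmxA (M K)) MM -mulmxA mulmx_suml mulmx_sumr.
apply: eq_bigr => k _; rewrite -scalemxAl -scalemxAr; congr (_ *: _).
by rewrite !fE trmx_mul !mulmxA.
Qed.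

Lemma compressed_gap_proj K : (forall k, (K (s k))^T = K (s k)) ->
  (forall k, K (s k) \in unitmx) ->
  exists Q c, 0 < c /\ gap_proj d c 0 (frame_avg (compressed K)) Q.
Proof.
move=> KT Ku; rewrite avg_compressed//; have [gP AP [ga _]] := hP.
(* Injectivity of [M K] on the image of [P]: if every [(frame W (s k))^T P x] vanishes, the average
   kills [P x], which its lower bound [a > 0] allows only for [P x = 0]. *)
apply: (gap_proj_square gP (MP K)) => x; rewrite /M stackM => /stack_eq0 Mx.
have Fx k : (frame W (s k))^T *m (P *m x) = 0.
  have := Mx k; rewrite -scalemxAl => /eqP; rewrite scaler_eq0.
  rewrite gt_eqF ?sqrtr_gt0//= => /eqP /(congr1 (mulmx (invmx (K (s k))))).
  by rewrite mulmx0 -!mulmxA mulKmx.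
have APx : frame_avg W *m (P *m x) = 0.
  rewrite mulmx_suml big1// => k _.
  by rewrite -scalemxAl -mulmxA Fx mulmx0 scaler0.
have := ga x; rewrite APx mdot0r => h; apply/eqP; rewrite -mdot_eq0.
case/andP: ab => b0 ba; have a0 : 0 < a := le_lt_trans b0 ba.
by rewrite eq_le mdot_ge0 andbT -(pmulr_rle0 _ a0).
Qed.

(** [G] has blocks [sqrt (p_k p_l) W_kl]; it is symmetric and its square is the average. For trivial
    weights [M = G P], so compression changes the average but not its projection. *)
Lemma compressed1_gap_proj :
  gap_proj d (a ^+ 2) 0 (frame_avg (compressed (fun=> 1%:M))) P.
Proof.
pose G : 'M[R]_n := stack (fun k => Num.sqrt (p k) *: (frame W (s k))^T).
have GT : G^T = G.
  apply/matrixP => t u; rewrite !mxE (W_sym (Vs _) (Vs _)) !mxE.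
  by rewrite mulrCA.
have GG : G *m G = frame_avg W.
  rewrite -{1}GT /G stack_mul; apply: eq_bigr => k _.
  by rewrite [(_ *: _)^T]linearZ /= trmxK -scalemxAl -scalemxAr scalerA sqrtp.
have MG : M (fun=> 1%:M) = G *m P.
  by rewrite /G stackM; apply: eq_stack => k; rewrite mul1mx -scalemxAl.
rewrite avg_compressed => [|i]; last by rewrite trmx1.
by rewrite MG; apply: (gap_proj_root_square GT ab); rewrite GG.
Qed.

End Compressed.

End Cocycle.

End PointwiseFrames.

(** * The classifying map *)

Section LocalContinuity.
Context {R : realType} {X : topologicalType}.

Lemma near_continuous_at (Y : topologicalType) (f g : X -> Y) x :
  (\forall y \near x, f y = g y) -> {for x, continuous g} -> {for x, continuous f}.
Proof.
move=> fg cg; rewrite /prop_for /continuous_at (nbhs_singleton fg).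
by apply: cvg_trans cg; apply: near_eq_cvg; near=> y; symmetry; near: y.
Unshelve. all: by end_near. Qed.

Lemma continuous_at_sum (J : Type) (r : seq J) (Q : pred J) (f : J -> X -> R) x :
  (forall j, {for x, continuous (f j)}) ->
  {for x, continuous (fun y => \sum_(j <- r | Q j) f j y)}.
Proof.
by move=> cf; apply: cvg_big => [|j _]; [exact: add_continuous|exact: cf].
Qed.

Lemma continuous_at_pair (Y Z : topologicalType) (f : X -> Y) (g : X -> Z) x :
  {for x, continuous f} -> {for x, continuous g} ->
  {for x, continuous (fun y => (f y, g y))}.
Proof. by move=> cf cg; exact: cvg_pair. Qed.

Lemma continuous_atM (f g : X -> R) x : {for x, continuous f} ->
  {for x, continuous g} -> {for x, continuous (fun y => f y * g y)}.
Proof. by move=> cf cg; exact: cvgM. Qed.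

Lemma continuous_atD (f g : X -> R) x : {for x, continuous f} ->
  {for x, continuous g} -> {for x, continuous (fun y => f y + g y)}.
Proof. by move=> cf cg; exact: cvgD. Qed.

Lemma continuous_atB (f g : X -> R) x : {for x, continuous f} ->
  {for x, continuous g} -> {for x, continuous (fun y => f y - g y)}.
Proof. by move=> cf cg; exact: cvgB. Qed.

Lemma near_out_closure (A : set X) x : ~ closure A x -> \forall y \near x, ~ A y.
Proof.
move=> nA; have : nbhs x (~` closure A).
  by apply: open_nbhs_nbhs; split=> //; exact/closed_openC/closed_closure.
by apply: filterS => y + Ay; apply; exact: subset_closure.
Qed.

End LocalContinuity.

Lemma fsbig_setT_seq (V : nmodType) (K : choiceType) (F : K -> V) (q : seq K) :
  uniq q -> (forall j, j \notin q -> F j = 0) ->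
  \sum_(j \in [set: K]) F j = \sum_(j <- q) F j.
Proof.
move=> uq F0; rewrite [RHS]fsbig_seq//; apply/esym; apply: fsbig_widen => // j.
by move=> [_ /negP jq]; exact: F0.
Qed.

Lemma continuous_at_fst (X Y : topologicalType) (z : X * Y) :
  {for z, continuous (@fst X Y)}.
Proof. by move=> V Vz; exact: (@cvg_fst _ _ (nbhs z.1) (nbhs z.2) _ V Vz). Qed.

Lemma continuous_at_snd (X Y : topologicalType) (z : X * Y) :
  {for z, continuous (@snd X Y)}.
Proof. by move=> V Vz; exact: (@cvg_snd _ _ (nbhs z.1) (nbhs z.2) _ V Vz). Qed.

Section ClassifyingMap.
Context {R : realType} {B : topologicalType} {I : choiceType} {U : I -> set B}.
Variables (d : nat) (phi : partition_of_unity R U) (iota : I -> nat).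
Hypothesis iota_inj : injective iota.
Hypothesis iota_gt0 : forall i, (1 <= iota i)%N.
Implicit Types (Omega : cochain (R := R) (B := B) (I := I) d).

Definition pou_supp y : seq I := fset_set [set j | phi j y != 0].

Lemma mem_pou_supp y j : (j \in pou_supp y) = (phi j y != 0).
Proof.
rewrite /pou_supp in_fset_set; last exact: pou_finite.
by apply/idP/idP; rewrite inE.
Qed.

Lemma pou_supp_uniq y : uniq (pou_supp y).
Proof. exact: fset_uniq. Qed.

Lemma pou_neq0 j y : phi j y != 0 -> U j y.
Proof. by move=> h; apply: (pou_subordinate (p := phi)); exact: subset_closure. Qed.

Definition pou_index y : 'I_(size (pou_supp y)) -> I := tnth (in_tuple (pou_supp y)).

Definition pou_weight y (k : 'I_(size (pou_supp y))) := phi (pou_index k) y.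

Lemma pou_indexP y (k : 'I_(size (pou_supp y))) : phi (pou_index k) y != 0.
Proof. by rewrite -mem_pou_supp mem_tnth. Qed.

Lemma pou_index_inj y : injective (@pou_index y).
Proof. by apply/tuple_uniqP; exact: pou_supp_uniq. Qed.

Lemma pou_weight_gt0 y k : 0 < @pou_weight y k.
Proof. by rewrite lt_def pou_indexP pou_ge0. Qed.

Lemma fsbig_pou (F : I -> R) y (r : seq I) : uniq r ->
  (forall j, phi j y != 0 -> j \in r) -> (forall j, phi j y = 0 -> F j = 0) ->
  \sum_(j \in [set: I]) F j = \sum_(j <- r) F j.
Proof.
move=> ur hr F0; apply: fsbig_setT_seq => // j jr.
by apply: F0; apply: contraNeq jr => /hr.
Qed.

Lemma pou_weight_sum1 y : \sum_k @pou_weight y k = 1.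
Proof.
rewrite -(pou_sum1 phi y) (@fsbig_pou _ y (pou_supp y)) ?pou_supp_uniq//.
  by rewrite [RHS](big_tnth _ _ (pou_supp y)).
by move=> j; rewrite mem_pou_supp.
Qed.

Definition frame_block Omega i y (r : nat) c j : R :=
  \sum_(k < d | r.+1 == (d * iota j + k)%N)
    Num.sqrt (phi j y) * (Omega i j y)^T k c.

Lemma frame_block0 Omega i y r c j : phi j y = 0 -> frame_block Omega i y r c j = 0.
Proof. by move=> p0; apply: big1 => k _; rewrite p0 sqrtr0 mul0r. Qed.

Lemma local_frame_seq Omega i y r c (q : seq I) : uniq q ->
  (forall j, phi j y != 0 -> j \in q) ->
  local_frame phi iota Omega i y r c = \sum_(j <- q) frame_block Omega i y r c j.
Proof.
move=> uq hq; rewrite -(fsbig_pou uq hq) => [|j]; last exact: frame_block0.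
apply: fsbig_widen => // j [_ /= nU]; apply: frame_block0.
by apply: contra_notP nU => /eqP; exact: pou_neq0.
Qed.

Definition iota_bound (q : seq I) m := forall j, j \in q -> (d * iota j + d <= m)%N.

Lemma iota_bound_exists q : exists m, iota_bound q m.
Proof.
exists (\sum_(j <- q) (d * iota j + d))%N => j jq.
by rewrite (big_rem j)//= leq_addr.
Qed.

Lemma local_frame_out Omega i y r c m (q : seq I) : uniq q ->
  (forall j, phi j y != 0 -> j \in q) -> iota_bound q m -> (m <= r)%N ->
  local_frame phi iota Omega i y r c = 0.
Proof.
move=> uq hq qm mr; rewrite (local_frame_seq _ _ _ _ uq hq) big1_seq// => j /= jq.
rewrite /frame_block big_pred0// => k; apply/negbTE; rewrite neq_ltn ltnS orbC.
rewrite (leq_trans _ mr)// (leq_trans _ (qm _ jq))// leq_add2l ltnW//.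
Qed.

Lemma cl_map_supported Omega y m (q : seq I) : uniq q ->
  (forall j, phi j y != 0 -> j \in q) -> iota_bound q m ->
  supported m (cl_map phi iota Omega y).
Proof.
move=> uq hq qm r s rs; rewrite /= /cl_fun fsbig1// => i _.
rewrite big1 ?mulr0// => c _.
by case/orP: rs => h; rewrite (local_frame_out _ _ _ uq hq qm h) ?mul0r ?mulr0.
Qed.

Local Notation emb y m := (@embed_mx R _ d (fun k => iota (@pou_index y k)) m).
Local Notation fr Omega y :=
  (frame (@pou_index y) (@pou_weight y) (fun i j => Omega i j y)).
Local Notation avg Omega y :=
  (frame_avg (@pou_index y) (@pou_weight y) (fun i j => Omega i j y)).

Lemma emb_isometry y m : iota_bound (pou_supp y) m ->
  (emb y m)^T *m emb y m = 1%:M.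
Proof.
move=> hm; apply: embed_mx_isometry => [k l /iota_inj /pou_index_inj //|//|k].
by apply: hm; exact: mem_tnth.
Qed.

Lemma local_frame_frame Omega i y m (r : 'I_m) c :
  local_frame phi iota Omega i y r c = (emb y m *m fr Omega y i) r c.
Proof.
rewrite (@local_frame_seq _ _ _ _ _ (pou_supp y)) ?pou_supp_uniq//; last first.
  by move=> j; rewrite mem_pou_supp.
rewrite big_tnth mxE; under [RHS]eq_bigr do rewrite !mxE.
rewrite (sum_enum_pair (fun x => (r.+1 == d * iota (pou_index x.1) + x.2)%N%:R *
  (Num.sqrt (pou_weight x.1) * Omega i (pou_index x.1) y c x.2))).
apply: eq_bigr => k _; rewrite /frame_block big_mkcond; apply: eq_bigr => b _ /=.
by rewrite mxE /pou_weight /pou_index; case: eqP => _; rewrite ?mul1r ?mul0r.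
Qed.

(** The bridge from the entrywise definition to the frames at [y]: up to an isometry, only the
    finitely many indices of positive weight matter. *)
Lemma cl_map_avg Omega y m : iota_bound (pou_supp y) m ->
  cl_map phi iota Omega y = pad (emb y m *m avg Omega y *m (emb y m)^T).
Proof.
move=> hm; have sy j : phi j y != 0 -> j \in pou_supp y by rewrite mem_pou_supp.
rewrite -(pad_trunc (cl_map_supported _ (pou_supp_uniq y) sy hm)); congr pad.
apply/matrixP => r s; rewrite mxE /= /cl_fun.
rewrite (fsbig_pou (pou_supp_uniq y) sy) => [|j ->]; last by rewrite mul0r.
rewrite big_tnth /frame_avg mulmx_sumr mulmx_suml summxE; apply: eq_bigr => k _.
rewrite -scalemxAr -scalemxAl mxE -/(pou_index k) -/(pou_weight k); congr (_ * _).
rewrite mulmxA -(mulmxA _ _ (emb y m)^T) -trmx_mul mxE; apply: eq_bigr => c _.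
by rewrite [X in _ = _ * X]mxE !local_frame_frame.
Qed.

(** Stated without orthogonality, so that it also applies to the families along the deformation. *)
Definition pointwise_continuous Omega := forall i j (y : B), U j y -> U i y ->
  forall a b, {for y, continuous (fun z : B => Omega i j z a b)}.

Lemma pou_near (y : B) : exists q : seq I, uniq q /\
  \forall z \near y, forall j, phi j z != 0 -> j \in q.
Proof.
have [N Ny fN] := pou_locally_finite phi y.
exists (fset_set [set j | setT j /\ closure [set x | phi j x != 0] `&` N !=set0]).
split; first exact: fset_uniq.
apply: filterS Ny => z Nz j jz; rewrite in_fset_set// inE; split=> //.
by exists z; split=> //; exact: subset_closure.
Qed.

Lemma near_pou0 j (y : B) : ~ U j y -> \forall z \near y, phi j z = 0.
Proof.
move=> nU; have : ~ closure [set x | phi j x != 0] y.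
  by move/(pou_subordinate (p := phi)).
by move/near_out_closure; apply: filterS => z /negP; rewrite negbK => /eqP.
Qed.

Lemma continuous_at_frame_block Omega i (y : B) r c j : pointwise_continuous Omega ->
  U i y -> {for y, continuous (fun z : B => frame_block Omega i z r c j)}.
Proof.
move=> cO Ui; have [Uj|nUj] := pselect (U j y).
  apply: continuous_at_sum => k; apply: continuous_atM.
    apply: (@continuous_comp _ _ _ (phi j) Num.sqrt).
      exact: pou_continuous.
    exact: sqrt_continuous.
  rewrite (_ : (fun _ => _) = (fun y => Omega i j y c k)); first exact: cO.
  by apply/funext => z; rewrite mxE.
apply: (@near_continuous_at _ _ _ (fun=> 0)); last exact: cst_continuous.
by apply: filterS (near_pou0 nUj) => z; exact: frame_block0.
Qed.

Lemma continuous_at_local_frame Omega i (y : B) r c : pointwise_continuous Omega ->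
  U i y -> {for y, continuous (fun z : B => local_frame phi iota Omega i z r c)}.
Proof.
move=> cO Ui; have [q [uq hq]] := pou_near y.
apply: (@near_continuous_at _ _ _
   (fun y => \sum_(j <- q) frame_block Omega i y r c j)).
  by apply: filterS hq => z hz; exact: local_frame_seq.
by apply: continuous_at_sum => j; exact: continuous_at_frame_block.
Qed.

(** Local finiteness provides one finite list [q] of indices near [y]; it gives both finite sums and
    the common support bound that [continuous_at_infmx] asks for. *)
Lemma continuous_cl_map Omega : pointwise_continuous Omega ->
  continuous (cl_map phi iota Omega).
Proof.
move=> cO y; have [q [uq hq]] := pou_near y.
have [m qm] := iota_bound_exists q.
apply: (@continuous_at_infmx _ _ _ _ m).
  by apply: filterS hq => z hz; exact: cl_map_supported qm.
move=> r s; apply: (@near_continuous_at _ _ _ (fun y => \sum_(i <- q) (phi i y *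
  \sum_(c < d) local_frame phi iota Omega i y r c * local_frame phi iota Omega i y s c))).
  apply: filterS hq => z hz; rewrite /= /cl_fun (fsbig_pou uq hz)// => j ->.
  by rewrite mul0r.
apply: continuous_at_sum => i; have [Ui|nUi] := pselect (U i y).
  apply: continuous_atM; first exact: pou_continuous.
  by apply: continuous_at_sum => c; apply: continuous_atM;
    exact: continuous_at_local_frame.
(* Off [U i] nothing is known about [Omega i], but there [phi i] vanishes near [y]. *)
apply: (@near_continuous_at _ _ _ (fun=> 0)); last exact: cst_continuous.
by apply: filterS (near_pou0 nUi) => z ->; rewrite mul0r.
Qed.

End ClassifyingMap.

(** * Partitions of unity *)

Section Paracompactness.
Context {T : topologicalType}.

Lemma closure_locally_finite (K : choiceType) (F : K -> set T) (A : set K) x :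
  locally_finite F A -> closure (\bigcup_(k in A) F k) x ->
  exists2 k, A k & closure (F k) x.
Proof.
move=> lf clx; apply: contrapT => h.
have [N Nx fN] := lf x; set D := [set k | _] in fN.
have nF : nbhs x (\bigcap_(k in [set` fset_set D]) ~` closure (F k)).
  apply: filter_bigI => k; rewrite in_fset_set// inE => -[Ak _].
  apply: open_nbhs_nbhs; split; first exact/closed_openC/closed_closure.
  by move=> clk; apply: h; exists k.
have [y [[k Ak Fky] [Ny]]] := clx _ (filterI Nx nF).
move=> /(_ k); apply; last exact: subset_closure.
by rewrite /= in_fset_set// inE; split=> //; exists y.
Qed.

Hypothesis pT : paracompact T.

(** The separating sets and the complement of [A] form a cover. In a locally finite refinement the
    members meeting [A] lie in separating sets, and closure commutes with their union. A point as
    [K] yields regularity, a closed set normality. *)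
Lemma paracompact_separate (A K : set T) : closed A ->
  (forall a, A a -> exists V, [/\ open V, V a & closure V `&` K = set0]) ->
  exists V, [/\ open V, A `<=` V & closure V `&` K = set0].
Proof.
move=> cA hA.
pose C := [set V | (open V /\ closure V `&` K = set0) \/ V = ~` A].
have [|D [[oD cD] DC lD]] := pT.2 C.
  split=> [V [[]//|->]|]; first exact: closed_openC.
  apply/seteqP; split=> // x _; have [Ax|nAx] := pselect (A x).
    by have [V [oV Vx VK]] := hA x Ax; exists V => //; left.
  by exists (~` A) => //; right.
pose G := [set W | D W /\ W `&` A !=set0].
exists (\bigcup_(W in G) W); split.
- by apply: bigcup_open => W [DW _]; exact: oD.
- move=> a Aa; have : setT a by [].
  by rewrite -cD => -[W DW Wa]; exists W => //; split=> //; exists a.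
apply/seteqP; split=> // x [clx Kx].
have lG : locally_finite id G.
  move=> y; have [N Ny fN] := lD y; exists N => //.
  by apply: sub_finite_set fN => W [[DW _] WN].
have [W [DW [a [Wa Aa]]] clW] := closure_locally_finite lG clx.
have [V [[_ VK]|VA] WV] := DC _ DW; last by move: (WV a Wa); rewrite VA; exact.
by rewrite -VK; split=> //; exact: closureS clW.
Qed.

Lemma paracompact_regular (x : T) (O : set T) : open O -> O x ->
  exists V, [/\ open V, V x & closure V `<=` O].
Proof.
move=> oO Ox; have [|a nOa|V [oV OV Vx]] := @paracompact_separate (~` O) [set x].
- exact: open_closedC.
- have ax : a != x by apply/eqP => ax; apply: nOa; rewrite ax.
  have := pT.1; rewrite open_hausdorff => /(_ a x ax)[[V W] /= [aV xW] [oV oW /eqP VW]].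
  exists V; split=> //; first by rewrite inE in aV.
  apply/seteqP; split=> // y [clV yx]; rewrite inE in xW; rewrite {}yx in clV.
  have := clV W (open_nbhs_nbhs (conj oW xW)).
  by rewrite VW => -[].
exists (~` closure V); split.
- exact/closed_openC/closed_closure.
- by move=> clx; have : set0 x by rewrite -Vx.
apply: (@subset_trans _ (~` V)).
  rewrite [X in _ `<=` X](closure_id _).1; last exact: open_closedC.
  by apply: closureS; apply: subsetC; exact: subset_closure.
by rewrite -[X in _ `<=` X]setCK; exact: subsetC.
Qed.

Lemma paracompact_normal : forall A B : set T, closed A -> closed B ->
  A `&` B = set0 ->
  exists U V : set T, [/\ open U, open V, A `<=` U, B `<=` V & U `&` V = set0].
Proof.
move=> A B cA cB AB.
have [||V [oV AV VB]] := @paracompact_separate A B => //.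
  move=> a Aa; have nBa : (~` B) a by move=> Ba; have : set0 a by rewrite -AB.
  have [V [oV Va VB]] := paracompact_regular (closed_openC cB) nBa.
  exists V; split=> //; apply/seteqP; split=> // y [/VB].
  by [].
exists V, (~` closure V); split=> //.
- exact/closed_openC/closed_closure.
- by move=> y By clV; have : set0 y by rewrite -VB.
- by apply/seteqP; split=> // y [Vy]; apply; exact: subset_closure.
Qed.

(** Each member of a locally finite refinement is assigned to one [U i] containing its closure;
    members with the same index are united. *)
Lemma paracompact_shrink (I : choiceType) (U : I -> set T) :
  is_indexed_open_cover U -> exists W : I -> set T,
  [/\ is_indexed_open_cover W, (forall i, closure (W i) `<=` U i) &
      locally_finite W setT].
Proof.
move=> [oU cU]; pose C := [set V | open V /\ exists i, closure V `<=` U i].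
have [|D [[oD cD] DC lD]] := pT.2 C.
  split=> [V []//|]; apply/seteqP; split=> // x _.
  have : setT x by []. 
  rewrite -cU => -[i _ Uix]; have [V [oV Vx VU]] := paracompact_regular (oU i) Uix.
  by exists V => //; split=> //; exists i.
(* [option] gives the sets outside [D] a value even if [I] is empty. *)
have /choice[idx hidx] : forall V : set T, exists o : option I,
    D V -> exists2 i, o = Some i & closure V `<=` U i.
  move=> V; have [DV|nDV] := pselect (D V); last by exists None.
  have [V' [_ [i V'U]] VV'] := DC _ DV; exists (Some i) => _; exists i => //.
  by apply: subset_trans V'U; exact: closureS.
pose G i := [set V | D V /\ idx V = Some i].
exists (fun i => \bigcup_(V in G i) V); split.
- split=> [i|]; first by apply: bigcup_open => V [DV _]; exact: oD.
  apply/seteqP; split=> // x _; have : setT x by [].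
  rewrite -cD => -[V DV Vx]; have [i iV _] := hidx _ DV.
  by exists i => //; exists V.
- move=> i x clx; have lG : locally_finite id (G i).
    move=> y; have [N Ny fN] := lD y; exists N => //.
    by apply: sub_finite_set fN => W [[DW _] WN].
  have [V [DV Vi] clV] := closure_locally_finite lG clx.
  have [j + VU] := hidx _ DV; rewrite Vi => -[ij].
  by rewrite ij; exact: VU.
- move=> x; have [N Nx fN] := lD x; exists N => //.
  have fS : finite_set (idx @` [set V | D V /\ id V `&` N !=set0]).
    exact: finite_image.
  apply: (@sub_finite_set _ _ (Some @^-1` (idx @` [set V | D V /\ id V `&` N !=set0]))).
    move=> i [_ [y [[V [DV Vi] Vy] Ny]]]; exists V => //.
    by split=> //; exists y.
  by apply: finite_preimage => // i j _ _ [].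
Qed.

Lemma locally_finite_closure (I : Type) (W : I -> set T) :
  locally_finite W setT -> locally_finite (closure \o W) setT.
Proof.
move=> lW x; have [N Nx fN] := lW x; exists N°; first exact: nbhs_interior.
apply: sub_finite_set fN => i [_ [y [clW Ny]]]; split=> //.
have [z [Wz Nz]] := clW _ (open_nbhs_nbhs (conj (@open_interior _ N) Ny)).
by exists z; split=> //; exact: interior_subset.
Qed.

End Paracompactness.

Section PartitionOfUnity.
Context {R : realType} {T : topologicalType} {I : choiceType}.

(** Shrinking twice leaves room for Urysohn functions that are 1 on [W' i] and 0 off [W i]: their
    supports lie in [U i], and their sum is at least 1 because the [W' i] cover, so it can be
    divided out. *)
Lemma pou_exists (U : I -> set T) : paracompact T ->
  is_indexed_open_cover U -> inhabited (partition_of_unity R U).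
Proof.
move=> pT cU; have [W [cW WU lW]] := paracompact_shrink pT cU.
have [W' [cW' W'W lW']] := paracompact_shrink pT cW.
pose f i : T -> R := Urysohn (~` W i) (closure (W' i)).
have sep i : uniform_separator (~` W i) (closure (W' i)).
  have nT : normal_space T := (normal_openP (R := R)).2 (paracompact_normal pT).
  apply: (normal_separatorP (R := R)).1 => //.
  - by apply: open_closedC; exact: cW.1.
  - exact: closed_closure.
  - by apply/seteqP; split=> // x [nW] /W'W.
have fc i : continuous (f i) by exact: Urysohn_continuous.
have f0 i x : ~ W i x -> f i x = 0.
  by move=> nW; apply: (Urysohn_sub0 (sep i)); exists x.
have f1 i x : W' i x -> f i x = 1.
  by move=> W'x; apply: (Urysohn_sub1 (sep i)); exists x => //; exact: subset_closure.
have fge0 i x : 0 <= f i x.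
  have : range (f i) (f i x) by exists x.
  by move/Urysohn_range; rewrite /= in_itv /= => /andP[].
have near_supp (x : T) : exists q : seq I, uniq q /\
    \forall y \near x, forall j, f j y != 0 -> j \in q.
  have [N Nx fN] := lW x.
  exists (fset_set [set k | setT k /\ W k `&` N !=set0]); split; first exact: fset_uniq.
  apply: filterS Nx => y Ny j fj; rewrite in_fset_set// inE; split=> //.
  by exists y; split=> //; apply: contrapT => /f0 /eqP; rewrite (negbTE fj).
have sumE (F : I -> R) y q : uniq q -> (forall j, f j y != 0 -> j \in q) ->
    (forall j, f j y = 0 -> F j = 0) ->
    \sum_(j \in [set: I]) F j = \sum_(j <- q) F j.
  move=> uq hq F0; apply: fsbig_setT_seq => // j jq.
  by apply: F0; apply: contraNeq jq => /hq.
pose s x := \sum_(j \in [set: I]) f j x.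
have s1 x : 1 <= s x.
  have [q [uq /nbhs_singleton hq]] := near_supp x.
  rewrite /s (sumE _ x q)//; have : setT x by [].
  rewrite -cW'.2 => -[i _ W'i]; have iq : i \in q.
    by apply: hq; rewrite (f1 _ _ W'i) oner_eq0.
  by rewrite (big_rem i)//= (f1 _ _ W'i) lerDl sumr_ge0.
have s_gt0 x : 0 < s x by apply: lt_le_trans (s1 x).
have sc : continuous s.
  move=> x; have [q [uq hq]] := near_supp x.
  apply: (@near_continuous_at _ _ _ (fun y => \sum_(j <- q) f j y)).
    by apply: filterS hq => y hy; apply: (sumE _ y).
  by apply: continuous_at_sum => j; exact: fc.
have supp_sub i : [set x | f i x / s x != 0] `<=` W i.
  by move=> x /=; apply: contraNP => /f0 ->; rewrite mul0r.
constructor; apply: (@PartitionOfUnity R T I U (fun i x => f i x / s x)).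
- move=> i x; apply: cvgM; first exact: fc.
  by apply: cvgV; [rewrite gt_eqF|exact: sc].
- by move=> i x; rewrite divr_ge0// ltW.
- move=> i; apply: subset_trans (WU i); exact: closureS.
- move=> x; have [N Nx fN] := locally_finite_closure lW x; exists N => //.
  apply: sub_finite_set fN => i [_ [y [cly Ny]]]; split=> //; exists y; split=> //.
  exact: closureS cly.
- move=> x; have [q [uq /nbhs_singleton hq]] := near_supp x.
  rewrite (sumE _ x q)// => [|j ->]; last by rewrite mul0r.
  by rewrite -mulr_suml -(sumE _ x q)// divff// gt_eqF// s_gt0.
Qed.

End PartitionOfUnity.

(** * Homotopies *)

Section Homotopies.
Context {R : realType} {X Y : topologicalType}.
Implicit Types (S : set Y) (f g h : X -> Y).

(** Extends a homotopy from times in [[0, 1]] to all of [R], so that continuity need not be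
    restricted to a subspace. *)
Definition clamp (t : R) := Num.max 0 (Num.min 1 t).

Lemma clamp_ge0 t : 0 <= clamp t.
Proof. by rewrite /clamp le_max lexx. Qed.

Lemma clamp_le1 t : clamp t <= 1.
Proof. by rewrite /clamp ge_max ler01 ge_min lexx. Qed.

Lemma clampE t : 0 <= t <= 1 -> clamp t = t.
Proof. by move=> /andP[t0 t1]; rewrite /clamp min_r// max_r. Qed.

Lemma continuous_clamp : continuous clamp.
Proof.
move=> t; apply: continuous_max; first exact: cst_continuous.
by apply: continuous_min; [exact: cst_continuous|exact: cvg_id].
Qed.

Lemma continuous_clamp_snd (x : X * R) :
  {for x, continuous (fun z : X * R => clamp z.2)}.
Proof.
apply: (@continuous_comp _ _ _ snd clamp); last exact: continuous_clamp.
exact: continuous_at_snd.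
Qed.

Lemma homotopicP S f g : homotopic_in R S f g <->
  exists H : X * R -> Y, [/\ continuous H, forall z, S (H z),
    forall x, H (x, 0) = f x & forall x, H (x, 1) = g x].
Proof.
split=> [[H [cH SH H0 H1]]|[H [cH SH H0 H1]]]; last first.
  by exists H; split=> //; exact: continuous_subspaceT.
pose c (z : X * R) : X * R := (z.1, clamp z.2).
have cA z : ([set: X] `*` `[0, 1]) (c z).
  by split=> //=; rewrite in_itv /= clamp_ge0 clamp_le1.
exists (H \o c); split.
- move=> z; move/subspace_continuousP : cH => /(_ _ (cA z)) cH.
  have cc : {for z, continuous c}.
    apply: (@continuous_at_pair _ X R fst (fun z => clamp z.2)).
      exact: continuous_at_fst.
    exact: continuous_clamp_snd.
  move=> V /cH VH.
  exact: (@filterS _ (nbhs z) _ _ _ (fun w hw => hw (cA w)) (cc _ VH)).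
- by move=> [x t]; apply: SH; rewrite clamp_ge0 clamp_le1.
- by move=> x; rewrite /= /c /= clampE ?lexx ?ler01// H0.
- by move=> x; rewrite /= /c /= clampE ?lexx ?ler01// H1.
Qed.

Lemma homotopic_refl S f : continuous f -> (forall x, S (f x)) ->
  homotopic_in R S f f.
Proof.
move=> cf Sf; apply/homotopicP; exists (f \o fst); split=> // [z|z]; last exact: Sf.
by apply: continuous_comp; [exact: continuous_at_fst|exact: cf].
Qed.

Lemma homotopic_sym S f g : homotopic_in R S f g -> homotopic_in R S g f.
Proof.
move=> /homotopicP[H [cH SH H0 H1]]; apply/homotopicP.
exists (fun z => H (z.1, 1 - z.2)); split=> // [z|x|x].
- suff c : {for z, continuous (fun z : X * R => (z.1, 1 - z.2))}.
    exact: (continuous_comp c (cH _)).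
  apply: continuous_at_pair; first exact: continuous_at_fst.
  by apply: continuousB; [exact: cst_continuous|exact: continuous_at_snd].
- by rewrite /= subr0 H1.
- by rewrite /= subrr H0.
Qed.

Lemma homotopic_trans S f g h : homotopic_in R S f g -> homotopic_in R S g h ->
  homotopic_in R S f h.
Proof.
move=> /homotopicP[H [cH SH H0 H1]] /homotopicP[G [cG SG G0 G1]].
apply/homotopicP.
pose F (z : X * R) := if z.2 <= 2^-1 then H (z.1, 2 * z.2)
                      else G (z.1, 2 * z.2 - 1).
have cl (P : R -> bool) : closed [set t | P t] -> closed [set z : X * R | P z.2].
  move=> cP; apply: (@preimage_closed _ _ snd [set t | P t]) => // z _.
  exact: continuous_at_snd.
have c2 : forall z : X * R, {for z, continuous (fun z : X * R => (z.1, 2 * z.2))}.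
  move=> z; apply: continuous_at_pair; first exact: continuous_at_fst.
  by apply: continuousM; [exact: cst_continuous|exact: continuous_at_snd].
have c3 : forall z : X * R, {for z, continuous (fun z : X * R => (z.1, 2 * z.2 - 1))}.
  move=> z; apply: continuous_at_pair; first exact: continuous_at_fst.
  apply: continuousB; last exact: cst_continuous.
  by apply: continuousM; [exact: cst_continuous|exact: continuous_at_snd].
exists F; split.
- apply/continuous_subspace_setT.
  have -> : [set: X * R] = [set z | z.2 <= 2^-1] `|` [set z | 2^-1 <= z.2].
    apply/seteqP; split=> // z _ /=.
    by case: (leP z.2 2^-1) => [|/ltW]; [left|right].
  apply: withinU_continuous; [exact: (cl (fun t => t <= 2^-1) (@closed_le _ _))|
    exact: (cl (fun t => 2^-1 <= t) (@closed_ge _ _))| |].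
    apply: (@subspace_eq_continuous _ [set z : X * R | z.2 <= 2^-1] _
      (fun z => H (z.1, 2 * z.2)) F).
      by move=> z; rewrite inE /= /F => ->.
    apply: continuous_subspaceT => z.
    by apply: (@continuous_comp _ _ _ _ H); [exact: c2|exact: cH].
  apply: (@subspace_eq_continuous _ [set z : X * R | 2^-1 <= z.2] _
    (fun z => G (z.1, 2 * z.2 - 1)) F).
    move=> [x t]; rewrite inE /= /F /= => t2'; case: (leP t 2^-1) => //= t2.
    have -> : t = 2^-1 by apply/eqP; rewrite eq_le t2 t2'.
    by rewrite divff ?pnatr_eq0// subrr G0 H1.
  apply: continuous_subspaceT => z.
  by apply: (@continuous_comp _ _ _ _ G); [exact: c3|exact: cG].
- by move=> z; rewrite /F; case: ifP.
- by move=> x; rewrite /F /= invr_ge0 ler0n mulr0 H0.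
- move=> x; rewrite /F /= ifF ?mulr1.
    by rewrite (_ : 2 - 1 = 1 :> R)// ; lra.
  by apply/negbTE; rewrite -ltNge; lra.
Qed.

End Homotopies.

Section PushClass.
Context {R : realType} {X : topologicalType}.
Variable d : nat.
Implicit Types (S : set (infmx R)) (f g h : X -> infmx R).

Lemma homotopic_closest_point S f g : S `<=` spectral_domain d ->
  homotopic_in R S f g ->
  homotopic_in R (grassmannian d) (closest_point d \o f) (closest_point d \o g).
Proof.
move=> Sd /homotopicP[H [cH SH H0 H1]]; apply/homotopicP.
exists (closest_point d \o H); split=> [z|z|x|x] /=.
- apply: continuous_comp; first exact: cH.
  by apply: continuous_closest_point; exact: Sd.
- by apply: (@spectral_proj_grass _ _ (H z)); apply: spectral_domainP; exact: Sd.
- by rewrite H0.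
- by rewrite H1.
Qed.

Lemma push_homotopy_class S f g : S `<=` spectral_domain d -> continuous f ->
  (forall x, S (f x)) ->
  homotopic_in R (grassmannian d) (closest_point d \o f) g ->
  homotopy_class R (grassmannian d) g =
  pi_star d (homotopy_class R S f).
Proof.
move=> Sd cf Sf fg; apply/seteqP; split=> [h gh|h [f' ff' f'h]].
  by exists f; [exact: homotopic_refl|exact: homotopic_trans gh].
apply: homotopic_trans f'h; apply: homotopic_trans (homotopic_sym fg) _.
exact: homotopic_closest_point ff'.
Qed.

End PushClass.

(** Over [B * R] a homotopy of classifying maps becomes itself the classifying map of a family, and
    its continuity comes from [continuous_cl_map]. *)
Definition cylinder (R : realType) (B : topologicalType) (I : Type)
    (U : I -> set B) (i : I) : set (B * R) := U i `*` [set: R].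
Arguments cylinder {R B I} U i.

(** * Interpolation of two partitions of unity over the cylinders *)

Section PullbackPartition.
Context {R : realType} {B : topologicalType} {I : choiceType} {U : I -> set B}.
Variables phi psi : partition_of_unity R U.

Lemma closure_prod_setT (A C : set B) : closure A `<=` C ->
  closure (A `*` [set: R]) `<=` C `*` [set: R].
Proof.
move=> hAC [y t] clA; split=> //=; apply: hAC => N Ny.
have [|[z s] [[Az _] Nz]] := clA (fst @^-1` N); first exact: (@continuous_at_fst _ _ (y, t) _ Ny).
by exists z.
Qed.

Definition interp (i : I) (z : B * R) : R :=
  (1 - clamp z.2) * phi i z.1 + clamp z.2 * psi i z.1.

Let interp_supp i : [set z | interp i z != 0] `<=`
  ([set y | phi i y != 0] `|` [set y | psi i y != 0]) `*` [set: R].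
Proof.
move=> [y t] /= h; split=> //=; apply: contrapT => /not_orP[/negP + /negP].
rewrite !negbK => /eqP p0 /eqP q0; move: h.
by rewrite /interp /= p0 q0 !mulr0 addr0 eqxx.
Qed.

Let closure_interp i : closure [set z | interp i z != 0] `<=`
  (closure [set y | phi i y != 0] `|` closure [set y | psi i y != 0]) `*` [set: R].
Proof.
apply: subset_trans (closureS (@interp_supp i)) _.
by apply: closure_prod_setT; rewrite closureU.
Qed.

Let interp_continuous i : continuous (interp i).
Proof.
move=> z; rewrite /interp; apply: cvgD; apply: cvgM.
- by apply: cvgB; [exact: cvg_cst|exact: continuous_clamp_snd].
- by apply: (@continuous_comp _ _ _ fst); [exact: continuous_at_fst|exact: pou_continuous].
- exact: continuous_clamp_snd.
- by apply: (@continuous_comp _ _ _ fst); [exact: continuous_at_fst|exact: pou_continuous].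
Qed.

Let interp_ge0 i z : 0 <= interp i z.
Proof.
by rewrite addr_ge0// mulr_ge0 ?pou_ge0 ?clamp_ge0// subr_ge0 clamp_le1.
Qed.

Let interp_subordinate i : closure [set z | interp i z != 0] `<=` cylinder U i.
Proof.
move=> z /closure_interp[+ _]; case=> h; split=> //; exact: (pou_subordinate h).
Qed.

Let interp_locally_finite :
  locally_finite (fun i => closure [set z | interp i z != 0]) setT.
Proof.
move=> [y t]; have [N Ny fN] := pou_locally_finite phi y.
have [M My fM] := pou_locally_finite psi y.
exists (fst @^-1` (N `&` M)).
  exact: (@continuous_at_fst _ _ (y, t) _ (filterI Ny My)).
apply: (@sub_finite_set _ _ (_ `|` _)); last by rewrite finite_setU; split; [exact: fN|exact: fM].
move=> i [_ [[z s] [/closure_interp[/= + _] [Nz Mz]]]].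
by case=> h; [left|right]; split=> //; exists z.
Qed.

Let interp_sum1 z : \sum_(i \in [set: I]) interp i z = 1.
Proof.
have uq := undup_uniq (pou_supp phi z.1 ++ pou_supp psi z.1).
set q := undup _ in uq.
have mem j : (j \in q) = (phi j z.1 != 0) || (psi j z.1 != 0).
  by rewrite mem_undup mem_cat !mem_pou_supp.
have pq j : j \notin q -> phi j z.1 = 0 /\ psi j z.1 = 0.
  by rewrite mem negb_or !negbK => /andP[/eqP -> /eqP ->].
rewrite (fsbig_setT_seq uq) => [|j /pq[p0 q0]]; last first.
  by rewrite /interp p0 q0 !mulr0 addr0.
rewrite big_split /= -!mulr_sumr -!(fsbig_setT_seq uq) => [|j /pq[]//|j /pq[]//].
by rewrite !pou_sum1 !mulr1 subrK.
Qed.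

Definition pou_interp : partition_of_unity R (cylinder U) :=
  PartitionOfUnity interp_continuous interp_ge0 interp_subordinate
    interp_locally_finite interp_sum1.

End PullbackPartition.

(** The value depends on the data at the point only; this compares a classifying map over [B * R]
    with its slices over [B]. *)
Lemma cl_map_ext (R : realType) (B B' : topologicalType) (I : choiceType)
    (U : I -> set B) (U' : I -> set B') d (iota : I -> nat)
    (phi : partition_of_unity R U) (phi' : partition_of_unity R U')
    (Omega : cochain d) (Omega' : cochain d) y y' :
  (forall j, phi j y = phi' j y') -> (forall j, U j y = U' j y') ->
  (forall i j, Omega i j y = Omega' i j y') ->
  cl_map phi iota Omega y = cl_map phi' iota Omega' y'.
Proof.
move=> pE UE OE; have fE i r c : local_frame phi iota Omega i y r c =
    local_frame phi' iota Omega' i y' r c.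
  rewrite /local_frame (_ : [set j | U j y] = [set j | U' j y']); last first.
    by apply/funext => j /=; rewrite UE.
  by apply: eq_fsbigr => j _; apply: eq_bigr => k _; rewrite pE OE.
apply: infmxP => r s; rewrite /= /cl_fun; apply: eq_fsbigr => i _.
by rewrite pE; congr (_ * _); apply: eq_bigr => c _; rewrite !fE.
Qed.

Lemma orthogonal_invmx (R : realType) d (A : 'M[R]_d) :
  orthogonal_group A -> invmx A = A^T.
Proof.
rewrite /orthogonal_group /= => AA; have [_ uA] := mulmx1_unit AA.
by rewrite -[RHS]mulmx1 -(mulmxV uA) mulmxA AA mul1mx.
Qed.

(** * Pointwise consequences of the cocycle conditions *)

Section CochainFacts.
Context {R : realType} {B : topologicalType} {I : choiceType} {U : I -> set B}.
Variables (d : nat) (e : R) (Omega : I -> I -> B -> 'M[R]_d).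
Hypothesis U_open : forall i, open (U i).
Hypothesis hO : approx_cocycle U e Omega.

Lemma cocycle_orth y i j : U i y -> U j y ->
  (Omega i j y)^T *m Omega i j y = 1%:M.
Proof. by move=> Ui Uj; have [/(_ i j)[_ h] _ _] := hO; apply: h. Qed.

Lemma cocycle_sym y i j : U i y -> U j y -> Omega i j y = (Omega j i y)^T.
Proof.
move=> Ui Uj; have [_ h _] := hO; rewrite h//.
by rewrite orthogonal_invmx//; exact: cocycle_orth.
Qed.

Lemma cocycle_mul_approx y i j k : e != 0 -> U i y -> U j y -> U k y ->
  frob (Omega i j y *m Omega j k y - Omega i k y) < e.
Proof.
move=> /negbTE e0 Ui Uj Uk; have [_ _ /(_ i j k y)] := hO.
by rewrite e0; apply; split=> //; split.
Qed.

Lemma cocycle_mul_exact y i j k : e = 0 -> U i y -> U j y -> U k y ->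
  Omega i j y *m Omega j k y = Omega i k y.
Proof.
move=> e0 Ui Uj Uk; have [_ _ /(_ i j k y)] := hO.
by rewrite e0 eqxx; apply; split=> //; split.
Qed.

Lemma cocycle_continuous : pointwise_continuous (U := U) Omega.
Proof.
move=> i j y Uj Ui a b; have [/(_ i j)[+ _] _ _] := hO.
rewrite continuous_open_subspace; last exact: openI.
move=> /(_ y (mem_set (conj Uj Ui))) c.
apply: (@continuous_comp _ _ _ (Omega i j) (fun A : 'M[R]_d => A a b) y c).
exact: coord_continuous.
Qed.

End CochainFacts.

(** * Values of the classifying map and their spectral projections *)

Section ClassifyingMapValues.
Context {R : realType} {B : topologicalType} {I : choiceType} {U : I -> set B}.
Variables (d : nat) (phi : partition_of_unity R U) (iota : I -> nat).
Hypothesis iota_inj : injective iota.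
Hypothesis iota_gt0 : forall i, (1 <= iota i)%N.
Hypothesis cU : is_indexed_open_cover U.
Implicit Types (Omega : I -> I -> B -> 'M[R]_d).

Local Notation emb y m :=
  (@embed_mx R _ d (fun k => iota (@pou_index _ _ _ _ phi y k)) m).
Local Notation fr Omega y := (frame (@pou_index _ _ _ _ phi y)
  (@pou_weight _ _ _ _ phi y) (fun i j => Omega i j y)).
Local Notation avg Omega y := (frame_avg (@pou_index _ _ _ _ phi y)
  (@pou_weight _ _ _ _ phi y) (fun i j => Omega i j y)).

Lemma cover_point y : exists i, U i y.
Proof. by have : setT y by []; rewrite -cU.2 => -[i _ Ui]; exists i. Qed.

Lemma pou_index_U y k : U (@pou_index _ _ _ _ phi y k) y.
Proof. by apply: (pou_neq0 (phi := phi)); exact: pou_indexP. Qed.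

Lemma cl_map_exact_grass Omega y : approx_cocycle U 0 Omega ->
  grassmannian d (cl_map phi iota Omega y).
Proof.
move=> hO; have [i Ui] := cover_point y.
have [m hm] := iota_bound_exists d iota (pou_supp phi y).
rewrite (cl_map_avg Omega hm).
rewrite (frame_avg_exact (V := fun j => U j y)
  (pou_weight_sum1 phi y) (pou_index_U (y := y)) _ _ _ Ui); first last.
- by move=> j k l; exact: (cocycle_mul_exact hO).
- by move=> j k; exact: (cocycle_sym hO).
- by move=> j k; exact: (cocycle_orth hO).
apply/grassmannian_pad; rewrite mulmxA -(mulmxA _ _ (emb y m)^T) -trmx_mul.
apply: frame_grass; rewrite trmx_mul mulmxA -(mulmxA _ _ (emb y m)).
rewrite (emb_isometry iota_inj iota_gt0 hm) mulmx1.
apply: (frame_isometry (V := fun j => U j y)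
  (pou_weight_gt0 (y := y)) (pou_weight_sum1 phi y) (pou_index_U (y := y))) => //.
- by move=> j k; exact: (cocycle_orth hO).
- by move=> j k; exact: (cocycle_sym hO).
Qed.

Section Approximate.
Variables (e : R) (Omega : I -> I -> B -> 'M[R]_d).
Hypothesis e_gt0 : 0 < e.
Hypothesis hO : approx_cocycle U e Omega.

Lemma pou_frame_isometry y i : U i y ->
  (fr Omega y i)^T *m fr Omega y i = 1%:M.
Proof.
move=> Ui; apply: (frame_isometry (V := fun j => U j y)
  (pou_weight_gt0 (y := y)) (pou_weight_sum1 phi y) (pou_index_U (y := y))) => //.
- by move=> j k; exact: (cocycle_orth hO).
- by move=> j k; exact: (cocycle_sym hO).
Qed.

Lemma pou_frame_gram_approx y i j : U i y -> U j y ->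
  frob ((fr Omega y i)^T *m fr Omega y j - Omega i j y) < e.
Proof.
move=> Ui Uj; apply: (frame_gram_approx (V := fun j => U j y)
  (pou_weight_gt0 (y := y)) (pou_weight_sum1 phi y) (pou_index_U (y := y)) _ _ Ui Uj).
- by move=> k l; exact: (cocycle_sym hO).
- by move=> k l n; apply: (cocycle_mul_approx hO); rewrite gt_eqF.
Qed.

Lemma pou_frame_avg_approx y j : U j y ->
  frob (avg Omega y - fr Omega y j *m (fr Omega y j)^T) < Num.sqrt 2 * e.
Proof.
move=> Uj; apply: (frame_avg_approx (V := fun j => U j y)
  (pou_weight_gt0 (y := y)) (pou_weight_sum1 phi y) (pou_index_U (y := y)) _ _ _ Uj).
- by move=> k l; exact: (cocycle_orth hO).
- by move=> k l; exact: (cocycle_sym hO).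
- by move=> k l n; apply: (cocycle_mul_approx hO); rewrite gt_eqF.
Qed.

Lemma cl_map_thick y :
  thick_grassmannian d (Num.sqrt 2 * e) (cl_map phi iota Omega y).
Proof.
have [i Ui] := cover_point y.
have [m hm] := iota_bound_exists d iota (pou_supp phi y).
rewrite (cl_map_avg Omega hm).
rewrite /thick_grassmannian gt_eqF ?mulr_gt0 ?sqrtr_gt0//=.
have EE := emb_isometry iota_inj iota_gt0 hm.
exists (pad (emb y m *m (fr Omega y i *m (fr Omega y i)^T) *m (emb y m)^T)).
  apply/grassmannian_pad; rewrite mulmxA -(mulmxA _ _ (emb y m)^T) -trmx_mul.
  apply: frame_grass; rewrite trmx_mul mulmxA -(mulmxA _ _ (emb y m)).
  by rewrite EE mulmx1 pou_frame_isometry.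
rewrite frob_dist_pad -mulmxBl -mulmxBr -frobT trmx_mul trmxK.
rewrite frob_isometry// frobT frob_isometry//.
exact: pou_frame_avg_approx.
Qed.

End Approximate.

Lemma cl_map_spectral_proj Omega y a b P m : 0 <= b < a ->
  gap_proj d a b (avg Omega y) P -> iota_bound d iota (pou_supp phi y) m ->
  spectral_proj d (cl_map phi iota Omega y)
    (pad (emb y m *m P *m (emb y m)^T)).
Proof.
move=> ab hP hm; exists m, (emb y m *m avg Omega y *m (emb y m)^T).
exists (emb y m *m P *m (emb y m)^T), a, b; split=> //.
  exact: (cl_map_avg Omega hm).
rewrite symm_conj symm_id ?frame_avgT//.
apply: gap_proj_isometry hP; last by case/andP: ab.
exact: (emb_isometry iota_inj iota_gt0 hm).
Qed.

End ClassifyingMapValues.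

(** * The rectified cocycle *)

Lemma continuous_at_inv_sqrt (R : realType) (X : topologicalType) n
    (f : X -> 'M[R]_n) x : {for x, continuous f} ->
  (\forall y \near x, frob (1%:M - f y) <= 2^-1) ->
  {for x, continuous (fun y => inv_sqrt (f y))}.
Proof.
move=> cf hf V /nbhs_frobP[e e0 he].
have e4 : 0 < e / 4 by rewrite divr_gt0.
have h := cf _ (near_frob_lt (f x) e4).
apply: (@filterS2 _ (nbhs x) _ _ _ _ _ h hf) => y fy y2; apply: he.
apply: le_trans (inv_sqrt_lipschitz y2 (nbhs_singleton hf)) _.
have : frob (f y - f x) < e / 4 by [].
lra.
Qed.

Lemma continuous_at_mulmx (R : realType) (X : topologicalType) m n p
    (f : X -> 'M[R]_(m, n)) (g : X -> 'M[R]_(n, p)) x :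
  {for x, continuous f} -> {for x, continuous g} ->
  {for x, continuous (fun y => f y *m g y)}.
Proof.
move=> cf cg; apply: continuous_at_mx => i j.
rewrite (_ : (fun _ => _) = (fun y => \sum_k f y i k * g y k j)); last first.
  by apply/funext => y; rewrite mxE.
apply: continuous_at_sum => k; apply: continuous_atM.
  apply: (@continuous_comp _ _ _ f (fun A : 'M[R]_(m, n) => A i k) x cf).
  exact: coord_continuous.
apply: (@continuous_comp _ _ _ g (fun A : 'M[R]_(n, p) => A k j) x cg).
exact: coord_continuous.
Qed.

Lemma four_sqrt2_le (R : realType) (e : R) : 0 < e ->
  2 * (Num.sqrt 2 * e) + 2 * (Num.sqrt 2 * e) + e <= 9 * e.
Proof.
have s2 : Num.sqrt 2 <= 2 :> R.
  by rewrite -ler_sqr ?nnegrE ?sqrtr_ge0// sqr_sqrtr// expr2; lra.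
by move=> /ltW /ler_wpM2r /(_ _ _ s2); lra.
Qed.

Section Rectification.
Context {R : realType} {B : topologicalType} {I : choiceType} {U : I -> set B}.
Variables (d : nat) (phi : partition_of_unity R U).
Variables (e : R) (Omega : I -> I -> B -> 'M[R]_d).
Hypothesis cU : is_indexed_open_cover U.
Hypothesis e_gt0 : 0 < e.
Hypothesis e_le : e <= Num.sqrt 2 / 4.
Hypothesis hO : approx_cocycle U e Omega.

Local Notation fr y := (frame (@pou_index _ _ _ _ phi y)
  (@pou_weight _ _ _ _ phi y) (fun i j => Omega i j y)).
Local Notation avg y := (frame_avg (@pou_index _ _ _ _ phi y)
  (@pou_weight _ _ _ _ phi y) (fun i j => Omega i j y)).

(** The size of this matrix depends on [y], so continuity is asked only of the [d] by [d] matrices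
    [frame_gram_proj] derived from it. *)
Definition avg_proj y := xget 0 [set P | exists a b,
  0 <= b < a /\ gap_proj d a b (avg y) P].

Definition frame_gram_proj i j y : 'M[R]_d :=
  (fr y i)^T *m avg_proj y *m fr y j.

Definition half_gram i y := inv_sqrt (frame_gram_proj i i y).

Definition rectified i j y : 'M[R]_d :=
  half_gram i y *m frame_gram_proj i j y *m half_gram j y.

(** The bound on [e] in the form in which it is used: the radius 1/2 of [near_gap_proj]. *)
Lemma sqrt2_e_le : Num.sqrt 2 * e <= 1 / 2.
Proof.
have s2 : Num.sqrt 2 * Num.sqrt 2 = 2 :> R by rewrite -expr2 sqr_sqrtr.
have := ler_wpM2l (sqrtr_ge0 (2 : R)) e_le; rewrite mulrA s2; lra.
Qed.

Lemma avg_projP y : exists a b,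
  0 <= b < a /\ gap_proj d a b (avg y) (avg_proj y).
Proof.
have [i Ui] := cover_point cU y.
have FF := pou_frame_isometry phi hO Ui.
have [P [a [b [ab hP _]]]] := near_gap_proj (frame_grass FF)
  (pou_frame_avg_approx phi e_gt0 hO Ui) sqrt2_e_le.
rewrite symm_id ?frame_avgT// in hP.
apply: (xgetPex 0 (P := [set P | exists a b,
  0 <= b < a /\ gap_proj d a b (avg y) P])).
by exists P, a, b.
Qed.

Lemma avg_proj_grass y : grassmannian_fin d _ (avg_proj y).
Proof. by have [a [b [_ []]]] := avg_projP y. Qed.

(** [avg_proj y] is at least as close to the average as the projection of any frame, so the triangle
    inequality through the average doubles the distance. *)
Lemma avg_proj_dist y i : U i y ->
  frob (avg_proj y - fr y i *m (fr y i)^T) < 2 * (Num.sqrt 2 * e).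
Proof.
move=> Ui; have FF := pou_frame_isometry phi hO Ui.
have h := pou_frame_avg_approx phi e_gt0 hO Ui.
have [a [b [/andP[_ ab] hP]]] := avg_projP y.
rewrite -[avg y]symm_id ?frame_avgT// in hP.
have [h' _] := gap_proj_closest ab hP (frame_grass FF).
rewrite frobC in h'.
apply: le_lt_trans (frob_tri _ (avg y) _) _.
rewrite mulr_natl mulr2n; apply: ltrD => //; exact: le_lt_trans h' h.
Qed.

Lemma avg_proj_dist1 y i : U i y ->
  frob (avg_proj y - fr y i *m (fr y i)^T) <= 1.
Proof.
by move=> Ui; apply: le_trans (ltW (avg_proj_dist Ui)) _; have := sqrt2_e_le; lra.
Qed.

Lemma frame_gram_projT i j y :
  (frame_gram_proj i j y)^T = frame_gram_proj j i y.
Proof.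
rewrite /frame_gram_proj !trmx_mul trmxK -(grass_proj (avg_proj_grass y)).1.
by rewrite mulmxA.
Qed.

Lemma frame_gram_proj_small i y : U i y ->
  frob (1%:M - frame_gram_proj i i y) <= 2^-1.
Proof.
move=> Ui; apply: (frob_compression (avg_proj_grass y)).
  exact: (pou_frame_isometry phi hO Ui).
exact: avg_proj_dist1.
Qed.

Lemma half_gramT i y : U i y -> (half_gram i y)^T = half_gram i y.
Proof.
move=> Ui; apply: inv_sqrtT; first exact: frame_gram_proj_small.
exact: frame_gram_projT.
Qed.

Lemma rectifiedE i j y : U i y -> U j y -> rectified i j y =
  (orth_frame (avg_proj y) (fr y i))^T *m orth_frame (avg_proj y) (fr y j).
Proof.
move=> Ui Uj; have [PT PP] := grass_proj (avg_proj_grass y).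
have KT := half_gramT Ui.
rewrite /orth_frame !trmx_mul -/(frame_gram_proj i i y) -/(half_gram i y) KT.
rewrite -/(frame_gram_proj j j y) -/(half_gram j y) -PT /rectified.
by rewrite {1}/frame_gram_proj {1}PP !mulmxA.
Qed.

Lemma orth_frame_pou y i : U i y ->
  (orth_frame (avg_proj y) (fr y i))^T *m orth_frame (avg_proj y) (fr y i) = 1%:M
  /\ orth_frame (avg_proj y) (fr y i) *m (orth_frame (avg_proj y) (fr y i))^T =
     avg_proj y.
Proof.
move=> Ui; have FF := pou_frame_isometry phi hO Ui.
by split; [apply: orth_frame_isometry|apply: orth_frame_proj] => //;
  [exact: avg_proj_grass|exact: avg_proj_dist1|exact: avg_proj_grass|
   exact: avg_proj_dist1].
Qed.

Lemma avg_proj_orth_frame y i : U i y ->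
  avg_proj y *m orth_frame (avg_proj y) (fr y i) = orth_frame (avg_proj y) (fr y i).
Proof.
by move=> Ui; rewrite /orth_frame !mulmxA -(grass_proj (avg_proj_grass y)).2.
Qed.

(** For the orthonormalized frames, [F_j F_j^T = P] and [P F_k = F_k], so
    [F_i^T F_j F_j^T F_k = F_i^T F_k]. *)
Lemma rectified_mul i j k y : U i y -> U j y -> U k y ->
  rectified i j y *m rectified j k y = rectified i k y.
Proof.
move=> Ui Uj Uk; rewrite !rectifiedE//.
rewrite mulmxA -(mulmxA _ (orth_frame _ (fr y j))) (orth_frame_pou Uj).2.
by rewrite -mulmxA avg_proj_orth_frame.
Qed.

Lemma rectified_orth i j y : U i y -> U j y ->
  (rectified i j y)^T *m rectified i j y = 1%:M.
Proof.
move=> Ui Uj; rewrite !rectifiedE// trmx_mul trmxK.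
rewrite mulmxA -(mulmxA _ (orth_frame _ (fr y i))) (orth_frame_pou Ui).2.
by rewrite -mulmxA avg_proj_orth_frame// (orth_frame_pou Uj).1.
Qed.

Lemma rectified_sym i j y : U i y -> U j y ->
  rectified i j y = invmx (rectified j i y).
Proof.
move=> Ui Uj; rewrite (orthogonal_invmx (rectified_orth Uj Ui)).
by rewrite (rectifiedE Ui Uj) (rectifiedE Uj Ui) [RHS]trmx_mul trmxK.
Qed.

(** The comparison passes through [V_i^T V_j]: each of the two orthonormalizations costs
    [2 sqrt 2 e], the Gram matrix one more [e]. *)
Lemma rectified_dist i j y : U i y -> U j y ->
  frob (Omega i j y - rectified i j y) <= 9 * e.
Proof.
move=> Ui Uj; rewrite frobC rectifiedE//.
apply: le_trans (frob_tri _ ((fr y i)^T *m fr y j) _) _.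
have h1 := orth_frame_dist (avg_proj_grass y) (pou_frame_isometry phi hO Ui)
  (pou_frame_isometry phi hO Uj) (avg_proj_dist1 Ui) (avg_proj_dist1 Uj).
have h2 := pou_frame_gram_approx phi e_gt0 hO Ui Uj.
have h3 := avg_proj_dist Ui; have h4 := avg_proj_dist Uj.
apply: le_trans (lerD h1 (ltW h2)) _.
apply: le_trans (lerD (lerD (ltW h3) (ltW h4)) (lexx _)) _.
exact: four_sqrt2_le.
Qed.

(** * Continuity and homotopy class of the rectified cocycle *)

Section Coordinates.
Variable iota : I -> nat.
Hypothesis iota_inj : injective iota.
Hypothesis iota_gt0 : forall i, (1 <= iota i)%N.

Local Notation emb y m :=
  (@embed_mx R _ d (fun k => iota (@pou_index _ _ _ _ phi y k)) m).

Lemma closest_point_cl_map y m : iota_bound d iota (pou_supp phi y) m ->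
  closest_point d (cl_map phi iota Omega y) =
  pad (emb y m *m avg_proj y *m (emb y m)^T).
Proof.
move=> hm; have [a [b [ab hP]]] := avg_projP y; apply: closest_pointE.
exact: (cl_map_spectral_proj iota_inj iota_gt0 ab hP hm).
Qed.

(** The isometry [emb] cancels, which turns a product of [y]-dependent size into sums of functions
    known to be continuous in [y]. *)
Lemma frame_gram_projE i j y m a b : iota_bound d iota (pou_supp phi y) m ->
  frame_gram_proj i j y a b = \sum_(s < m) (\sum_(r < m)
    local_frame phi iota Omega i y r a *
    closest_point d (cl_map phi iota Omega y) r s) *
    local_frame phi iota Omega j y s b.
Proof.
move=> hm; rewrite (closest_point_cl_map hm).
have EE := emb_isometry iota_inj iota_gt0 hm.
transitivity (((emb y m *m fr y i)^T *m
    (emb y m *m avg_proj y *m (emb y m)^T) *m (emb y m *m fr y j)) a b).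
  rewrite trmx_mul !mulmxA -(mulmxA _ (emb y m)^T (emb y m)) EE mulmx1.
  by rewrite -(mulmxA _ (emb y m)^T (emb y m)) EE mulmx1.
rewrite mxE; apply: eq_bigr => s _; rewrite local_frame_frame mxE; congr (_ * _).
by apply: eq_bigr => r _; rewrite local_frame_frame pad_ord mxE.
Qed.

Let U_open i : open (U i). Proof. exact: cU.1. Qed.

Let cO : pointwise_continuous (U := U) Omega.
Proof. exact: cocycle_continuous hO. Qed.

Lemma cl_map_domain y : spectral_domain d (cl_map phi iota Omega y).
Proof.
apply: (near_spectral_domain (e := Num.sqrt 2 * e)).
  by rewrite mulr_gt0 ?sqrtr_gt0//= sqrt2_e_le.
exact: (cl_map_thick phi iota_inj iota_gt0 cU e_gt0 hO y).
Qed.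

Lemma continuous_frame_gram_proj i j y : U i y -> U j y ->
  {for y, continuous (frame_gram_proj i j)}.
Proof.
move=> Ui Uj; apply: continuous_at_mx => a b.
(* One bound [m] serves all points near [y], so the sums have fixed length there. *)
have [q [uq hq]] := pou_near phi y; have [m hm] := iota_bound_exists d iota q.
apply: near_continuous_at.
  apply: filterS hq => z hz; apply: (@frame_gram_projE _ _ _ m) => k.
  by rewrite mem_pou_supp => /hz; exact: hm.
apply: continuous_at_sum => s; apply: continuous_atM; last first.
  exact: continuous_at_local_frame.
apply: continuous_at_sum => r; apply: continuous_atM.
  exact: continuous_at_local_frame.
apply: (@continuous_comp _ _ _ (fun z => closest_point d (cl_map phi iota Omega z))
  (fun A : infmx R => A r s)); last exact: continuous_infmx_entry.
apply: (@continuous_comp _ _ _ (cl_map phi iota Omega) (closest_point d)).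
  exact: continuous_cl_map.
by apply: continuous_closest_point; exact: cl_map_domain.
Qed.

Lemma continuous_half_gram i y : U i y -> {for y, continuous (half_gram i)}.
Proof.
move=> Ui; apply: continuous_at_inv_sqrt.
  exact: continuous_frame_gram_proj.
have : nbhs y (U i) by apply: open_nbhs_nbhs.
by apply: filterS => z Uz; exact: frame_gram_proj_small.
Qed.

Lemma continuous_rectified i j y : U i y -> U j y ->
  {for y, continuous (rectified i j)}.
Proof.
move=> Ui Uj; apply: continuous_at_mulmx; last exact: continuous_half_gram.
apply: continuous_at_mulmx; first exact: continuous_half_gram.
exact: continuous_frame_gram_proj.
Qed.

Lemma rectified_cocycle : approx_cocycle U 0 rectified.
Proof.
split=> [i j|i j y [Uj Ui]|i j k y [[Uk Uj] Ui]].
- split=> [|y [Uj Ui]]; last exact: rectified_orth.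
  rewrite continuous_open_subspace; last exact: openI.
  by move=> y /set_mem[Uj Ui]; exact: continuous_rectified.
- exact: rectified_sym.
- by rewrite eqxx; exact: rectified_mul.
Qed.

(** The homotopy is the closest point to the classifying map of [Theta]; it is defined throughout
    because the weights [K] stay symmetric and invertible. *)
Lemma homotopic_rectified : homotopic_in R (grassmannian d)
  (closest_point d \o cl_map phi iota Omega) (cl_map phi iota rectified).
Proof.
pose K i (z : B * R) : 'M[R]_d :=
  (1 - clamp z.2) *: 1%:M + clamp z.2 *: half_gram i z.1.
pose Theta i j (z : B * R) : 'M[R]_d :=
  K i z *m frame_gram_proj i j z.1 *m K j z.
have K0 i y : K i (y, 0) = 1%:M.
  by rewrite /K /= clampE ?lexx ?ler01// subr0 scale1r scale0r addr0.
have K1 i y : K i (y, 1) = half_gram i y.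
  by rewrite /K /= clampE ?lexx ?ler01// subrr scale1r scale0r add0r.
(* [pou_interp phi phi] is [phi] at every time, as a partition of unity on the cylinders. *)
pose G := cl_map (pou_interp phi phi) iota Theta.
have GE y t : G (y, t) = cl_map phi iota (fun i j y => Theta i j (y, t)) y.
  apply: cl_map_ext => // j.
    by rewrite /= /interp /= mulrBl mul1r subrK.
  by rewrite /cylinder; apply/propext; split=> [[]|].
have cG : continuous G.
  apply: continuous_cl_map => i j [y t] [/= Uj _] [/= Ui _] a b.
  have cK k : U k y -> {for (y, t), continuous (K k)}.
    move=> Uk; apply: continuous_at_mx => r s.
    rewrite (_ : (fun _ => _) = (fun z : B * R =>
      (1 - clamp z.2) * (1%:M : 'M[R]_d) r s + clamp z.2 * half_gram k z.1 r s)).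
      apply: continuous_atD; apply: continuous_atM.
      - apply: continuous_atB; first exact: cst_continuous.
        exact: continuous_clamp_snd.
      - exact: cst_continuous.
      - exact: continuous_clamp_snd.
      apply: (@continuous_comp _ _ _ fst (fun y => half_gram k y r s)).
        exact: continuous_at_fst.
      apply: (@continuous_comp _ _ _ (half_gram k) (fun A : 'M[R]_d => A r s)).
        exact: continuous_half_gram.
      exact: coord_continuous.
    by apply/funext => z; rewrite !mxE.
  apply: (@continuous_comp _ _ _ (Theta i j) (fun A : 'M[R]_d => A a b)); last first.
    exact: coord_continuous.
  apply: continuous_at_mulmx; last exact: cK.
  apply: continuous_at_mulmx; first exact: cK.
  apply: (@continuous_comp _ _ _ fst (frame_gram_proj i j)).
    exact: continuous_at_fst.
  exact: continuous_frame_gram_proj.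
have hdom z : spectral_domain d (G z).
  case: z => y t; have [a [b [ab hP]]] := avg_projP y.
  have [m hm] := iota_bound_exists d iota (pou_supp phi y).
  have [|k|Q [c [c0 hQ]]] := @compressed_gap_proj R I _ d _ _
    (pou_weight_gt0 (phi := phi) (y := y)) _ _ _ _ ab hP (fun i => K i (y, t)).
  - move=> k; rewrite /K /= linearD /= !linearZ /= trmx1 half_gramT//.
    exact: pou_index_U.
  - apply: unitmx_inv_sqrt_path; last by rewrite clamp_ge0 clamp_le1.
    by apply: frame_gram_proj_small; exact: pou_index_U.
  exists (pad (emb y m *m Q *m (emb y m)^T)); rewrite GE.
  apply: (cl_map_spectral_proj iota_inj iota_gt0 _ hQ hm).
  by rewrite lexx c0.
apply/homotopicP; exists (closest_point d \o G); split=> [z|z|y|y].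
- apply: continuous_comp; first exact: cG.
  exact: continuous_closest_point.
- exact: (spectral_proj_grass (spectral_domainP (hdom z))).
(* At time 0 the weights are 1: the average differs from that of [Omega], its spectral projection
   does not. *)
- have [m hm] := iota_bound_exists d iota (pou_supp phi y).
  have [a [b [ab hP]]] := avg_projP y.
  rewrite /= (closest_point_cl_map hm); apply: closest_pointE; rewrite GE.
  apply: (cl_map_spectral_proj (a := a ^+ 2) (b := 0) iota_inj iota_gt0 _ _ hm).
    case/andP: ab => b0 ab; rewrite lexx exprn_gt0//; exact: le_lt_trans ab.
  have -> : (fun i j => Theta i j (y, 0)) =
      (fun i j => 1%:M *m frame_gram_proj i j y *m 1%:M).
    by apply/funext => i; apply/funext => j; rewrite /Theta (K0 i) (K0 j).
  apply: (compressed1_gap_proj (V := fun j => U j y)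
    (pou_weight_gt0 (y := y)) (pou_index_U (y := y)) _ ab hP).
  by move=> j k; exact: (cocycle_sym hO).
(* At time 1 the values already lie in Gr(d), where [closest_point] is the identity. *)
- have -> : (closest_point d \o G) (y, 1) = closest_point d (cl_map phi iota rectified y).
    rewrite /= GE; congr closest_point; apply: cl_map_ext => // i j.
    by rewrite /Theta (K1 i) (K1 j).
  apply: closest_point_grass.
  exact: (cl_map_exact_grass phi iota_inj iota_gt0 cU y rectified_cocycle).
Qed.

End Coordinates.

End Rectification.

(** * Independence of the partition of unity *)

Section ChangeOfPartition.
Context {R : realType} {B : topologicalType} {I : choiceType} {U : I -> set B}.
Variables (d : nat) (iota : I -> nat) (phi psi : partition_of_unity R U).
Hypothesis iota_inj : injective iota.
Hypothesis iota_gt0 : forall i, (1 <= iota i)%N.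
Hypothesis cU : is_indexed_open_cover U.
Variables (e : R) (Omega : I -> I -> B -> 'M[R]_d).
Hypothesis hO : approx_cocycle U e Omega.

Let Omega_fst i j (z : B * R) := Omega i j z.1.

Lemma cylinder_cover : is_indexed_open_cover (cylinder (R := R) U).
Proof.
split=> [i|].
  have -> : cylinder (R := R) U i = fst @^-1` U i.
    by apply/seteqP; split=> [z []|z].
  by apply: open_comp; [move=> z _; exact: continuous_at_fst|exact: cU.1].
apply/seteqP; split=> // -[y t] _; have [i Ui] := cover_point cU y.
by exists i.
Qed.

Lemma approx_cocycle_cylinder : approx_cocycle (cylinder U) e Omega_fst.
Proof.
have [hc hs hm] := hO; split=> [i j|i j [y t] [[Uj _] [Ui _]]|].
- split=> [|[y t] [[Uj _] [Ui _]]]; last by apply: (hc i j).2.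
  rewrite continuous_open_subspace; last first.
    by apply: openI; exact: cylinder_cover.1.
  move=> [y t] /set_mem[[/= Uj _] [/= Ui _]].
  apply: (@continuous_comp _ _ _ fst (Omega i j)); first exact: continuous_at_fst.
  have := (hc i j).1; rewrite continuous_open_subspace; last first.
    by apply: openI; exact: cU.1.
  by apply; apply: mem_set.
- exact: hs.
- by move=> i j k [y t] [[[Uk _] [Uj _]] [Ui _]]; apply: hm.
Qed.

(** [S] is left general to cover both uses: the thickened Grassmannian for [Omega] and Gr(d) itself
    for the exact cocycle. Membership is a pointwise estimate, available for every partition over
    the cylinders. *)
Lemma homotopic_cl_map (S : set (infmx R)) :
  (forall (theta : partition_of_unity R (cylinder U)) z,
     S (cl_map theta iota Omega_fst z)) ->
  homotopic_in R S (cl_map phi iota Omega) (cl_map psi iota Omega).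
Proof.
move=> hS; apply/homotopicP.
exists (cl_map (pou_interp phi psi) iota Omega_fst); split.
- apply: continuous_cl_map; apply: cocycle_continuous approx_cocycle_cylinder.
  exact: cylinder_cover.1.
- exact: hS.
- move=> y; apply: cl_map_ext => // j.
    by rewrite /= /interp /= clampE ?lexx ?ler01// subr0 mul1r mul0r addr0.
  by rewrite /cylinder; apply/propext; split=> [[]|].
- move=> y; apply: cl_map_ext => // j.
    by rewrite /= /interp /= clampE ?lexx ?ler01// subrr mul1r mul0r add0r.
  by rewrite /cylinder; apply/propext; split=> [[]|].
Qed.

End ChangeOfPartition.

(** * The exact cocycle near an approximate one *)

Lemma exists_iota (I : countType) :
  exists iota : I -> nat, injective iota /\ forall i, (1 <= iota i)%N.
Proof.
exists (fun i => (choice.pickle i).+1); split=> // i j [].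
exact: (pcan_inj choice.pickleK).
Qed.

Lemma homotopy_class_exact (R : realType) (B : topologicalType) (I : choiceType)
    (U : I -> set B) (d : nat) (Lambda : I -> I -> B -> 'M[R]_d)
    (phi : partition_of_unity R U) (iota : I -> nat) :
  is_indexed_open_cover U -> injective iota -> (forall i, (1 <= iota i)%N) ->
  approx_cocycle U 0 Lambda ->
  homotopy_classes R B (grassmannian d) (cl phi iota 0 Lambda).
Proof.
move=> cU iota_inj iota_gt0 hL; rewrite /cl mulr0 /thick_grassmannian eqxx.
exists (cl_map phi iota Lambda) => //; split.
  by apply: continuous_cl_map; apply: cocycle_continuous hL; exact: cU.1.
by move=> y; exact: (cl_map_exact_grass phi iota_inj iota_gt0 cU y hL).
Qed.

Theorem theorem4p27 (R : realType) (B : topologicalType) (I : countType)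
    (U : I -> set B) (d : nat) (e : R) (Omega : I -> I -> B -> 'M[R]_d) :
  paracompact B ->
  is_indexed_open_cover U ->
  (1 <= d)%N ->
  0 <= e <= Num.sqrt 2 / 4 ->
  approx_cocycle U e Omega ->
  exists Lambda : I -> I -> B -> 'M[R]_d,
    [/\ approx_cocycle U 0 Lambda,
        (forall (phi : partition_of_unity R U) (iota : I -> nat),
           injective iota -> (forall i, (1 <= iota i)%N) ->
           homotopy_classes R B (grassmannian d) (cl phi iota 0 Lambda) /\
           cl phi iota 0 Lambda = pi_star d (cl phi iota e Omega)) &
        (cocycle_dist U Omega Lambda <= (9 * e)%:E)%E].
Proof.
move=> pB cU _ /andP[e0 e_le] hO.
have thick0 : thick_grassmannian d (Num.sqrt 2 * 0) = grassmannian d :> set (infmx R).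
  by rewrite mulr0 /thick_grassmannian eqxx.
have cO (phi : partition_of_unity R U) iota : continuous (cl_map phi iota Omega).
  by apply: continuous_cl_map; apply: cocycle_continuous hO; exact: cU.1.
have [ee|en] := eqVneq e 0.
  (* For [e = 0] the cocycle is already exact; its classifying map lies in Gr(d), which
     [closest_point] fixes pointwise. *)
  rewrite ee in hO *; exists Omega; split=> //.
    move=> phi iota iota_inj iota_gt0; split; first exact: homotopy_class_exact.
    have grO := fun y => cl_map_exact_grass phi iota_inj iota_gt0 cU y hO.
    rewrite /cl thick0; apply: push_homotopy_class => //.
      by move=> A gA; exists A; exact: grass_spectral_proj.
    rewrite (_ : closest_point d \o _ = cl_map phi iota Omega).
      exact: homotopic_refl.
    by apply/funext => y /=; rewrite closest_point_grass.
  apply: ub_ereal_sup => _ [i [j [y [_ ->]]]].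
  by rewrite subrr frob0 mulr0.
have e_gt0 : 0 < e by rewrite lt_def en.
(* [Lambda] is fixed here, before [phi] and [iota] are given; [iota0] serves to prove its continuity
   and does not enter its definition. *)
have [phi0] := pou_exists (R := R) pB cU.
have [iota0 [iota0_inj iota0_gt0]] := exists_iota I.
have hL := rectified_cocycle phi0 cU e_gt0 e_le hO iota0_inj iota0_gt0.
exists (rectified phi0 Omega); split=> //; last first.
  apply: ub_ereal_sup => _ [i [j [y [[Uj Ui] ->]]]].
  by rewrite lee_fin; exact: rectified_dist.
move=> phi iota iota_inj iota_gt0; split; first exact: homotopy_class_exact.
have thickS : thick_grassmannian d (Num.sqrt 2 * e) `<=` spectral_domain (R := R) d.
  move=> A; apply: near_spectral_domain.
  by rewrite mulr_gt0 ?sqrtr_gt0//= sqrt2_e_le.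
rewrite /cl thick0; apply: push_homotopy_class => //.
  by move=> y; exact: (cl_map_thick phi iota_inj iota_gt0 cU e_gt0 hO y).
(* Three homotopies with [iota] unchanged: from [phi] to [phi0] for [Omega], from [Omega] to
   [Lambda] over [phi0], and back to [phi] for [Lambda]. *)
apply: (@homotopic_trans _ _ _ _ _ (closest_point d \o cl_map phi0 iota Omega)).
  apply: homotopic_closest_point thickS _.
  apply: (homotopic_cl_map phi phi0 cU hO) => theta z.
  apply: (cl_map_thick theta iota_inj iota_gt0 _ e_gt0 _ z).
    exact: cylinder_cover.
  exact: approx_cocycle_cylinder.
apply: (@homotopic_trans _ _ _ _ _ (cl_map phi0 iota (rectified phi0 Omega))).
  exact: (homotopic_rectified phi0 cU e_gt0 e_le hO iota_inj iota_gt0).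
apply: (homotopic_cl_map phi0 phi cU hL) => theta z.
apply: (cl_map_exact_grass theta iota_inj iota_gt0 _ z).
  exact: cylinder_cover.
exact: approx_cocycle_cylinder.
Qed.
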